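(* Let $q\in[1,\infty]$, let $\|\cdot\|$ be either the norm $\|\cdot\|_{L^{q}(\mathbb{S}_{1},\mathbb{R}^{d})}$ or the norm $\|\cdot\|_{W^{1,q}(\mathbb{S}_{1},\mathbb{R}^{d})}$, and let $\mathcal{K}$ be a tame knot class. Then the discrete Möbius energies $\mathcal{E}_{n}$ $\Gamma$-converge, as $n\to\infty$, to the Möbius energy $\mathcal{E}$ on $(\mathcal{C}_{1,\mathrm{p}}(\mathcal{K}),\|\cdot\|)$. That is: (i) whenever $\gamma_{n},\gamma\in\mathcal{C}_{1,\mathrm{p}}(\mathcal{K})$ satisfy $\|\gamma_{n}-\gamma\|\to 0$, then $\mathcal{E}(\gamma)\leq\liminf_{n\to\infty}\mathcal{E}_{n}(\gamma_{n})$; (ii) for every $\gamma\in\mathcal{C}_{1,\mathrm{p}}(\mathcal{K})$ there are $\gamma_{n}\in\mathcal{C}_{1,\mathrm{p}}(\mathcal{K})$ with $\|\gamma_{n}-\gamma\|\to 0$ and $\limsup_{n\to\infty}\mathcal{E}_{n}(\gamma_{n})\leq\mathcal{E}(\gamma)$.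
   Context: $\mathbb{S}_{L}$ is the circle of length $L$ and $d(\cdot,\cdot)$ its intrinsic (shortest arc) metric; $\mathbb{R}^{d}$ is the ambient Euclidean space. $\mathcal{C}$ is the set of closed curves $\gamma:\mathbb{S}_{1}\to\mathbb{R}^{d}$ of length $1$ parametrised by arc length (Lipschitz, $|\gamma'|=1$ a.e.). Möbius energy of $\gamma\in\mathcal{C}$: $$\mathcal{E}(\gamma)=\int_{\mathbb{S}_{1}}\int_{\mathbb{S}_{1}}\Big(\frac{1}{|\gamma(t)-\gamma(s)|^{2}}-\frac{1}{d(t,s)^{2}}\Big)\,ds\,dt\in[0,\infty],$$ where $1/0=+\infty$ (the integrand is nonnegative). $\mathcal{P}_{n}\subset\mathcal{C}$ is the set of closed equilateral polygons with $n$ segments, i.e. those $p\in\mathcal{C}$ for which there are consecutive points $a_{1},\dots,a_{n}$ on $\mathbb{S}_{1}$ (indices mod $n$) with $d(a_{i+1},a_{i})=1/n$ such that $p$ is affine on each arc $[a_{i},a_{i+1}]$; the $p(a_i)$ are the vertices. Discrete Möbius energy of $p\in\mathcal{P}_{n}$: $$\mathcal{E}_{n}(p)=\sum_{\substack{i,j=1\\ i\neq j}}^{n}\Big(\frac{1}{|p(a_{j})-p(a_{i})|^{2}}-\frac{1}{d(a_{j},a_{i})^{2}}\Big)d(a_{i+1},a_{i})\,d(a_{j+1},a_{j})\in[0,\infty].$$ The functionals are extended by $+\infty$ outside their natural domain; in particular $\mathcal{E}_{n}=+\infty$ on curves not in $\mathcal{P}_{n}$. $\mathcal{C}_{1,\mathrm{p}}=\mathcal{C}\cap\big(C^{1}\cup\bigcup_{n\in\mathbb{N}}\mathcal{P}_{n}\big)$.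 A knot class is an ambient isotopy class of embedded closed curves in $\mathbb{R}^d$ (classically $d=3$), and it is tame if it contains a polygonal curve. For a set $\mathcal{A}$ of curves, $\mathcal{A}(\mathcal{K})$ is the subset of those curves in $\mathcal{A}$ that belong to the knot class $\mathcal{K}$. $W^{1,q}(\mathbb{S}_{1},\mathbb{R}^{d})$ is the usual Sobolev space of closed curves. *)

(* Defs.v *)
(* A closed curve [S_1 -> R^d] is represented by a 1-periodic function
   [R -> 'rV[R]_d]; [`[0, 1[] is a fundamental domain of [S_1]. *)
From HB Require Import structures.
From mathcomp Require Export all_boot all_order all_algebra.
From mathcomp Require Export all_classical all_reals all_analysis.
Export Order.TTheory GRing.Theory Num.Theory.
Export numFieldNormedType.Exports.

Set Implicit Arguments.
Unset Strict Implicit.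
Unset Printing Implicit Defensive.

Local Open Scope classical_set_scope.
Local Open Scope ring_scope.

Section Curves.
Context {R : realType} {d : nat}.

Implicit Types (f g p : R -> 'rV[R]_d) (a : nat -> R).

Local Notation mu := (@lebesgue_measure R).

(* The library norm on ['rV[R]_d] is the sup norm (it defines the same
   topology and the same Lipschitz functions). *)
Definition eucl (v : 'rV[R]_d) : R := Num.sqrt (\sum_(i < d) v ord0 i ^+ 2).

(* With [r] in [0, 1[ the length of the positively oriented arc from [s] to
   [t], the other arc has length [1 - r]. *)
Definition circ_dist (t s : R) : R :=
  let r := (t - s) - (Num.floor (t - s))%:~R in Num.min r (1 - r).

Definition closed_curve f : Prop := forall t, f (t + 1) = f t.

Definition arclength_curves : set (R -> 'rV[R]_d) := [set f |
  [/\ closed_curve f,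
      [lipschitz f t | t in setT] &
      {ae mu, forall t, derivable f t 1 /\ eucl (derive1 f t) = 1} ] ].

Definition C1_curves : set (R -> 'rV[R]_d) := [set f |
  [/\ closed_curve f, (forall t, derivable f t 1) & continuous (derive1 f) ] ].

(* In [\bar R] one has [0^-1 = +oo].  The diagonal, where the integrand would
   be [+oo - +oo], is a null set and is left out. *)
Definition mobius_energy f : \bar R :=
  (\int[mu]_(t in `[0%R, 1%R[) \int[mu]_(s in `[0%R, 1%R[ `\ t)
     ((((eucl (f t - f s)) ^+ 2)%:E)^-1 - (((circ_dist t s) ^+ 2)%:E)^-1))%E.

Definition affine_on f (x y : R) : Prop :=
  forall c, 0 <= c <= 1 ->
    f ((1 - c) * x + c * y) = (1 - c) *: f x + c *: f y.

(* [a 0 < ... < a n = a 0 + 1] are lifts to [R] of [n] consecutive points of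
   the circle, [a n] and [a 0] being the same point of the circle. *)
Definition consecutive (n : nat) a : Prop :=
  (forall i, (i < n)%N -> a i < a i.+1) /\ a n = a 0%N + 1.

Definition equilateral_vertices (n : nat) p a : Prop :=
  [/\ arclength_curves p, consecutive n a,
      (forall i, (i < n)%N -> circ_dist (a i.+1) (a i) = n%:R^-1) &
      (forall i, (i < n)%N -> affine_on p (a i) (a i.+1)) ].

Definition equilateral_polygons (n : nat) : set (R -> 'rV[R]_d) :=
  [set p | exists a, equilateral_vertices n p a].

Definition discrete_energy_sum (n : nat) p a : \bar R :=
  (\sum_(i < n) \sum_(j < n | j != i)
     ((((eucl (p (a j) - p (a i))) ^+ 2)%:E)^-1
        - (((circ_dist (a j) (a i)) ^+ 2)%:E)^-1)
     * (circ_dist (a i.+1) (a i))%:E * (circ_dist (a j.+1) (a j))%:E)%E.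

(* The points [a i] are determined by [p] up to cyclic relabelling: were two
   of the equally spaced grids disjoint modulo 1, [p] would have no corner at
   all, hence be affine and periodic, that is constant.  So the infimum ranges
   over a single value when [p] is in [equilateral_polygons n], and it is
   [ereal_inf set0 = +oo] otherwise. *)
Definition discrete_mobius_energy (n : nat) p : \bar R :=
  ereal_inf [set discrete_energy_sum n p a | a in equilateral_vertices n p].

Definition embedded f : Prop :=
  [/\ closed_curve f, continuous f & set_inj `[0, 1[ f].

Definition self_homeomorphism (h : 'rV[R]_d -> 'rV[R]_d) : Prop :=
  continuous h /\ exists k, [/\ continuous k, cancel h k & cancel k h].

(* The curves are compared as subsets of the ambient space, irrespective of
   their parametrisations. *)
Definition ambient_isotopic f g : Prop :=
  exists F : R -> 'rV[R]_d -> 'rV[R]_d,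
    [/\ {within `[0, 1] `*` setT,
           continuous (fun x : R * 'rV[R]_d => F x.1 x.2)},
        (forall t, 0 <= t <= 1 -> self_homeomorphism (F t)),
        (forall v, F 0 v = v) &
        F 1 @` range f = range g].

Definition knot_class (K : set (R -> 'rV[R]_d)) : Prop :=
  exists2 f, embedded f & K = [set g | embedded g /\ ambient_isotopic f g].

Definition polygonal p : Prop :=
  closed_curve p /\
  exists n a, consecutive n a /\
    forall i, (i < n)%N -> affine_on p (a i) (a i.+1).

Definition tame (K : set (R -> 'rV[R]_d)) : Prop :=
  exists2 p, K p & polygonal p.

Definition C1p (K : set (R -> 'rV[R]_d)) : set (R -> 'rV[R]_d) :=
  arclength_curves `&`
    (C1_curves `|` \bigcup_(n in setT) equilateral_polygons n) `&` K.

Definition Lq_norm (q : \bar R) f : \bar R :=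
  'N[mu]_q[(fun t => (eucl (f t))%:E) \_ `[0, 1[].

(* Meant for Lipschitz [f], whose weak derivative is the a.e. derivative. *)
Definition W1q_norm (q : \bar R) f : \bar R :=
  (Lq_norm q f + Lq_norm q (derive1 f))%E.

End Curves.

(* Sequential Gamma-convergence on [X] for the convergence induced by [nrm]. *)
Definition Gamma_converges {R : realType} {V : zmodType} (X : set V)
    (nrm : V -> \bar R) (E_ : nat -> V -> \bar R) (E : V -> \bar R) : Prop :=
  (forall (g_ : nat -> V) (g : V), (forall n, X (g_ n)) -> X g ->
     nrm (g_ n - g) @[n --> \oo] --> 0%E ->
     (E g <= limn_einf (fun n => E_ n (g_ n)))%E)
  /\
  (forall g : V, X g -> exists g_ : nat -> V,
     [/\ forall n, X (g_ n),
         nrm (g_ n - g) @[n --> \oo] --> 0%E &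
         (limn_esup (fun n => E_ n (g_ n)) <= E g)%E]).

(* Main.v *)
(* Write k(t,s) = |g(t) - g(s)|^-2 - d(t,s)^-2 >= 0, so that the Moebius energy is the integral of k over the unit square.

   Lower bound.  On { d >= delta } the kernel is continuous and stable under uniform convergence, and the discrete energy is a Riemann sum of nonnegative kernel values of the polygon; so it is eventually at least the integral of k over { d >= delta } minus epsilon.  Convergence in L^q of Lipschitz curves is uniform.

   Recovery sequence.  Only finite E(g) matters.  A closed polygon has a corner, and near a corner k is homogeneous of degree -2, so each dyadic square contributes the same positive amount and the energy is infinite; hence g is C^1.  For n large an intermediate value argument in the chord length inscribes an equilateral n-gon in g; rescaled to length 1 it is C^1-close to g, and, the vertices lying on g, its discrete energy is at most a Riemann sum of k.  Away from the diagonal this sum is controlled by continuity.  Near the diagonal k is comparable to (l^2 - c^2) / l^4 with l the arc length and c the chord length, and l^2 - c^2 increases with the arc by the triangle inequality alone; so k at a vertex pair is at most a constant times k on the adjacent outer cell, and these contributions are bounded by the integral of k near the diagonal, which is small.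

   Knot class.  The difference p - g of the polygon and the curve, viewed as a vector field on the image of g, has small Lipschitz constant since g is bi-Lipschitz.  McShane's extension V gives the isotopy x + t V(x), each stage of which is a homeomorphism by the contraction principle. *)

(* Both norms are served by one argument. The lower bound uses only [L^q] convergence, which either
   norm gives; the recovery polygons are close to g in sup norm and in Lipschitz constant, which
   bounds both norms for every q. The vertices of a polygon start at an arbitrary offset, so in the
   lower bound uniform cells are matched with vertices by a cyclic shift, and pairs near the
   diagonal are dropped by nonnegativity. For the recovery sequence the obstacle is the diagonal:
   there the kernel is only integrable, so a value at a pair of vertices must be paid for by an
   integral over a cell, namely one whose arcs all contain the arc between the two vertices.
   Rescaling the inscribed polygon to length 1 costs nothing: for n chords of length h, the weight
   1/n^2 and the factor (nh)^-1 combine to h^2, and nh times the grid distance is at most the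
   distance of the vertices along g. The polygons exist only for n beyond a threshold depending on
   the accuracy; a diagonal choice, filled up by g itself for the remaining n, gives the
   sequence. *)
From HB Require Import structures.
Require Import Defs.
From mathcomp Require Import measurable_realfun ess_sup_inf ring lra.

Set Implicit Arguments.
Unset Strict Implicit.
Unset Printing Implicit Defensive.

Local Open Scope classical_set_scope.
Local Open Scope ring_scope.

(** * The Euclidean norm and the distance on the circle *)

Section Eucl.
Context {R : realType} {d : nat}.
Implicit Types u v w : 'rV[R]_d.

Definition dotp u v : R := (u *m v^T) ord0 ord0.

Lemma dotpC u v : dotp u v = dotp v u.
Proof. by rewrite /dotp -[in LHS](trmxK u) -trmx_mul mxE. Qed.

Lemma dotpDl u v w : dotp (u + v) w = dotp u w + dotp v w.
Proof. by rewrite /dotp mulmxDl mxE. Qed.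

Lemma dotpZl c u w : dotp (c *: u) w = c * dotp u w.
Proof. by rewrite /dotp -scalemxAl mxE. Qed.

Lemma dotpDr u v w : dotp w (u + v) = dotp w u + dotp w v.
Proof. by rewrite dotpC dotpDl !(dotpC w). Qed.

Lemma dotpZr c u w : dotp w (c *: u) = c * dotp w u.
Proof. by rewrite dotpC dotpZl dotpC. Qed.

Lemma dotpNl u w : dotp (- u) w = - dotp u w.
Proof. by rewrite -scaleN1r dotpZl mulN1r. Qed.

Lemma dotpNr u w : dotp w (- u) = - dotp w u.
Proof. by rewrite dotpC dotpNl dotpC. Qed.

Lemma dotpE u v : dotp u v = \sum_(i < d) u ord0 i * v ord0 i.
Proof. by rewrite /dotp mxE; apply: eq_bigr => i _; rewrite mxE. Qed.

Lemma sqr_eucl u : eucl u ^+ 2 = dotp u u.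
Proof.
rewrite sqr_sqrtr ?sumr_ge0// => [|i _]; last exact: sqr_ge0.
by rewrite dotpE; apply: eq_bigr => i _; rewrite expr2.
Qed.

Lemma eucl_ge0 u : 0 <= eucl u.
Proof. exact: sqrtr_ge0. Qed.

Lemma eucl_le_sqr u (c : R) : 0 <= c -> dotp u u <= c ^+ 2 -> eucl u <= c.
Proof. by move=> c0; rewrite -sqr_eucl ler_sqr// nnegrE eucl_ge0. Qed.

Lemma eucl_eq0 u : eucl u = 0 -> u = 0.
Proof.
move=> u0; have : dotp u u = 0 by rewrite -sqr_eucl u0 expr0n.
rewrite dotpE => /eqP; rewrite psumr_eq0 => [/allP h|i _]; last first.
  by rewrite -expr2 sqr_ge0.
apply/rowP => i; rewrite mxE; have := h i (mem_index_enum _).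
by rewrite -expr2 sqrf_eq0 => /eqP.
Qed.

Lemma euclZ c u : eucl (c *: u) = `|c| * eucl u.
Proof.
apply/eqP; rewrite -(@eqrXn2 _ 2)//; first last.
- by rewrite mulr_ge0 ?eucl_ge0.
- exact: eucl_ge0.
by rewrite exprMn !sqr_eucl dotpZl dotpZr real_normK ?num_real// mulrA expr2.
Qed.

Lemma eucl0 : eucl (0 : 'rV[R]_d) = 0.
Proof. by rewrite -(scale0r 0) euclZ normr0 mul0r. Qed.

Lemma euclN u : eucl (- u) = eucl u.
Proof. by rewrite -scaleN1r euclZ normrN1 mul1r. Qed.

Lemma euclB u v : eucl (u - v) = eucl (v - u).
Proof. by rewrite -euclN opprB. Qed.

Lemma dotp_le_eucl u v : dotp u v <= eucl u * eucl v.
Proof.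
have [/eucl_eq0 ->|u0] := eqVneq (eucl u) 0.
  by rewrite -(scale0r v) dotpZl mul0r mulr_ge0 ?eucl_ge0.
have [/eucl_eq0 ->|v0] := eqVneq (eucl v) 0.
  by rewrite -(scale0r u) dotpZr mul0r mulr_ge0 ?eucl_ge0.
have a0 : 0 < eucl u by rewrite lt_neqAle eq_sym u0 eucl_ge0.
have b0 : 0 < eucl v by rewrite lt_neqAle eq_sym v0 eucl_ge0.
have : 0 <= dotp (eucl v *: u - eucl u *: v) (eucl v *: u - eucl u *: v).
  by rewrite -sqr_eucl sqr_ge0.
rewrite !(dotpDl, dotpDr, dotpNl, dotpNr, dotpZl, dotpZr) -!sqr_eucl (dotpC v u).
move: (dotp u v) => c; set a := eucl u in a0 *; set b := eucl v in b0 *.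
have ab : 0 < a * b by rewrite mulr_gt0.
move=> h; rewrite -(ler_pM2l ab); nra.
Qed.

Lemma eucl_triangle u v : eucl (u + v) <= eucl u + eucl v.
Proof.
apply: eucl_le_sqr; first by rewrite addr_ge0 ?eucl_ge0.
rewrite !(dotpDl, dotpDr) (dotpC v u) -!sqr_eucl.
have := dotp_le_eucl u v; nra.
Qed.

Lemma eucl_dist_triangle w u v : eucl (u - v) <= eucl (u - w) + eucl (w - v).
Proof. by rewrite -{1}(subrK w u) -addrA; exact: eucl_triangle. Qed.

Lemma eucl_lerB_dist u v : `|eucl u - eucl v| <= eucl (u - v).
Proof.
have := eucl_triangle (u - v) v; have := eucl_triangle (v - u) u.
by rewrite !subrK (euclB v) ler_norml => *; lra.
Qed.

Lemma normr_le_eucl u : `|u| <= eucl u.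
Proof.
rewrite [leLHS]/Num.norm/= mx_normrE; apply: bigmax_le; first exact: eucl_ge0.
move=> [i j] _ /=; rewrite (ord1 i) -sqrtr_sqr ler_wsqrtr//.
by rewrite (bigD1 j)//= lerDl sumr_ge0// => k _; exact: sqr_ge0.
Qed.

Lemma ler_mx_norm_coord u i : `|u ord0 i| <= `|u|.
Proof.
rewrite [leRHS]/Num.norm/= mx_normrE.
exact: (@le_bigmax _ R _ 0 (fun ij => `|u ij.1 ij.2|) (ord0, i)).
Qed.

Lemma eucl_le_normr u : eucl u <= d%:R * `|u|.
Proof.
apply: eucl_le_sqr; first by rewrite mulr_ge0.
have [d0|d0] := posnP d.
  rewrite dotpE big1 ?sqr_ge0// => i _; exfalso.
  by have := ltn_ord i; rewrite [X in (_ < X)%N]d0.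
rewrite dotpE (@le_trans _ _ (\sum_(i < d) `|u| ^+ 2))//.
  apply: ler_sum => i _; rewrite -expr2 -[leLHS]real_normK ?num_real//.
  by rewrite lerXn2r ?nnegrE// ler_mx_norm_coord.
rewrite sumr_const card_ord exprMn -[leLHS]mulr_natl ler_wpM2r ?sqr_ge0//.
by rewrite expr2 -natrM ler_nat leq_pmulr.
Qed.

End Eucl.

Section CircDist.
Context {R : realType}.
Implicit Types (s t u : R) (m : int).

(** With [circ_distP] this says that the circle distance is the minimum of |t - s - m| over integers
    m; the metric properties below are all derived from these two facts, without returning to
    [Num.floor]. *)
Lemma circ_dist_le t s m : circ_dist t s <= `|t - s - m%:~R|.
Proof.
rewrite /circ_dist; set x := t - s.
have /andP[f1 f2] := floor_itv x; move: f1 f2; set fl := Num.floor x => f1 f2.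
rewrite rmorphD/= in f2.
have [k0|k0] := leP m fl.
  rewrite ge_min; apply/orP; left; rewrite -(ler_int R) in k0.
  by rewrite ger0_norm; lra.
rewrite ge_min; apply/orP; right.
have {}k0 : (fl + 1)%:~R <= m%:~R :> R by rewrite ler_int lezD1.
rewrite rmorphD/= in k0.
by rewrite ler0_norm; lra.
Qed.

Lemma circ_distP t s : exists m, circ_dist t s = `|t - s - m%:~R|.
Proof.
rewrite /circ_dist; set x := t - s.
have /andP[f1 f2] := floor_itv x; move: f1 f2; set fl := Num.floor x => f1 f2.
rewrite rmorphD/= in f2.
have [h|h] := leP (x - fl%:~R) (1 - (x - fl%:~R)).
  by exists fl; rewrite ger0_norm//; lra.
by exists (fl + 1); rewrite rmorphD/= ler0_norm; lra.
Qed.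

Lemma circ_dist_ge0 t s : 0 <= circ_dist t s.
Proof. by have [m ->] := circ_distP t s. Qed.

Lemma circ_dist_le_norm t s : circ_dist t s <= `|t - s|.
Proof. by have := circ_dist_le t s 0; rewrite subr0. Qed.

Lemma circ_dist_triangle u t s :
  circ_dist t s <= circ_dist t u + circ_dist u s.
Proof.
have [m ->] := circ_distP t u; have [n ->] := circ_distP u s.
apply: le_trans (circ_dist_le t s (m + n)) _; rewrite rmorphD/=.
apply: le_trans (ler_normD _ _).
by rewrite le_eqVlt; apply/orP; left; apply/eqP; congr `|_|; ring.
Qed.

Lemma circ_distC t s : circ_dist t s = circ_dist s t.
Proof.
wlog suff h : t s / circ_dist t s <= circ_dist s t.
  by apply/eqP; rewrite eq_le !h.
have [m ->] := circ_distP s t; apply: le_trans (circ_dist_le t s (- m)) _.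
by rewrite -normrN le_eqVlt rmorphN/=; apply/orP; left; apply/eqP; congr `|_|; ring.
Qed.

Lemma circ_distDz t s m : circ_dist (t + m%:~R) s = circ_dist t s.
Proof.
apply/eqP; rewrite eq_le; apply/andP; split.
  have [n ->] := circ_distP t s.
  apply: le_trans (circ_dist_le _ _ (n + m)) _.
  by rewrite le_eqVlt rmorphD/=; apply/orP; left; apply/eqP; congr `|_|; ring.
have [n ->] := circ_distP (t + m%:~R) s.
apply: le_trans (circ_dist_le _ _ (n - m)) _.
by rewrite le_eqVlt rmorphB/=; apply/orP; left; apply/eqP; congr `|_|; ring.
Qed.

Lemma circ_dist_perturb t' s' t s :
  circ_dist t s <= circ_dist t' s' + `|t - t'| + `|s - s'|.
Proof.
have := circ_dist_triangle t' t s; have := circ_dist_triangle s' t' s.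
have := circ_dist_le_norm t t'; have := circ_dist_le_norm s' s.
rewrite (distrC s' s); lra.
Qed.

Lemma circ_dist_eq0 t s : circ_dist t s = 0 -> exists m, t = s + m%:~R.
Proof.
have [m ->] := circ_distP t s => /eqP; rewrite normr_eq0 => /eqP h.
by exists m; lra.
Qed.

Lemma circ_distE t s : 0 <= t - s < 1 ->
  circ_dist t s = Num.min (t - s) (1 - (t - s)).
Proof.
move=> ts; rewrite /circ_dist.
have -> : Num.floor (t - s) = 0 by apply/floor_def; rewrite add0r.
by rewrite subr0.
Qed.

Lemma circ_dist_small t s : `|t - s| <= 2^-1 -> circ_dist t s = `|t - s|.
Proof.
wlog st : t s / s <= t.
  move=> h; have [/h//|ts] := leP s t.
  by rewrite circ_distC distrC; apply: h; exact: ltW.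
rewrite ger0_norm ?subr_ge0// => h.
by rewrite circ_distE ?min_l//; lra.
Qed.

Lemma circ_dist_le_half t s : circ_dist t s <= 2^-1.
Proof.
rewrite /circ_dist; set x := t - s.
set y := x - _; rewrite ge_min; have [//|h] := leP y 2^-1.
by apply/orP; right; lra.
Qed.

Lemma closed_curveDz (d : nat) (f : R -> 'rV[R]_d) t m :
  closed_curve f -> f (t + m%:~R) = f t.
Proof.
move=> cf; have pos (n : nat) x : f (x + n%:R) = f x.
  by elim: n => [|n ih]; rewrite ?addr0// -natr1 addrA cf.
case: m => n; first exact: pos.
by rewrite NegzE rmorphN/= -(pos n.+1 (t - _)) subrK.
Qed.

End CircDist.

(** * Lipschitz curves *)

Section Lip.
Context {R : realType} {d : nat}.
Implicit Types (f g : R -> 'rV[R]_d).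

(** Comparing chord and arc needs the constant itself, and in the Euclidean norm: an arclength curve
    has constant 1. *)
Definition eucl_lipschitz (c : R) f := forall t s, eucl (f t - f s) <= c * `|t - s|.

Lemma lipschitz_eucl f : [lipschitz f t | t in setT] ->
  exists2 c, 0 < c & eucl_lipschitz c f.
Proof.
move=> /pinfty_ex_gt0[c c0 fc]; exists (d%:R * c + 1).
  by rewrite ltr_wpDl// mulr_ge0// ltW.
move=> t s; apply: le_trans (eucl_le_normr _) _.
apply: (@le_trans _ _ (d%:R * (c * `|t - s|))).
  by rewrite ler_wpM2l//; apply: (fc (t, s)).
by rewrite mulrA ler_wpM2r// lerDl.
Qed.

Lemma eucl_lipschitzW f c : eucl_lipschitz c f -> [lipschitz f t | t in setT].
Proof.
move=> fc.
have pf : ProperFilter (globally ([set: R] `*` [set: R])).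
  exact: (globally_properfilter (a := (0, 0))).
apply: (@klipschitzW _ _ _ c) => -[t s] _ /=.
exact: le_trans (normr_le_eucl _) (fc _ _).
Qed.

Lemma derivable_eucl f t e : derivable f t 1 -> 0 < e ->
  exists2 r, 0 < r & forall s, `|s - t| < r ->
    eucl (f s - f t - (s - t) *: derive1 f t) <= e * `|s - t|.
Proof.
move=> fd e0.
have fd' : (fun h => h^-1 *: (f (h + t) - f t)) @ (0:R)^' --> derive1 f t.
  rewrite /derive1; move: fd; rewrite /derivable.
  set g := (fun h => _); set g' := (fun h => _).
  by suff -> : g = g' by []; apply/funext => h; rewrite /g /g' /= [h *: 1]mulr1.
have e1 : 0 < e / (d%:R + 1) by rewrite divr_gt0// ltr_wpDl.
move/cvgrPdist_le : fd' => /(_ _ e1) [r /= r0 hr].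
exists r => // s st.
have [->|sNt] := eqVneq s t; first by rewrite !subrr scale0r subr0 eucl0 normr0 mulr0.
have st0 : s - t != 0 by rewrite subr_eq0.
have := hr (s - t); rewrite /= sub0r normrN subrK => /(_ st st0) h.
rewrite (_ : _ - _ = (s - t) *: - (derive1 f t - (s - t)^-1 *: (f s - f t))); last first.
  by rewrite opprB scalerBr scalerA divff// scale1r.
rewrite euclZ euclN mulrC ler_wpM2r// (le_trans (eucl_le_normr _))//.
apply: (@le_trans _ _ (d%:R * (e / (d%:R + 1)))); first by rewrite ler_wpM2l.
by rewrite mulrCA ler_piMr ?(ltW e0)// ler_pdivrMr ?ltr_wpDl// mul1r lerDl.
Qed.

(* [phi] need not be continuous: at the supremum of the times up to which the bound holds, monotonicity of [phi] suffices. *)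
Lemma right_local_bound f (c : R) (phi : R -> R) x y : x <= y ->
  eucl_lipschitz c f -> {homo phi : s t / s <= t} ->
  (forall t, x <= t < y -> exists2 r, 0 < r & forall s, t <= s < t + r ->
     eucl (f s - f t) <= phi s - phi t) ->
  eucl (f y - f x) <= phi y - phi x.
Proof.
move=> xy fc phi_nd loc.
pose S := [set t | x <= t <= y /\ eucl (f t - f x) <= phi t - phi x].
have Sx : S x by split; rewrite ?lexx ?xy// !subrr eucl0.
have hS : has_sup S by split; [exists x|exists y => t [/andP[]]].
pose z := sup S.
have xz : x <= z by apply: ub_le_sup Sx; case: hS.
have zy : z <= y by apply: ge_sup; [exists x|move=> t [/andP[]]].
have Sz : S z.
  split; first by rewrite xz.
  apply/ler_addgt0Pr => e e0.
  have k0 : 0 < `|c| + 1 by rewrite ltr_wpDl.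
  have [t St zt] := sup_adherent (divr_gt0 e0 k0) hS.
  have tz : t <= z by apply: ub_le_sup St; case: hS.
  case: St => txy ht.
  have := eucl_dist_triangle (f t) (f z) (f x).
  have : eucl (f z - f t) <= e.
    apply: le_trans (fc _ _) _; rewrite ger0_norm ?subr_ge0//.
    apply: (@le_trans _ _ ((`|c| + 1) * (z - t))).
      by rewrite ler_wpM2r ?subr_ge0// (le_trans (ler_norm _))// lerDl.
    by rewrite mulrC -ler_pdivlMr// lerBlDr -lerBlDl ltW.
  have := phi_nd _ _ tz; lra.
have [zey|zy'] := eqVneq z y; first by case: Sz => _; rewrite zey.
have {}zy : z < y by rewrite lt_neqAle zy'.
have [|r r0 hr] := loc z; first by rewrite xz.
pose s := Num.min y (z + r / 2).
have zs : z < s by rewrite lt_min zy ltrDl divr_gt0.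
have sr : s < z + r.
  apply: (@le_lt_trans _ _ (z + r / 2)); first by rewrite ge_min lexx orbT.
  by rewrite ltrD2l; lra.
have sy : s <= y by rewrite ge_min lexx.
suff /(ub_le_sup) : S s by move=> /(_ hS.2); rewrite leNgt zs.
split; first by rewrite sy andbT (le_trans xz)// ltW.
have := hr s; rewrite (ltW zs) sr => /(_ isT).
have := eucl_dist_triangle (f z) (f s) (f x).
case: Sz => _; lra.
Qed.

Local Notation mu := (@lebesgue_measure R).

(** The exceptional null set is covered by an open set U of small measure. At points of it the
    growth of f is charged, at the crude rate c, to the measure of U; at all other points it is
    charged to M plus a small error. The control function adds the two charges and
    [right_local_bound] integrates the local estimates. *)
Lemma ae_derivative_lipschitz f (M : R) : [lipschitz f t | t in setT] -> 0 <= M ->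
  {ae mu, forall t, derivable f t 1 /\ eucl (derive1 f t) <= M} ->
  eucl_lipschitz M f.
Proof.
move=> /lipschitz_eucl[c c0 fc] M0 [N [mN N0 hN]].
suff main x y : x <= y -> eucl (f y - f x) <= M * (y - x).
  move=> t s; have [st|ts] := leP s t.
    by rewrite ger0_norm ?subr_ge0//; exact: main.
  by rewrite euclB distrC ger0_norm ?subr_ge0 ?(ltW ts)//; exact/main/ltW.
move=> xy; apply/ler_addgt0Pr => e e0.
(* The final error is e' (y - x) from the derivative and at most c e' from U, together e. *)
pose e' := e / (y - x + c); have yx0 : 0 < y - x + c by lra.
have e'0 : 0 < e' by rewrite divr_gt0.
have [|U [oU NU muU]] := @lebesgue_regularity_outer R N e' mN _ e'0.
  by rewrite [X in (X < _)%E](_ : _ = 0%E) ?ltry.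
have mU : measurable U by exact: open_measurable.
have {}muU : (mu U < e'%:E)%E.
  apply: le_lt_trans muU; rewrite -(setDUK NU).
  apply: (@le_trans _ _ (mu N + mu (U `\` N))%E).
    by apply: measureU2 => //; exact: measurableD.
  by rewrite N0 add0e setDUK.
pose m t := fine (mu (U `&` `]x, t])).
have mfin (A : set R) : measurable A -> mu (U `&` A) \is a fin_num.
  move=> mA; rewrite ge0_fin_numE//; apply: le_lt_trans (lt_trans muU (ltry _)).
  by apply: le_measure; rewrite ?inE//; exact: measurableI.
have mD s t : x <= s -> s <= t -> m t - m s = fine (mu (U `&` `]s, t])).
  move=> xs st; rewrite /m.
  have -> : U `&` `]x, t] = (U `&` `]x, s]) `|` (U `&` `]s, t]).
    rewrite -setIUr; congr (_ `&` _); apply/seteqP; split => z /=; rewrite !in_itv/=.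
      by move=> /andP[-> ->]; rewrite andbT/=; have [] := leP z s; [left|right].
    by move=> [/andP[-> zs]|/andP[zs ->]]; rewrite ?andbT/= ?(le_trans zs)// (le_lt_trans xs).
  rewrite measureU//; [|exact: measurableI|exact: measurableI|]; last first.
    apply/seteqP; split => z //= [[_ +] [_ +]]; rewrite !in_itv/= => /andP[_ zs] /andP[].
    by rewrite ltNge zs.
  by rewrite fineD ?mfin// addrC addKr.
(* The [Num.max] freezes the function to the left of x, because [right_local_bound] asks for
   monotonicity on the whole line. *)
pose phi t := (M + e') * Num.max t x + c * m (Num.max t x).
have m_nd s t : x <= s -> s <= t -> m s <= m t.
  by move=> xs st; rewrite -subr_ge0 mD// fine_ge0.
have : eucl (f y - f x) <= phi y - phi x.
  apply: (right_local_bound xy fc).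
    move=> s t st; have st' : Num.max s x <= Num.max t x by rewrite ge_max !le_max st lexx orbT.
    apply: lerD; first by rewrite ler_wpM2l// addr_ge0// ltW.
    by rewrite ler_wpM2l ?(ltW c0)// m_nd// le_max lexx orbT.
  move=> t /andP[xt ty].
  have [Nt|Nt] := pselect (N t).
    have /nbhs_ballP[r /= r0 tr] := open_nbhs_nbhs (conj oU (NU _ Nt)).
    exists r => // s /andP[ts sr].
    have xs := le_trans xt ts.
    rewrite /phi !max_l//.
    have -> : (M + e') * s + c * m s - ((M + e') * t + c * m t) =
      (M + e') * (s - t) + c * (m s - m t) by ring.
    rewrite mD// (_ : U `&` _ = `]t, s]%classic); last first.
      apply/setIidr => z/=; rewrite in_itv/= => /andP[tz zs]; apply: tr.
      by rewrite /ball/= ltr0_norm ?subr_lt0//; lra.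
    rewrite lebesgue_measure_itv/= lte_fin.
    have -> : fine (if t < s then (s%:E - t%:E)%E else 0%R) = s - t.
      by case: ifPn => //; rewrite -leNgt => st; rewrite (@le_anti _ _ s t) ?st// subrr.
    apply: le_trans (fc _ _) _; rewrite ger0_norm ?subr_ge0// lerDr.
    by rewrite mulr_ge0 ?subr_ge0// addr_ge0// ltW.
  have [fd fM] : derivable f t 1 /\ eucl (derive1 f t) <= M.
    by apply: contrapT => h; apply: Nt; exact: hN.
  have [r r0 hr] := derivable_eucl fd e'0.
  exists r => // s /andP[ts sr].
  have xs := le_trans xt ts.
  rewrite /phi !max_l//.
  have := hr s; rewrite ger0_norm ?subr_ge0// ltrBlDl => /(_ sr) h.
  have := eucl_triangle (f s - f t - (s - t) *: derive1 f t) ((s - t) *: derive1 f t).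
  rewrite subrK euclZ ger0_norm ?subr_ge0//.
  have : (s - t) * eucl (derive1 f t) <= (s - t) * M by rewrite ler_wpM2l ?subr_ge0.
  have : c * m t <= c * m s by rewrite ler_wpM2l ?(ltW c0)// m_nd.
  lra.
rewrite /phi !max_l// => h; apply: (le_trans h).
have -> : M * (y - x) + e = M * (y - x) + e' * (y - x + c).
  by rewrite /e' divfK// gt_eqF.
have : c * (m y - m x) <= c * e'.
  rewrite ler_wpM2l ?(ltW c0)// mD// -lee_fin fineK ?mfin//.
  apply: le_trans (ltW muU).
  by apply: le_measure; rewrite ?inE//; exact: measurableI.
lra.
Qed.

Lemma arclength_lipschitz f : arclength_curves f -> eucl_lipschitz 1 f.
Proof.
move=> [_ fl fd]; apply: ae_derivative_lipschitz => //.
case: fd => N [mN N0 hN]; exists N; split => // t /= ht.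
by apply: hN => /= -[td t1]; apply: ht; rewrite t1.
Qed.

Lemma arclength_circ_dist f t s : arclength_curves f ->
  eucl (f t - f s) <= circ_dist t s.
Proof.
move=> fA; have [m ->] := circ_distP t s.
have -> : f s = f (s + m%:~R) by rewrite closed_curveDz//; case: fA.
by rewrite -addrA -opprD; have := arclength_lipschitz fA t (s + m%:~R); rewrite mul1r.
Qed.

End Lip.

(** * The energy as an integral over the unit square *)

Section Energy.
Context {R : realType} {d : nat}.
Implicit Types (f g p : R -> 'rV[R]_d).
Local Notation mu := (@lebesgue_measure R).

(* On the diagonal, [0^-1 = 0] gives the value [0]. *)
Definition mobius_kernel f (t s : R) : R :=
  (eucl (f t - f s) ^+ 2)^-1 - (circ_dist t s ^+ 2)^-1.

Local Notation K := mobius_kernel.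

Lemma mobius_kernelC f t s : K f t s = K f s t.
Proof. by rewrite /K euclB circ_distC. Qed.

Lemma mobius_kernelDz f t s m n : closed_curve f ->
  K f (t + m%:~R) (s + n%:~R) = K f t s.
Proof.
move=> cf; rewrite /K !closed_curveDz// circ_distDz circ_distC circ_distDz.
by rewrite (circ_distC s).
Qed.

Lemma mobius_kernel_diag f t m : closed_curve f -> K f (t + m%:~R) t = 0.
Proof.
move=> cf; rewrite /K closed_curveDz// circ_distDz subrr eucl0.
rewrite circ_dist_small ?subrr ?normr0 ?invr_ge0//.
by rewrite subrr.
Qed.

Lemma frac_01 (t : R) : exists m : int, t + m%:~R \in `[0, 1[.
Proof.
exists (- Num.floor t); rewrite in_itv/= rmorphN/=.
have /andP[f1 f2] := floor_itv t; rewrite rmorphD/= in f2.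
by apply/andP; split; lra.
Qed.

Lemma embedded_eq f t s : embedded f -> f t = f s -> circ_dist t s = 0.
Proof.
move=> [cf _ fi] fts.
have [m tm] := frac_01 t; have [n sn] := frac_01 s.
have h : t + m%:~R = s + n%:~R.
  apply: fi; rewrite ?inE//.
  by rewrite !closed_curveDz.
rewrite -(circ_distDz _ _ m) h circ_distDz circ_dist_small ?subrr ?normr0 ?invr_ge0//.
Qed.

Lemma embedded_eucl_gt0 f t s : embedded f -> circ_dist t s != 0 ->
  0 < eucl (f t - f s).
Proof.
move=> ef ts; rewrite lt_neqAle eucl_ge0 andbT eq_sym; apply: contra ts => /eqP.
move=> /eucl_eq0 h; apply/eqP; apply: (embedded_eq ef).
by apply/eqP; rewrite -subr_eq0 h.
Qed.

Lemma mobius_kernel_ge0 f t s : embedded f -> arclength_curves f -> 0 <= K f t s.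
Proof.
move=> ef fA; have [ts|ts] := eqVneq (circ_dist t s) 0.
  have [m ->] := circ_dist_eq0 ts.
  by rewrite mobius_kernel_diag//; case: ef.
have e0 := embedded_eucl_gt0 ef ts.
rewrite subr_ge0 lef_pV2 ?posrE ?exprn_gt0//.
  by rewrite lerXn2r ?nnegrE ?eucl_ge0 ?circ_dist_ge0// arclength_circ_dist.
by rewrite lt_neqAle eq_sym ts circ_dist_ge0.
Qed.

Lemma mobius_kernelE f t s : embedded f -> circ_dist t s != 0 ->
  (((eucl (f t - f s)) ^+ 2)%:E^-1 - ((circ_dist t s) ^+ 2)%:E^-1)%E = (K f t s)%:E.
Proof.
move=> ef ts; have e0 := embedded_eucl_gt0 ef ts.
by rewrite !inver !expf_eq0 /= (negbTE ts) gt_eqF.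
Qed.

Lemma measurable_inv_ge0 d' (T : measurableType d') (h : T -> R) :
  (forall x, 0 <= h x) -> measurable_fun setT h ->
  measurable_fun setT (fun x => (h x)^-1).
Proof.
move=> h0 mh.
(* The power -1 agrees with the total inverse at 0 as well, both being 0. *)
rewrite (_ : (fun _ => _) = (fun x => h x `^ (- 1))); last first.
  by apply/funext => x; rewrite powR_inv1.
exact: (measurableT_comp (measurable_powR _)).
Qed.

Lemma measurable_circ_dist :
  measurable_fun setT (fun z : R * R => circ_dist z.1 z.2).
Proof.
have mts : measurable_fun setT (fun z : R * R => z.1 - z.2).
  by apply: measurable_funB; [exact: measurable_fst|exact: measurable_snd].
have mfl : measurable_fun setT (fun z : R => z - (Num.floor z)%:~R).
  apply: measurable_funB => //; apply: nondecreasing_measurable => // x y xy.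
  by rewrite ler_int; exact: Num.Theory.le_floor.
pose h (x : R) := Num.min (x - (Num.floor x)%:~R) (1 - (x - (Num.floor x)%:~R)).
have mh : measurable_fun setT h by apply: measurable_minr => //; exact: measurable_funB.
exact: (measurableT_comp mh mts).
Qed.

Lemma measurable_mobius_kernel f : continuous f ->
  measurable_fun setT (fun z : R * R => K f z.1 z.2).
Proof.
move=> fc; apply: measurable_funB; last first.
  apply: measurable_inv_ge0; first by move=> x; rewrite sqr_ge0.
  by apply: measurable_funX; exact: measurable_circ_dist.
apply: measurable_inv_ge0; first by move=> x; rewrite sqr_ge0.
rewrite (_ : (fun _ => _) = (fun z : R * R =>
   \sum_(i < d) (f z.1 ord0 i - f z.2 ord0 i) ^+ 2)); last first.
  apply/funext => z; rewrite sqr_eucl dotpE; apply: eq_bigr => i _.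
  by rewrite !mxE expr2.
apply: measurable_sum => i; apply: measurable_funX.
have mfi : measurable_fun setT (fun t => f t ord0 i).
  apply: continuous_measurable_fun => t.
  by apply: (@continuous_comp _ _ _ f (fun v : 'rV[R]_d => v ord0 i)); [exact: fc|exact: coord_continuous].
by apply: measurable_funB; [apply: (measurableT_comp mfi)|apply: (measurableT_comp mfi)].
Qed.

Definition unit_square : set (R * R) := `[0, 1[ `*` `[0, 1[.
Local Notation Q := unit_square.

Lemma measurable_unit_square : measurable Q.
Proof. exact: measurableX. Qed.

(** Off the diagonal an embedded curve makes both inverses finite, and on the diagonal the real
    kernel is 0, so removing one point from each inner integral changes nothing. Tonelli for the
    nonnegative kernel then turns the iterated integral into one over the square. *)
Lemma mobius_energyE f : embedded f -> arclength_curves f ->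
  mobius_energy f = (\int[mu \x mu]_(z in Q) (K f z.1 z.2)%:E)%E.
Proof.
move=> ef fA; have cf : continuous f by case: ef.
have mK := measurable_mobius_kernel cf.
transitivity (\int[mu]_(t in `[0%R, 1%R[) \int[mu]_(s in `[0%R, 1%R[) (K f t s)%:E)%E.
  apply: eq_integral => t; rewrite inE/= => t01.
  transitivity (\int[mu]_(s in `[0%R, 1%R[ `\ t) (K f t s)%:E)%E.
    apply: eq_integral => s; rewrite inE/= => -[s01 /= st].
    apply: mobius_kernelE => //; apply/eqP => /circ_dist_eq0[m tm].
    apply: st; move: t01 s01; rewrite tm !in_itv/= => /andP[a1 a2] /andP[b1 b2].
    (* Two points of [[0, 1[] that differ by an integer coincide. *)
    have m0 : m = 0.
      by apply/eqP; rewrite eq_le -ltzD1 -(lerD2r 1) add0r -ltzD1 -(ltr_int R) -(ltr_int R _ (m + 1 + 1)) !rmorphD/=; apply/andP; split; lra.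
    by rewrite m0 addr0.
  rewrite [LHS]integral_mkcond [RHS]integral_mkcond; apply: eq_integral => s _.
  rewrite !patchE; case: ifPn => [|]; rewrite ?inE ?notin_setE => h.
    by rewrite mem_set//; case: h.
  case: ifPn => //; rewrite inE => h1.
  have -> : s = t by apply: contrapT => st; apply: h; split.
  by rewrite -{1}[t]addr0 (mobius_kernel_diag _ 0)//; case: ef.
pose F := ((fun z : R * R => (K f z.1 z.2)%:E) \_ Q)%E.
have mF : measurable_fun setT F.
  apply/(measurable_restrictT _ measurable_unit_square).
  apply/measurable_EFinP; exact: measurable_funS mK.
have F0 z : (0 <= F z)%E.
  rewrite /F patchE; case: ifPn => // _.
  by rewrite lee_fin mobius_kernel_ge0.
rewrite [RHS]integral_mkcond -/F [LHS]integral_mkcond.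
transitivity (\int[mu]_t fubini_F mu F t)%E; last exact/esym/fubini_tonelli1.
apply: eq_integral => t _; rewrite /fubini_F patchE; case: ifPn => h.
  rewrite [LHS]integral_mkcond; apply: eq_integral => s _; rewrite /F !patchE.
  rewrite in_setX /= h/=. by [].
rewrite integral0_eq// => s _; rewrite /F patchE in_setX/= (negbTE h)//.
Qed.

End Energy.

(** * The energy near and away from the diagonal *)

Section KernelIntegral.
Context {R : realType} {d : nat}.
Implicit Types (f : R -> 'rV[R]_d).
Local Notation mu := (@lebesgue_measure R).
Local Notation K := mobius_kernel.
Local Notation Q := (@unit_square R).

Definition kernel_integral f (A : set (R * R)) : \bar R :=
  (\int[mu \x mu]_(z in A) (K f z.1 z.2)%:E)%E.

Definition far (e : R) : set (R * R) := [set z | e <= circ_dist z.1 z.2].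

Lemma measurable_far e : measurable (far e).
Proof.
rewrite -[far e]setTI (_ : far e = (fun z => circ_dist z.1 z.2) @^-1` `[e, +oo[).
  by apply: measurable_circ_dist => //; exact: measurable_itv.
by apply/seteqP; split => z; rewrite /far/= in_itv/= andbT.
Qed.

(** Half-open, so that the cells of a partition tile the fundamental domain without overlap. *)
Definition cell (y : nat -> R) (i : nat) : set R := `[y i, y i.+1[.

Lemma measurable_cell2 (y : nat -> R) i j : measurable (cell y i `*` cell y j).
Proof. by apply: measurableX; exact: measurable_itv. Qed.

Lemma measure_cell2 (y : nat -> R) i j : y i <= y i.+1 -> y j <= y j.+1 ->
  (mu \x mu)%E (cell y i `*` cell y j) =
    ((y i.+1 - y i) * (y j.+1 - y j))%:E.
Proof.
move=> yi yj; have muc k : y k <= y k.+1 -> mu (cell y k) = (y k.+1 - y k)%:E.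
  move=> yk; rewrite lebesgue_measure_itv/= lte_fin.
  by case: ltP => // h; rewrite (@le_anti _ _ (y k) (y k.+1)) ?yk// subrr.
by rewrite EFinM -!muc//; apply: product_measure1E; exact: measurable_itv.
Qed.

Section fixed_curve.
Variable f : R -> 'rV[R]_d.
Hypotheses (ef : embedded f) (fA : arclength_curves f).

Let cf : continuous f. Proof. by case: ef. Qed.

Let mK A : measurable_fun A (fun z : R * R => (K f z.1 z.2)%:E).
Proof.
by apply/measurable_EFinP; apply: measurable_funS (measurable_mobius_kernel cf).
Qed.

Let K0 (z : R * R) : (0 <= (K f z.1 z.2)%:E)%E.
Proof. by rewrite lee_fin mobius_kernel_ge0. Qed.

Lemma kernel_integral_ge0 A : (0 <= kernel_integral f A)%E.
Proof. exact: integral_ge0. Qed.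

Lemma subset_kernel_integral A B : measurable A -> measurable B -> A `<=` B ->
  (kernel_integral f A <= kernel_integral f B)%E.
Proof. by move=> mA mB AB; apply: ge0_subset_integral => // *; first exact: mK. Qed.

(** In use, A is a product of cells cut by [far] and B the full product, whose measure is
    explicit. *)
Lemma kernel_integral_le_cst A B (c : R) : measurable A -> measurable B ->
  A `<=` B -> 0 <= c -> (forall z, A z -> K f z.1 z.2 <= c) ->
  (kernel_integral f A <= c%:E * (mu \x mu) B)%E.
Proof.
move=> mA mB AB c0 Kc; apply: (@le_trans _ _ (\int[mu \x mu]_(z in A) c%:E)%E).
  by apply: ge0_le_integral => //=; exact: mK.
rewrite integral_cst//; apply: lee_wpmul2l; first by rewrite lee_fin.
by apply: le_measure; rewrite ?inE.
Qed.

Lemma kernel_integral_ge_cst A (c : R) : measurable A ->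
  0 <= c -> (forall z, A z -> c <= K f z.1 z.2) ->
  (c%:E * (mu \x mu) A <= kernel_integral f A)%E.
Proof.
move=> mA c0 Kc; rewrite -integral_cst//.
by apply: ge0_le_integral => //=; exact: mK.
Qed.

(** The sets where the distance is at least 1/(m+1) increase to the square minus the set of distance
    0, on which the kernel vanishes; monotone convergence passes c on to one of them. *)
Lemma mobius_energy_far (c : R) : (c%:E < mobius_energy f)%E ->
  exists2 e, 0 < e & (c%:E < kernel_integral f (Q `&` far e))%E.
Proof.
move=> cE; pose F (m : nat) := Q `&` far m.+1%:R^-1.
have mF m : measurable (F m).
  by apply: measurableI; [exact: measurable_unit_square|exact: measurable_far].
have QF : kernel_integral f Q = kernel_integral f (\bigcup_m F m).
  rewrite /kernel_integral [LHS]integral_mkcond [RHS]integral_mkcond.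
  apply: eq_integral => z _; rewrite !patchE.
  case: ifPn => [|]; rewrite ?inE ?notin_setE => Qz; last first.
    by rewrite memNset// => -[m _ []].
  case: ifPn => //; rewrite notin_setE => nF.
  have [z0|z0] := eqVneq (circ_dist z.1 z.2) 0.
    have [m ->] := circ_dist_eq0 z0.
    by rewrite mobius_kernel_diag//; case: ef.
  exfalso; apply: nF.
  have {}z0 : 0 < circ_dist z.1 z.2 by rewrite lt_neqAle eq_sym z0 circ_dist_ge0.
  exists (Num.truncn (circ_dist z.1 z.2)^-1) => //; split => //=.
  rewrite /far/= invf_ple ?posrE//; apply/ltW.
  exact: truncnS_gt.
have cv : kernel_integral f (F m) @[m --> \oo] --> kernel_integral f (\bigcup_m F m).
  apply: ge0_nondecreasing_set_cvg_integral => //; last by move=> m; exact: mK.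
  move=> m n mn; rewrite subsetEset => z [Qz mz]; split => //.
  by apply: le_trans mz; rewrite lef_pV2 ?posrE// ler_nat.
apply: contrapT => nex.
move: cE; rewrite mobius_energyE// -/(kernel_integral f Q) QF -(cvg_lim _ cv)//.
rewrite ltNge => /negP; apply; apply: lime_le; first exact: cvgP cv.
apply: nearW => m; rewrite leNgt; apply/negP => h; apply: nex.
by exists m.+1%:R^-1.
Qed.

Lemma mobius_energy_near (e : R) : (mobius_energy f < +oo)%E -> 0 < e ->
  exists2 r, 0 < r & (kernel_integral f (Q `\` far r) <= e%:E)%E.
Proof.
move=> Efin e0; have E0 : (0 <= mobius_energy f)%E.
  by rewrite mobius_energyE//; exact: kernel_integral_ge0.
have Efin' : mobius_energy f \is a fin_num by rewrite ge0_fin_numE.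
have [|r r0 hr] := @mobius_energy_far (fine (mobius_energy f) - e).
  by rewrite EFinB fineK// lteBlDr// lteDl// ?fin_numE// lte_fin.
exists r => //; have mQ := @measurable_unit_square R; have mr := @measurable_far r.
have : mobius_energy f = (kernel_integral f (Q `&` far r) + kernel_integral f (Q `\` far r))%E.
  rewrite mobius_energyE// /kernel_integral -ge0_integral_setU//.
  - by rewrite setUIDK.
  - exact: measurableI.
  - exact: measurableD.
  - exact: mK.
  - by rewrite disj_set2E; apply/eqP/seteqP; split => // z [[_ ?] [_]].
move: hr; have := kernel_integral_ge0 (Q `\` far r).
have := kernel_integral_ge0 (Q `&` far r).
move: Efin' (kernel_integral _ _) (kernel_integral _ _).
case: (mobius_energy f) => // E _ [a| |] [b| |] //=.
by rewrite -EFinD !lee_fin !lte_fin => _ _ h [hE]; lra.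
Qed.

Lemma kernel_integral_cells (y : nat -> R) n (W : set (R * R)) :
  measurable W -> (forall i, y i <= y i.+1) -> y 0%N = 0 -> y n = 1 ->
  kernel_integral f (Q `&` W) =
  (\sum_(ij : 'I_n * 'I_n)
     kernel_integral f ((cell y ij.1 `*` cell y ij.2) `&` W))%E.
Proof.
move=> mW yS y0 yn.
have ymono i j : (i <= j)%N -> y i <= y j.
  by move=> /subnKC <-; elim: (j - i)%N => [|k ih]; rewrite ?addn0// addnS (le_trans ih).
pose F (ij : 'I_n * 'I_n) := (cell y ij.1 `*` cell y ij.2) `&` W.
have mF ij : measurable (F ij) by apply: measurableI => //; exact: measurable_cell2.
have cellU t : `[0, 1[%classic t -> exists i : 'I_n, cell y i t.
  rewrite /= in_itv/= => /andP[t0 t1].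
  have ex : exists i, t < y i by exists n; rewrite yn.
  case: (ex_minnP ex) => -[|i] ti imin; first by move: ti; rewrite y0 ltNge t0.
  have iN : (i < n)%N by apply: imin; rewrite yn.
  exists (Ordinal iN); rewrite /cell/= in_itv/= ti andbT leNgt.
  by apply/negP => /imin; rewrite ltnn.
have cell_inj (i j : 'I_n) t : cell y i t -> cell y j t -> i = j.
  rewrite /cell/= !in_itv/= => /andP[a1 a2] /andP[b1 b2].
  apply/val_inj/eqP; rewrite /= eqn_leq; apply/andP; split; rewrite leqNgt.
    by apply/negP => /ymono h; have := lt_le_trans b2 (le_trans h a1); rewrite ltxx.
  by apply/negP => /ymono h; have := lt_le_trans a2 (le_trans h b1); rewrite ltxx.
have cell01 (i : 'I_n) t : cell y i t -> `[0, 1[%classic t.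
  rewrite /cell/= !in_itv/= => /andP[a1 a2]; rewrite -y0 -yn.
  by rewrite (le_trans (ymono _ _ (leq0n i)) a1) (lt_le_trans a2)// ymono.
have QU : Q `&` W = \big[setU/set0]_(ij <- index_enum (('I_n * 'I_n)%type : finType)) F ij.
  rewrite -bigcup_seq; apply/seteqP; split => [z [[/= z1 z2] Wz]|z].
    have [i hi] := cellU _ z1; have [j hj] := cellU _ z2.
    by exists (i, j); rewrite //= mem_index_enum.
  by move=> [[i j] _ [[/= /cell01 ? /cell01 ?] ?]]; split.
rewrite /kernel_integral QU ge0_integral_bigsetU//.
- exact: index_enum_uniq.
- move=> [i j] [i' j'] _ _ [z [[[/= a b] _] [[/= a' b'] _]]].
  by rewrite (cell_inj _ _ _ a a') (cell_inj _ _ _ b b').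
- exact: mK.
Qed.

End fixed_curve.
End KernelIntegral.

(** * Perturbations away from the diagonal *)

Section Perturbation.
Context {R : realType}.

Lemma inv_sqr_dist (u v m r : R) : 0 < m -> m <= u -> m <= v -> `|u - v| <= r ->
  `|(u ^+ 2)^-1 - (v ^+ 2)^-1| <= 2 * r / m ^+ 3.
Proof.
move=> m0 mu mv uv.
have u0 : 0 < u by lra. have v0 : 0 < v by lra.
have -> : (u ^+ 2)^-1 - (v ^+ 2)^-1 = (v - u) * (u^-1 * (v^-1 * v^-1) + u^-1 * (u^-1 * v^-1)).
  by field; rewrite !gt_eqF.
have hu : 0 <= u^-1 <= m^-1 by rewrite invr_ge0 (ltW u0) lef_pV2.
have hv : 0 <= v^-1 <= m^-1 by rewrite invr_ge0 (ltW v0) lef_pV2.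
case/andP: hu => hu0 hu; case/andP: hv => hv0 hv.
have b1 : 0 <= u^-1 * (v^-1 * v^-1) <= m^-1 * (m^-1 * m^-1).
  by rewrite !mulr_ge0//= !ler_pM// mulr_ge0.
have b2 : 0 <= u^-1 * (u^-1 * v^-1) <= m^-1 * (m^-1 * m^-1).
  by rewrite !mulr_ge0//= !ler_pM// mulr_ge0.
rewrite normrM distrC.
have -> : 2 * r / m ^+ 3 = r * (2 * (m^-1 * (m^-1 * m^-1))).
  by field; rewrite gt_eqF.
rewrite ler_pM// [leLHS]ger0_norm; lra.
Qed.

Lemma lip2_continuous (g : R * R -> R) :
  (forall z w, `|g z - g w| <= `|z.1 - w.1| + `|z.2 - w.2|) -> continuous g.
Proof.
move=> glip z; apply/cvgrPdist_le => /= e e0.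
have e2 : 0 < e / 2 by rewrite divr_gt0.
apply/(@nbhs_ballP R (R * R)%type); exists (e / 2) => //= w [b1 b2]; apply: le_trans (glip _ _) _.
by move: b1 b2; rewrite /ball/=; lra.
Qed.

Context {d : nat}.
Implicit Types f p : R -> 'rV[R]_d.

(** The chord lengths of pairs at distance at least e form a compact set, by continuity on the
    closed square, and embeddedness keeps 0 out of it. *)
Lemma embedded_far_gap f (e : R) : embedded f -> arclength_curves f -> 0 < e ->
  exists2 m, 0 < m & forall t s, e <= circ_dist t s -> m <= eucl (f t - f s).
Proof.
move=> ef fA e0.
pose g (z : R * R) := eucl (f z.1 - f z.2).
have cg : continuous g.
  apply: lip2_continuous => z w; apply: le_trans (eucl_lerB_dist _ _) _.
  rewrite (_ : _ - _ = (f z.1 - f w.1) - (f z.2 - f w.2)); last first.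
    by apply/rowP => i; rewrite !mxE; ring.
  apply: le_trans (eucl_triangle _ _) _; rewrite euclN.
  by apply: lerD; rewrite -[leRHS]mul1r; exact: arclength_lipschitz.
have cd : continuous (fun z : R * R => circ_dist z.1 z.2).
  apply: lip2_continuous => z w; rewrite ler_norml.
  have := circ_dist_perturb z.1 z.2 w.1 w.2.
  have := circ_dist_perturb w.1 w.2 z.1 z.2.
  by rewrite (distrC w.1) (distrC w.2); lra.
pose A := (`[0, 1]%classic `*` `[0, 1]%classic) `&` far e.
have cA : compact A.
  apply: compact_closedI; first by apply: compact_setX; exact: segment_compact.
  have -> : far e = (fun z : R * R => circ_dist z.1 z.2) @^-1` `[e, +oo[%classic.
    by apply/seteqP; split => z; rewrite /far/= in_itv/= andbT.
  by apply: closed_comp => //; exact: interval_closed.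
have : compact (g @` A) by apply: continuous_compact => //; exact: continuous_subspaceT.
move=> /(compact_closed (@Rhausdorff R)) clA.
have : nbhs (0 : R) (~` (g @` A)).
  apply: open_nbhs_nbhs; split; first exact: closed_openC.
  move=> [z [_ ez] gz]; have : 0 < g z; last by rewrite gz ltxx.
  by apply: embedded_eucl_gt0 => //; rewrite gt_eqF// (lt_le_trans e0).
move=> /nbhs_ballP[m /= m0 hm]; exists m => // t s ets; rewrite leNgt; apply/negP => lt.
have [k tk] := frac_01 t; have [l sl] := frac_01 s.
have cf : closed_curve f by case: ef.
apply: (hm (eucl (f t - f s))).
  by rewrite /ball/= sub0r normrN ger0_norm ?eucl_ge0.
exists (t + k%:~R, s + l%:~R); last by rewrite /g/= !closed_curveDz.
split; last by rewrite /far/= circ_distDz circ_distC circ_distDz circ_distC.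
by move: tk sl; rewrite /= !in_itv/= => /andP[-> /ltW ->] /andP[-> /ltW ->].
Qed.

(** Nothing is asked of p beyond its two values. In the lower bound p is the approximating polygon;
    in the Riemann sums p is f itself and only the parameters move. *)
Lemma mobius_kernel_perturb f (e r : R) : embedded f -> arclength_curves f ->
  0 < e -> 0 < r ->
  exists2 h, 0 < h & forall p t s t' s', e <= circ_dist t s ->
    `|t - t'| <= h -> `|s - s'| <= h ->
    eucl (p t' - f t') <= h -> eucl (p s' - f s') <= h ->
    `|mobius_kernel p t' s' - mobius_kernel f t s| <= r.
Proof.
move=> ef fA e0 r0; have [m' m'0 hm'] := embedded_far_gap ef fA e0.
(* The halving leaves room: chords and distances start at 2m or more and change by at most 4h <= m,
   so they stay above m. *)
pose m := Num.min m' e / 2.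
have m0 : 0 < m by rewrite divr_gt0// lt_min m'0.
have m1 : 2 * m <= m' by rewrite mulrC divfK// ge_min lexx.
have m2 : 2 * m <= e by rewrite mulrC divfK// ge_min lexx orbT.
(* Each of the two inverse squares changes by at most 2 (4h) / m^3, which together is 16 h / m^3 <=
   r. *)
pose h := Num.min (m / 4) (r * m ^+ 3 / 16).
have m30 : 0 < m ^+ 3 by rewrite exprn_gt0.
have h0 : 0 < h.
  by rewrite lt_min; apply/andP; split; apply: divr_gt0 => //; exact: mulr_gt0.
have h1 : 4 * h <= m by rewrite mulrC -ler_pdivlMr// ge_min lexx.
have h2 : 16 * (h / m ^+ 3) <= r.
  rewrite mulrA ler_pdivrMr ?exprn_gt0// mulrC -ler_pdivlMr//.
  by rewrite ge_min lexx orbT.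
exists h => // p t s t' s' ets tt ss pt ps.
have fl := arclength_lipschitz fA.
have E1 : `|eucl (p t' - p s') - eucl (f t - f s)| <= 4 * h.
  apply: le_trans (eucl_lerB_dist _ _) _.
  rewrite (_ : _ - _ = ((p t' - f t') - (p s' - f s')) + ((f t' - f t) - (f s' - f s))); last first.
    by apply/rowP => i; rewrite !mxE; ring.
  apply: le_trans (eucl_triangle _ _) _.
  have := eucl_triangle (p t' - f t') (- (p s' - f s')).
  have := eucl_triangle (f t' - f t) (- (f s' - f s)).
  rewrite !euclN; have := fl t' t; have := fl s' s.
  rewrite (distrC t') (distrC s'); lra.
have E2 : `|circ_dist t' s' - circ_dist t s| <= 4 * h.
  rewrite ler_norml.
  have := circ_dist_perturb t' s' t s; have := circ_dist_perturb t s t' s'.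
  by rewrite (distrC t' t) (distrC s' s); lra.
have m3 : 2 * m <= eucl (f t - f s) by rewrite (le_trans m1)// hm'.
have m4 : 2 * m <= circ_dist t s by lra.
have a1 : m <= eucl (p t' - p s') by move: E1; rewrite ler_norml; lra.
have a2 : m <= circ_dist t' s' by move: E2; rewrite ler_norml; lra.
have b1 : m <= eucl (f t - f s) by lra.
have b2 : m <= circ_dist t s by lra.
have := inv_sqr_dist m0 a1 b1 E1; have := inv_sqr_dist m0 a2 b2 E2.
rewrite /mobius_kernel !ler_norml.
rewrite (_ : 2 * (4 * h) / m ^+ 3 = 8 * (h / m ^+ 3)); last by ring.
lra.
Qed.

End Perturbation.

(** * Lower bound for the discrete energy *)

Section Discrete.
Context {R : realType} {d : nat}.
Implicit Types (f p : R -> 'rV[R]_d) (a : nat -> R).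
Local Notation K := mobius_kernel.
Local Notation Q := (@unit_square R).

Lemma equilateral_vertices_gt0 n p a : equilateral_vertices n p a -> (0 < n)%N.
Proof.
case: n => // -[_ [_ /eqP]]; rewrite -subr_eq0 opprD addrA subrr sub0r oppr_eq0.
by rewrite oner_eq0.
Qed.

(** A circle distance of 1/n only says that the gap of the lifts is at least 1/n; but n such gaps
    add up to 1, so all are equal to 1/n. *)
Lemma equilateral_verticesE n p a : equilateral_vertices n p a ->
  forall i, (i <= n)%N -> a i = a 0%N + i%:R / n%:R.
Proof.
move=> eqv; have n0 := equilateral_vertices_gt0 eqv.
case: eqv => _ [ainc an] acirc _.
have step i : (i < n)%N -> n%:R^-1 <= a i.+1 - a i.
  move=> ni; rewrite -(acirc _ ni); apply: le_trans (circ_dist_le_norm _ _) _.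
  by rewrite ger0_norm// subr_ge0 ltW// ainc.
have inc i k : (i + k <= n)%N -> a i + k%:R / n%:R <= a (i + k)%N.
  elim: k => [|k ih]; first by rewrite mul0r !addr0 addn0.
  rewrite addnS => h; have := ih (ltnW h); have := step _ h.
  by rewrite -natr1 mulrDl mul1r; lra.
move=> i ni; apply/eqP; rewrite eq_le; apply/andP; split; last first.
  exact: (inc 0%N i ni).
have := inc i (n - i)%N; rewrite subnKC// an => /(_ (leqnn _)).
rewrite natrB// mulrBl divff ?pnatr_eq0 -?lt0n//; lra.
Qed.

Lemma discrete_energy_sumE n p a : embedded p -> equilateral_vertices n p a ->
  discrete_energy_sum n p a =
  (\sum_(i < n) \sum_(j < n) K p (a j) (a i) * (n%:R^-1) ^+ 2)%:E.
Proof.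
move=> ep eqv; have aE := equilateral_verticesE eqv.
have cp : closed_curve p by case: ep.
rewrite /discrete_energy_sum -sumEFin; apply: eq_bigr => i _.
rewrite [in RHS](bigD1 i)//=.
rewrite (_ : K p (a i) (a i) = 0) ?mul0r ?add0r; last first.
  by rewrite -{1}[a i]addr0 (mobius_kernel_diag _ 0).
rewrite -sumEFin; apply: eq_bigr => j ji.
have n0 := equilateral_vertices_gt0 eqv.
case: eqv => _ _ acirc _; rewrite !acirc//.
rewrite mobius_kernelE// -?EFinM ?expr2 ?mulrA//.
apply/eqP => /circ_dist_eq0[m].
rewrite (aE _ (ltnW (ltn_ord i))) (aE _ (ltnW (ltn_ord j))) => h.
have {}h : (j%:Z - i%:Z)%:~R = (n%:Z * m)%:~R :> R.
  rewrite rmorphB rmorphM/= -!pmulrn.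
  have nn0 : n%:R != 0 :> R by rewrite pnatr_eq0 -lt0n.
  have -> : j%:R = n%:R * (j%:R / n%:R) :> R by rewrite mulrCA divff// mulr1.
  have -> : i%:R = n%:R * (i%:R / n%:R) :> R by rewrite mulrCA divff// mulr1.
  by rewrite -mulrBr; congr (_ * _); lra.
move/eqP: h; rewrite eqr_int => /eqP h.
have /eqP : (j%:Z == i%:Z %[mod n%:Z])%Z by rewrite eqz_mod_dvd h dvdz_mulr.
rewrite !modz_small ?ltz_nat ?ltn_ord// => -[/val_inj ji'].
by rewrite ji' eqxx in ji.
Qed.

(** The vertices are a translate of the uniform grid, so modulo 1 each uniform cell contains one of
    them. The index map s is the cyclic shift by the integer part of n times the offset. *)
Lemma equilateral_vertices_cell n p a : equilateral_vertices n p a ->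
  exists s : 'I_n -> 'I_n, injective s /\
   forall j : 'I_n, exists m, j%:R / n%:R <= a (s j) + m%:~R < j.+1%:R / n%:R.
Proof.
move=> eqv; have aE := equilateral_verticesE eqv.
have n0 := equilateral_vertices_gt0 eqv.
have nR : 0 < n%:R :> R by rewrite ltr0n.
pose k := Num.floor (n%:R * a 0%N).
have nz : n%:Z != 0 by rewrite eqz_nat -lt0n.
have ub (j : int) : (`|(j - k) %% n%:Z|%Z < n)%N.
  by rewrite -ltz_nat gez0_abs ?modz_ge0// ltz_pmod.
pose s (j : 'I_n) := Ordinal (ub j).
have sE j : (s j)%:Z = ((j%:Z - k) %% n%:Z)%Z by rewrite /= gez0_abs// modz_ge0.
exists s; split.
  move=> i j ij; have := sE i; rewrite ij sE => /eqP.
  rewrite eqz_modDr !modz_small ?ltz_nat ?ltn_ord// => /eqP[h].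
  exact/val_inj.
move=> j; exists ((j%:Z - k) %/ n%:Z)%Z.
rewrite aE; last exact/ltnW/ltn_ord.
have /andP[f1 f2] := floor_itv (n%:R * a 0%N); rewrite -/k rmorphD/= in f1 f2.
have : (j%:Z - k)%:~R = (((j%:Z - k) %/ n%:Z)%Z * n%:Z + (s j)%:Z)%:~R :> R.
  by rewrite sE -divz_eq.
rewrite rmorphB rmorphD rmorphM/= -!pmulrn; set m := (X in X%:~R * _).
move=> h; rewrite ler_pdivrMr// ltr_pdivlMr//.
have -> : (a 0%N + (s j)%:R / n%:R + m%:~R) * n%:R = n%:R * a 0%N + (s j)%:R + m%:~R * n%:R.
  by field; rewrite gt_eqF.
rewrite -natr1 /=; apply/andP; split; lra.
Qed.

(** Each uniform cell is compared with the pair of vertices that it contains. Cells that miss the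
    far set have integral 0, yet their terms remain in the discrete sum, which is harmless since
    these are nonnegative. *)
Lemma kernel_integral_far_le n f p a (e r : R) :
  embedded f -> arclength_curves f -> embedded p -> equilateral_vertices n p a ->
  0 <= r ->
  (forall t s t' s', e <= circ_dist t s -> `|t - t'| <= n%:R^-1 ->
     `|s - s'| <= n%:R^-1 -> K f t s <= K p t' s' + r) ->
  (kernel_integral f (Q `&` far e) <= discrete_energy_sum n p a + r%:E)%E.
Proof.
move=> ef fA ep eqv r0 H.
have n0 := equilateral_vertices_gt0 eqv.
have nR : 0 < n%:R :> R by rewrite ltr0n.
have pA : arclength_curves p by case: eqv.
have cp : closed_curve p by case: ep.
pose y (i : nat) : R := i%:R / n%:R.
have yS i : y i.+1 - y i = n%:R^-1 by rewrite /y -natr1 mulrDl mul1r addrC addKr.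
have yle i : y i <= y i.+1 by rewrite -subr_ge0 yS invr_ge0 ltW.
rewrite (@kernel_integral_cells _ _ _ ef fA y n)//; first last.
- by rewrite /y divff// gt_eqF.
- by rewrite /y mul0r.
- exact: measurable_far.
have [s [sinj hs]] := equilateral_vertices_cell eqv.
pose b (j : 'I_n) := xget 0 [set x | exists m, x = a (s j) + m%:~R /\ cell y j x].
have bP j : exists m, b j = a (s j) + m%:~R /\ cell y j (b j).
  have [m hm] := hs j.
  have : exists x, exists m, x = a (s j) + m%:~R /\ cell y j x.
    by exists (a (s j) + m%:~R), m; split => //; rewrite /cell/= in_itv.
  by move=> h; have := xgetPex 0 h.
have main (ij : 'I_n * 'I_n) :
   (kernel_integral f ((cell y ij.1 `*` cell y ij.2) `&` far e) <=
    ((K p (a (s ij.1)) (a (s ij.2)) + r) * (n%:R^-1) ^+ 2)%:E)%E.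
  case: ij => i j /=.
  have [m [bi ci]] := bP i; have [l [bj cj]] := bP j.
  rewrite -(mobius_kernelDz _ _ m l)// -bi -bj.
  rewrite EFinM (_ : _ ^+ 2 = (y i.+1 - y i) * (y j.+1 - y j)); last by rewrite !yS expr2.
  rewrite -measure_cell2//; apply: kernel_integral_le_cst => //.
  - by apply: measurableI; [exact: measurable_cell2|exact: measurable_far].
  - exact: measurable_cell2.
  - by rewrite addr_ge0// mobius_kernel_ge0.
  - have near_cell (x x' : R) (i' : nat) : cell y i' x -> cell y i' x' -> `|x - x'| <= n%:R^-1.
      by rewrite /cell/= !in_itv/= -(yS i') ler_norml => /andP[? ?] /andP[? ?]; lra.
    move=> [t t'] [[/= ti t'j] far_t]; apply: H => //; exact: near_cell ci + exact: near_cell cj.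
apply: le_trans (lee_sum _ (fun ij _ => main ij)) _.
rewrite sumEFin discrete_energy_sumE// -EFinD lee_fin.
under eq_bigr do rewrite mulrDl.
(* The errors r / n^2 of the n^2 cells add up to r. *)
rewrite big_split/= sumr_const card_prod !card_ord; apply: lerD; last first.
  rewrite -[leLHS]mulr_natr natrM le_eqVlt; apply/orP; left; apply/eqP.
  by field; rewrite gt_eqF.
rewrite exchange_big/= pair_bigA/=.
have inj2 : injective (fun ij : 'I_n * 'I_n => (s ij.1, s ij.2)).
  by move=> [i j] [i' j'] [/sinj -> /sinj ->].
by rewrite [leRHS](reindex_inj inj2)/=.
Qed.

End Discrete.

(** * Limits and norms *)

Section Limits.
Context {R : realType}.
Implicit Types (u : nat -> \bar R) (E : \bar R).
Local Open Scope ereal_scope.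

(** Testing against all real c below E treats finite and infinite E alike. *)
Lemma limn_einf_ge E u :
  (forall c : R, c%:E < E -> exists N, forall n, (N <= n)%N -> c%:E <= u n) ->
  E <= limn_einf u.
Proof.
move=> h; rewrite limn_einf_lim.
have {}h (c : R) : c%:E < E -> c%:E <= limn (einfs u).
  move=> /h[N hN]; rewrite (cvg_lim _ (@cvg_einfs_sup _ u))//.
  apply: le_trans (ereal_sup_ubound _) => /=; last by exists N.
  by apply: le_ereal_inf_tmp => _ [n /= Nn <-]; exact: hN.
case: E h => [r h| h|]; last by rewrite leNye.
  apply/lee_subgt0Pr => e e0; rewrite -EFinB; apply: h.
  by rewrite lte_fin ltrBlDr ltrDl.
by rewrite leye_eq; apply/eqP/eqyP => A _; apply: h; rewrite ltry.
Qed.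

Lemma limn_esup_le E u :
  (forall e : R, (0 < e)%R -> exists N, forall n, (N <= n)%N -> u n <= E + e%:E) ->
  limn_esup u <= E.
Proof.
move=> h; rewrite limn_esup_lim; apply/lee_addgt0Pr => e /h[N hN].
rewrite (cvg_lim _ (@cvg_esups_inf _ u))//.
apply: (@le_trans _ _ (esups u N)); first by apply: ereal_inf_lbound; exists N.
by apply: ge_ereal_sup => _ [n /= Nn <-]; exact: hN.
Qed.

(** No measurability is required, because the integral of a nonnegative function is a supremum over
    the simple functions below it. This is what lets [Lq_norm_le] be applied to [derive1 g]
    directly. *)
Lemma nonneg_le_integral d (T : measurableType d) (mu : {measure set T -> \bar R})
    (f g : T -> \bar R) : (forall x, 0 <= f x) -> (forall x, f x <= g x) ->
  \int[mu]_x f x <= \int[mu]_x g x.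
Proof.
move=> f0 fg; have g0 x : 0 <= g x by apply: le_trans (fg x).
rewrite !ge0_integralTE//; apply: ereal_sup_le => _ [h hf <-].
by exists h => // x; apply: le_trans (fg x).
Qed.

End Limits.

Section LqNorm.
Context {R : realType} {d : nat}.
Implicit Types (f g : R -> 'rV[R]_d).
Local Notation mu := (@lebesgue_measure R).

(** Decides the case split on the total measure in the norm at [+oo]. *)
Lemma setT_measure_gt0 : (0 < mu [set: R])%E.
Proof.
have -> : [set: R] = `]-oo, +oo[%classic by rewrite set_itvNyy.
by rewrite lebesgue_measure_itv/= ltry.
Qed.

Lemma Lq_norm_ge0 (q : \bar R) f : (0 <= Lq_norm q f)%E.
Proof. exact: Lnorm_ge0. Qed.

Lemma Lq_norm_le (q : \bar R) g (c : R) : (1 <= q)%E -> 0 <= c ->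
  (forall t, eucl (g t) <= c) -> (Lq_norm q g <= c%:E)%E.
Proof.
move=> q1 c0 gc; rewrite /Lq_norm.
set F := _ \_ _; have F0 t : (0 <= F t)%E.
  by rewrite /F patchE; case: ifPn => // _; rewrite lee_fin eucl_ge0.
have Fc t : (F t <= (cst c%:E \_ `[0%R, 1%R[) t)%E.
  by rewrite /F !patchE; case: ifPn => // _; rewrite lee_fin.
case: q q1 => [r|_|//].
  rewrite lee_fin => r1; rewrite unlock /Lnorm.
  have r0 : 0 < r by lra.
  have step : (\int[mu]_x `|F x| `^ r <= (c `^ r)%:E)%E.
    apply: (@le_trans _ _ (\int[mu]_x ((cst (c `^ r)%:E \_ `[0%R, 1%R[) x)))%E.
      apply: nonneg_le_integral => t; first exact: poweR_ge0.
      rewrite gee0_abs// /F !patchE; case: ifPn => _; last by rewrite poweR0r// gt_eqF.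
      by rewrite poweR_EFin lee_fin ge0_ler_powR ?nnegrE ?eucl_ge0// ltW.
    have mu01 : mu `[0, 1[%classic = 1%:E.
      by rewrite lebesgue_measure_itv/= lte_fin ltr01 oppr0 adde0.
    rewrite -integral_mkcond integral_cst//.
    by rewrite [X in (_ * X)%E](_ : _ = 1%:E) ?mule1.
  apply: (@le_trans _ _ ((c `^ r)%:E `^ r^-1)%E).
    apply: gt0_ler_poweR => //; first by rewrite invr_ge0 ltW.
      by rewrite in_itv/= leey andbT integral_ge0// => *; exact: poweR_ge0.
    by rewrite in_itv/= leey andbT lee_fin powR_ge0.
  by rewrite poweR_EFin -powRrM divff ?gt_eqF// powRr1.
rewrite unlock /Lnorm setT_measure_gt0; apply/ess_supP.
apply: nearW => t /=; rewrite gee0_abs//; apply: le_trans (Fc t) _.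
by rewrite patchE; case: ifPn => // _; rewrite lee_fin.
Qed.

(** For finite r the norm is at least h l^(1/r), and l <= 1 <= r gives l^(1/r) >= l: a bound
    independent of the exponent. For the exponent [+oo] only the positive measure of the interval
    matters. *)
Lemma Lq_norm_ge (q : \bar R) g (h l x : R) : (1 <= q)%E -> 0 <= h ->
  0 < l -> 0 <= x -> x + l <= 1 ->
  (forall t, x <= t < x + l -> h <= eucl (g t)) -> ((h * l)%:E <= Lq_norm q g)%E.
Proof.
move=> q1 h0 l0 x0 x1 gh; rewrite /Lq_norm.
set F := _ \_ _; have F0 t : (0 <= F t)%E.
  by rewrite /F patchE; case: ifPn => // _; rewrite lee_fin eucl_ge0.
have l1 : l <= 1 by lra.
have muJ : mu `[x, x + l[%classic = l%:E.
  rewrite lebesgue_measure_itv/= lte_fin ltrDl l0 -EFinB.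
  by congr (_%:E); ring.
have hF t : `[x, x + l[%classic t -> (h%:E <= F t)%E.
  rewrite /= in_itv/= => /andP[t0 t1]; rewrite /F patchE mem_set; last first.
    by rewrite /= in_itv/=; apply/andP; split; lra.
  by rewrite lee_fin gh// t0.
case: q q1 => [r|_|//].
  rewrite lee_fin => r1; rewrite unlock /Lnorm.
  have r0 : 0 < r by lra.
  have step : ((h `^ r * l)%:E <= \int[mu]_x `|F x| `^ r)%E.
    pose G : R -> \bar R := (cst (h `^ r)%:E \_ `[x, (x + l)%R[).
    apply: (@le_trans _ _ (\int[mu]_t G t)%E).
      by rewrite /G -integral_mkcond integral_cst// EFinM -muJ.
    apply: nonneg_le_integral => t; rewrite /G.
      by rewrite patchE; case: ifPn => // _; rewrite lee_fin powR_ge0.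
    rewrite gee0_abs// patchE; case: ifPn => [|_]; last exact: poweR_ge0.
    rewrite inE => /hF Ft; rewrite -poweR_EFin; apply: gt0_ler_poweR => //.
    - exact: ltW.
    - by rewrite in_itv/= leey andbT.
    - by rewrite in_itv/= leey andbT.
  apply: (@le_trans _ _ ((h `^ r * l)%:E `^ r^-1)%E); last first.
    apply: gt0_ler_poweR => //; first by rewrite invr_ge0 ltW.
      by rewrite in_itv/= leey andbT lee_fin mulr_ge0 ?powR_ge0// ltW.
    by rewrite in_itv/= leey andbT integral_ge0// => *; exact: poweR_ge0.
  rewrite poweR_EFin lee_fin powRM ?powR_ge0 ?(ltW l0)// -powRrM divff ?gt_eqF//.
  rewrite powRr1// ler_wpM2l// -[leLHS](powRr1 (ltW l0)).
  by apply: ger_powR; rewrite ?l0// invf_le1.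
rewrite unlock /Lnorm setT_measure_gt0 leNgt; apply/negP => lt.
have [N [mN N0 hN]] := ess_sup_ge mu (abse \o F).
suff JN : `[x, x + l[%classic `<=` N.
  have : (mu `[x, (x + l)%R[%classic <= mu N)%E by apply: le_measure; rewrite ?inE.
  by rewrite muJ N0 lee_fin leNgt l0.
move=> t Jt; apply: hN => /=; rewrite gee0_abs// => Ft.
have := le_lt_trans Ft lt; rewrite ltNge => /negP; apply.
apply: le_trans (hF _ Jt); rewrite lee_fin ler_piMr//.
Qed.

(** A c-Lipschitz function that exceeds h at a point stays above h/2 on an interval of length l,
    with c l <= h/2; its norm is then at least (h/2) l. Hence smallness in [L^q] forces uniform
    smallness. *)
Lemma Lq_norm_lower (q : \bar R) (c h : R) : (1 <= q)%E -> 0 < c -> 0 < h ->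
  exists2 e, 0 < e & forall g, closed_curve g -> eucl_lipschitz c g ->
    (Lq_norm q g < e%:E)%E -> forall t, eucl (g t) <= h.
Proof.
move=> q1 c0 h0.
pose l := Num.min (1 / 2) (h / 2 / c).
have l0 : 0 < l by rewrite lt_min !divr_gt0.
have l2 : l <= 1 / 2 by rewrite ge_min lexx.
have lc : c * l <= h / 2 by rewrite mulrC -ler_pdivlMr// ge_min lexx orbT.
exists (h / 2 * l); first by rewrite !mulr_gt0.
move=> g cg gc small t'; rewrite leNgt; apply/negP => ht'.
have [m t01] := frac_01 t'.
have ht : h < eucl (g (t' + m%:~R)) by rewrite closed_curveDz.
move: t01 ht; set t := t' + _ => + ht; rewrite in_itv/= => /andP[t0 t1].
have low s : `|s - t| <= l -> h / 2 <= eucl (g s).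
  move=> st; have := eucl_lerB_dist (g t) (g s); rewrite ler_norml.
  have := gc t s; rewrite distrC.
  have : c * `|s - t| <= c * l by rewrite ler_wpM2l// ltW.
  by lra.
move: small; rewrite ltNge => /negP; apply.
(* As l <= 1/2, an interval of length l on one side of t fits into the fundamental domain. *)
have [th|th] := leP t (1 / 2).
  apply: (@Lq_norm_ge _ _ _ _ t) => //; [by rewrite divr_ge0// ltW|lra|].
  by move=> s /andP[? ?]; apply: low; rewrite ger0_norm; lra.
apply: (@Lq_norm_ge _ _ _ _ (t - l)) => //; [by rewrite divr_ge0// ltW|lra|lra|].
by move=> s /andP[? ?]; apply: low; rewrite ler0_norm; lra.
Qed.

Lemma eucl_derive1_le g (c : R) t : 0 <= c -> eucl_lipschitz c g ->
  eucl (derive1 g t) <= c.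
Proof.
move=> c0 gc; have [gd|ngd] := pselect (derivable g t 1).
  apply/ler_addgt0Pr => e e0; have [r r0 hr] := derivable_eucl gd e0.
  have r2 : 0 < r / 2 by rewrite divr_gt0.
  pose s := t + r / 2; have st : s - t = r / 2 by rewrite /s addrC addKr.
  have := hr s; rewrite st ger0_norm ?(ltW r2)//.
  have /[swap] /[apply] : r / 2 < r by lra.
  move=> h; have := eucl_triangle ((r / 2) *: derive1 g t - (g s - g t)) (g s - g t).
  rewrite subrK euclZ ger0_norm ?(ltW r2)// (euclB ((r / 2) *: _)).
  have := gc s t; rewrite st ger0_norm ?(ltW r2)// => h1 h2.
  by rewrite -(ler_pM2l r2); lra.
(* Where g is not derivable, the limit defining [derive1] takes the default value [point], which is
   the zero vector; the bound therefore holds at every t. *)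
suff -> : derive1 g t = 0 by rewrite eucl0.
have -> : (0 : 'rV[R]_d) = point by apply/rowP => i; rewrite !mxE.
rewrite /derive1; apply: dvgP; apply: contra_not ngd; rewrite /derivable.
set g1 := (fun h => _); set g2 := (fun h => _).
suff -> : g1 = g2 by []; apply/funext => h; rewrite /g1 /g2 /= [h *: 1]mulr1//.
Qed.

Lemma curve_norm_le (nrm : (R -> 'rV[R]_d) -> \bar R) (q : \bar R) g (c : R) :
  nrm = Lq_norm q \/ nrm = W1q_norm q -> (1 <= q)%E -> 0 <= c ->
  (forall t, eucl (g t) <= c) -> eucl_lipschitz c g ->
  (nrm g <= (2 * c)%:E)%E.
Proof.
move=> hn q1 c0 gc gl.
have h1 := Lq_norm_le q1 c0 gc.
have h2 := Lq_norm_le q1 c0 (fun t => eucl_derive1_le t c0 gl).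
case: hn => ->; last by rewrite mulr_natl mulr2n EFinD leeD.
by apply: le_trans h1 _; rewrite lee_fin; lra.
Qed.

Lemma curve_norm_ge (nrm : (R -> 'rV[R]_d) -> \bar R) (q : \bar R) g :
  nrm = Lq_norm q \/ nrm = W1q_norm q -> (Lq_norm q g <= nrm g)%E.
Proof. by case=> ->//; rewrite /W1q_norm leeDl// Lq_norm_ge0. Qed.

End LqNorm.

(** * The lower bound inequality *)

Section Liminf.
Context {R : realType} {d : nat}.
Implicit Types (f g : R -> 'rV[R]_d).

Lemma closed_curveB f g : closed_curve f -> closed_curve g -> closed_curve (f - g).
Proof. by move=> cf cg t; rewrite /= -[LHS]/(f _ - g _) cf cg. Qed.

Lemma eucl_lipschitzB f g (a b : R) : eucl_lipschitz a f -> eucl_lipschitz b g ->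
  eucl_lipschitz (a + b) (f - g).
Proof.
move=> fa gb t s; rewrite -[X in X - _]/(f t - g t) -[X in _ - X]/(f s - g s).
rewrite (_ : _ - _ = (f t - f s) - (g t - g s)); last first.
  by apply/rowP => i; rewrite !mxE; ring.
apply: le_trans (eucl_triangle _ _) _; rewrite euclN mulrDl.
by apply: lerD; [exact: fa|exact: gb].
Qed.

Lemma near_lt_ereal (u : nat -> \bar R) (e : R) : 0 < e ->
  u n @[n --> \oo] --> 0%E -> exists N, forall n, (N <= n)%N -> (u n < e%:E)%E.
Proof.
move=> e0 u0; have [|N _ hN] := u0 [set y | (y < e%:E)%E].
  by apply: open_nbhs_nbhs; split; [exact: open_ereal_lt_ereal|rewrite /= lte_fin].
by exists N => n Nn; exact: (hN n).
Qed.

Lemma near_inv_nat (e : R) : 0 < e ->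
  exists N, (0 < N)%N /\ forall n, (N <= n)%N -> n%:R^-1 <= e.
Proof.
move=> e0; exists (Num.truncn e^-1).+1; split => // n hn.
rewrite invf_ple ?posrE//; last by rewrite ltr0n (leq_trans _ hn).
by apply/ltW/(lt_le_trans (truncnS_gt _)); rewrite ler_nat.
Qed.

Lemma mobius_liminf (q : \bar R) (nrm : (R -> 'rV[R]_d) -> \bar R)
    (g_ : nat -> R -> 'rV[R]_d) g : (1 <= q)%E ->
  nrm = Lq_norm q \/ nrm = W1q_norm q ->
  (forall n, embedded (g_ n) /\ arclength_curves (g_ n)) ->
  embedded g -> arclength_curves g ->
  nrm (g_ n - g) @[n --> \oo] --> 0%E ->
  (mobius_energy g <= limn_einf (fun n => discrete_mobius_energy n (g_ n)))%E.
Proof.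
move=> q1 hnrm hg_ eg gA cv; apply: limn_einf_ge => c /(mobius_energy_far eg gA).
move=> [e e0 ce].
(* The strict inequality leaves room for the perturbation error r; when the integral is infinite any
   r will do. *)
have [r r0 cr] : exists2 r, 0 < r & ((c + r)%:E <= kernel_integral g (unit_square `&` far e))%E.
  move: ce; case: kernel_integral => [b| |]//.
    by rewrite lte_fin => cb; exists (b - c); rewrite ?subr_gt0// lee_fin; lra.
  by move=> _; exists 1; rewrite // leey.
have [h h0 hh] := mobius_kernel_perturb eg gA e0 r0.
(* The constant 1 + 1 is that of a difference of two arclength curves. *)
have [|e' e'0 he'] := @Lq_norm_lower R d q (1 + 1) h q1 _ h0; first by rewrite addr_gt0.
have [N1 hN1] := near_lt_ereal e'0 cv.
have [N2 [N20 hN2]] := near_inv_nat h0.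
exists (maxn N1 N2) => n; rewrite geq_max => /andP[/hN1 n1 /hN2 n2].
(* The discrete energy is an infimum over vertex lists, so each list is bounded from below; if there
   is none, the infimum is [+oo] and nothing remains to be shown. *)
apply: le_ereal_inf_tmp => _ [a eqv <-].
have [en An] := hg_ n.
have close t : eucl (g_ n t - g t) <= h.
  apply: (he' (g_ n - g)).
  - by apply: closed_curveB; [case: en|case: eg].
  - by apply: eucl_lipschitzB; exact: arclength_lipschitz.
  - exact: le_lt_trans (curve_norm_ge _ hnrm) n1.
have := @kernel_integral_far_le _ _ n g (g_ n) a e r eg gA en eqv (ltW r0).
have H t s t' s' : e <= circ_dist t s -> `|t - t'| <= n%:R^-1 ->
     `|s - s'| <= n%:R^-1 -> mobius_kernel g t s <= mobius_kernel (g_ n) t' s' + r.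
  move=> ets tt ss.
  have := hh (g_ n) t s t' s' ets (le_trans tt n2) (le_trans ss n2) (close _) (close _).
  by rewrite ler_norml; lra.
move=> /(_ H) /(le_trans cr); rewrite EFinD leeD2rE//.
Qed.

End Liminf.

(** * Ambient isotopies by small Lipschitz perturbations *)

Section Isotopy.
Context {R : realType} {d : nat}.
Local Notation V := 'rV[R]_d.
Implicit Types (f g p : R -> V) (y z : V).

(* McShane's formula; in the sup norm a vector-valued map can be extended coordinate by coordinate without increasing the Lipschitz constant. *)
Lemma lipschitz_extension (I : pointedType) (x : I -> V) (v : I -> R) (L : R) :
  0 <= L -> (forall i j, `|v i - v j| <= L * `|x i - x j|) ->
  exists W : V -> R, (forall i, W (x i) = v i) /\
    forall y z, `|W y - W z| <= L * `|y - z|.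
Proof.
move=> L0 vL.
pose S y := range (fun i => v i + L * `|y - x i|).
have S0 y : S y !=set0 by exists (v point + L * `|y - x point|), point.
have lb y j : lbound (S y) (v j - L * `|x j - y|).
  move=> _ [i _ <-]; have := vL i j; rewrite ler_norml => /andP[h _].
  have : L * `|x i - x j| <= L * (`|y - x i| + `|x j - y|).
    rewrite ler_wpM2l//; have := ler_distD y (x i) (x j).
    by rewrite (distrC (x i) y) (distrC y (x j)).
  by rewrite mulrDr; lra.
have hi y : has_inf (S y) by split => //; exists (v point - L * `|x point - y|).
exists (fun y => inf (S y)); split.
  move=> i; apply/eqP; rewrite eq_le; apply/andP; split.
    apply: ge_inf; first by case: (hi (x i)).
    by exists i; rewrite // subrr normr0 mulr0 addr0.
  apply: lb_le_inf => //.
  by have := lb (x i) i; rewrite subrr normr0 mulr0 subr0.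
suff main y z : inf (S y) <= inf (S z) + L * `|y - z|.
  move=> y z; rewrite ler_norml; have := main y z; have := main z y.
  by rewrite (distrC z); lra.
rewrite -lerBlDr; apply: lb_le_inf => // _ [i _ <-].
rewrite lerBlDr; apply: (@le_trans _ _ (v i + L * `|y - x i|)).
  by apply: ge_inf; [case: (hi y)|exists i].
rewrite -addrA lerD2l -mulrDr ler_wpM2l// [leRHS]addrC; exact: ler_distD.
Qed.

Lemma lipschitz_extension_rV (I : pointedType) (x v : I -> V) (L : R) :
  0 <= L -> (forall i j, `|v i - v j| <= L * `|x i - x j|) ->
  exists W : V -> V, (forall i, W (x i) = v i) /\
    forall y z, `|W y - W z| <= L * `|y - z|.
Proof.
move=> L0 vL.
have /choice[W hW] : forall k : 'I_d, exists W : V -> R, (forall i, W (x i) = v i ord0 k) /\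
    forall y z, `|W y - W z| <= L * `|y - z|.
  move=> k; apply: lipschitz_extension => // i j; apply: le_trans (vL i j).
  by have := ler_mx_norm_coord (v i - v j) k; rewrite !mxE.
exists (fun y => \row_k W k y); split.
  by move=> i; apply/rowP => k; rewrite mxE; exact: (hW k).1.
move=> y z; rewrite [leLHS]/Num.norm/= mx_normrE; apply: bigmax_le.
  by rewrite mulr_ge0.
by move=> [i k] _ /=; rewrite !mxE; exact: (hW k).2.
Qed.

Lemma normr_lipschitz_continuous (W : V -> V) (L : R) :
  (forall y z, `|W y - W z| <= L * `|y - z|) -> continuous W.
Proof.
move=> WL y; apply/(@cvgrPdist_le _ _ _ (nbhs (y : V)) _ W) => /= e e0.
pose k := `|L| + 1; have k0 : 0 < k by rewrite ltr_wpDl.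
apply/(@nbhs_ballP R V); exists (e / k) => [|z]; first by rewrite /= divr_gt0.
rewrite -ball_normE /= ltr_pdivlMr// => yz; apply: le_trans (WL _ _) _.
apply: (@le_trans _ _ (k * `|y - z|)); last by rewrite mulrC ltW.
by rewrite ler_wpM2r// (le_trans (ler_norm _))// lerDl.
Qed.

Lemma self_homeomorphism_comp (h k : V -> V) :
  self_homeomorphism h -> self_homeomorphism k -> self_homeomorphism (k \o h).
Proof.
move=> [ch [h' [ch' hK h'K]]] [ck [k' [ck' kK k'K]]]; split.
  by move=> x; apply: continuous_comp; [exact: ch|exact: ck].
exists (h' \o k'); split; [|exact: can_comp|exact: can_comp].
by move=> x; apply: continuous_comp; [exact: ck'|exact: ch'].
Qed.

(** A 1/2-Lipschitz perturbation satisfies |y - z| <= 2 |h y - h z|, which gives both injectivity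
    and continuity of the inverse. *)
Lemma perturbed_identity_homeomorphism (W : V -> V) (c : R) : 0 <= c <= 1 ->
  (forall y z, `|W y - W z| <= 2^-1 * `|y - z|) ->
  self_homeomorphism (fun y => y + c *: W y).
Proof.
move=> /andP[c0 c1] WL; set h := fun y => _.
have cW y z : `|c *: W y - c *: W z| <= 2^-1 * `|y - z|.
  rewrite -scalerBr normrZ ger0_norm//; apply: le_trans (WL _ _).
  by rewrite ler_piMl.
have hlow y z : `|y - z| <= 2 * `|h y - h z|.
  have := cW y z; have := ler_normB (h y - h z) (c *: W y - c *: W z).
  rewrite (_ : _ - _ - _ = y - z); last first.
    by rewrite /h; apply/rowP => i; rewrite !mxE; ring.
  by lra.
have hsurj y : exists x, h x = y.
  pose X : completeNormedModType R := HB.pack_for (completeNormedModType R) V.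
  (* A fixed point of this contraction is a preimage of y under h. *)
  pose F : X -> X := fun x => y - c *: W x.
  have FT : isFun X X setT setT F by split.
  pose F' : {fun [set: X] >-> [set: X]} := HB.pack F FT.
  have ctr : is_contraction F'.
    exists (2^-1)%:nng; split => /=; first by rewrite invf_lt1// ltr1n.
    move=> -[a b] _ /=; rewrite /F.
    rewrite (_ : _ - _ = - (c *: W a - c *: W b)) ?normrN; first exact: cW.
    by apply/rowP => i; rewrite !mxE; ring.
  have [] := @banach_fixed_point R X setT F' ctr closedT.
    by exists (0 : X).
  move=> x _ xF; exists x; rewrite /h {1}xF /= /F.
  by apply/rowP => i; rewrite !mxE; ring.
have [k hk] := choice hsurj; split.
  apply: (@normr_lipschitz_continuous _ 2) => y z.
  rewrite /h opprD addrACA; apply: le_trans (ler_normD _ _) _.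
  by have := cW y z; have := normr_ge0 (y - z); lra.
exists k; split.
- by apply: (@normr_lipschitz_continuous _ 2) => y z; rewrite -{2}(hk y) -{2}(hk z).
- move=> y; apply/eqP; rewrite -subr_eq0 -normr_le0.
  by have := hlow (k (h y)) y; rewrite hk subrr normr0 mulr0.
- exact: hk.
Qed.

(** Concatenation of isotopies: [a] runs through the given one during [0, 1/2] and [b] switches on
    the perturbation during [1/2, 1]. A single formula in the clamped parameters makes the joint
    continuity immediate at the junction. *)
Lemma ambient_isotopic_perturb f g (W : V -> V) : ambient_isotopic f g ->
  (forall y z, `|W y - W z| <= 2^-1 * `|y - z|) ->
  ambient_isotopic f (fun t => g t + W (g t)).
Proof.
move=> [F [cF hF F0 F1]] WL.
pose a (t : R) : R := Num.min (2 * t) 1.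
pose b (t : R) : R := Num.max (2 * t - 1) 0.
have a01 t : 0 <= t <= 1 -> 0 <= a t <= 1.
  move=> /andP[t0 t1]; rewrite /a le_min ler01 andbT mulr_ge0//=.
  by rewrite ge_min lexx orbT.
have b01 t : 0 <= t <= 1 -> 0 <= b t <= 1.
  move=> /andP[t0 t1]; rewrite /b le_max lexx orbT/= ge_max ler01 andbT.
  by lra.
exists (fun t v => F (a t) v + b t *: W (F (a t) v)); split.
- apply/subspace_continuousP => -[t v] /= [t01 _].
  have lipc (u : R -> R) : (forall s s', s <= s' -> 0 <= u s' - u s <= 2 * (s' - s)) -> continuous u.
    move=> ulip s; apply/cvgrPdist_le => /= e e0.
    have e2 : 0 < e / 2 by rewrite divr_gt0.
    near=> s'; have : `|s - s'| <= e / 2 by near: s'; exact: cvgr_dist_le.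
    have [ss|/ltW ss] := leP s s'; have := ulip _ _ ss; rewrite !ler_norml; lra.
  have ca : continuous a.
    apply: lipc => s s' ss; rewrite /a.
    by case: (leP (2 * s) 1) => ?; case: (leP (2 * s') 1) => ?; lra.
  have cb : continuous b.
    apply: lipc => s s' ss; rewrite /b.
    by case: (leP (2 * s - 1) 0) => ?; case: (leP (2 * s' - 1) 0) => ?; lra.
  have cFa : F (a x.1) x.2 @[x --> within (`[0, 1] `*` setT) (nbhs (t, v))] --> F (a t) v.
    move/subspace_continuousP : cF => /(_ (a t, v)).
    have At : (`[0, 1]%classic `*` [set: V]) (a t, v).
      by split => //=; rewrite in_itv/= a01// -in_itv.
    move=> /(_ At) {}cF P /cF; rewrite /= /within/= => nP.
    have cm : (a x.1, x.2) @[x --> (t, v)] --> (a t, v).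
      move=> P' [[A B] /= [nA nB] AB]; exists (a @^-1` A, B) => /=.
        by split => //; exact: ca nA.
      by move=> [s w] [/= As Bw]; apply: AB.
    move/cm : nP => nP; apply: (@filterS _ _ (nbhs_filter ((t, v) : R * V)) _ _ _ nP).
    move=> -[s w] /= sP [/= s01 _]; apply: sP.
    by split => //=; rewrite in_itv/= a01// -in_itv.
  apply: cvgD => //; apply: cvgZ.
    have h : b x.1 @[x --> (t, v)] --> b t.
      by apply: (@cvg_comp _ _ _ fst b); [exact: cvg_fst|exact: cb].
    by apply: cvg_trans h; apply: cvg_app; exact: cvg_within.
  apply: (@cvg_comp _ _ _ _ W _ _ _ cFa).
  exact: normr_lipschitz_continuous WL _.
- move=> t t01; apply: (@self_homeomorphism_comp (F (a t)) (fun y => y + b t *: W y)).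
    by apply: hF; exact: a01.
  by apply: perturbed_identity_homeomorphism => //; exact: b01.
- move=> v; have -> : a 0 = 0 by rewrite /a mulr0 min_l.
  have -> : b 0 = 0 by rewrite /b mulr0 max_r; lra.
  by rewrite F0 scale0r addr0.
- have -> : a 1 = 1 by rewrite /a mulr1 min_r// ler1n.
  have -> : b 1 = 1 by rewrite /b mulr1 max_l; lra.
  rewrite (_ : (fun v => _) = (fun y => y + W y) \o F 1); last first.
    by apply/funext => v /=; rewrite scale1r.
  by rewrite -image_comp F1 image_comp.
Unshelve. all: by end_near. Qed.

Lemma eucl_lipschitz_circ f (c : R) t s : closed_curve f -> eucl_lipschitz c f ->
  eucl (f t - f s) <= c * circ_dist t s.
Proof.
move=> cf fc; have [m ->] := circ_distP t s.
have -> : f s = f (s + m%:~R) by rewrite closed_curveDz.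
by rewrite -addrA -opprD; exact: fc.
Qed.

Lemma knot_class_embedded (K : set (R -> V)) f : knot_class K -> K f -> embedded f.
Proof. by move=> [f0 _ ->] []. Qed.

(** The bi-Lipschitz bound turns smallness in the parameter into smallness along the image of f, so
    that p - f becomes a vector field there. The factor [d.+1] pays for passing between the
    Euclidean norm and the sup norm in which the extension is made; it is positive, and at least 1,
    for every d. *)
Lemma knot_class_perturb (K : set (R -> V)) f p (b c : R) :
  knot_class K -> K f -> closed_curve p -> 0 < b -> 0 <= c ->
  (forall t s, b * circ_dist t s <= eucl (f t - f s)) ->
  eucl_lipschitz c (p - f) -> d.+1%:R * c <= b / 2 -> K p.
Proof.
move=> Kk Kf cp b0 c0 fb pfc cb; have ef := knot_class_embedded Kk Kf.
have cf : closed_curve f by case: ef.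
have cpf : closed_curve (p - f).
  by move=> t; rewrite -[LHS]/(p _ - f _) cp cf.
have key t s : d.+1%:R * eucl ((p - f) t - (p - f) s) <= 2^-1 * eucl (f t - f s).
  apply: (@le_trans _ _ (d.+1%:R * (c * circ_dist t s))).
    by rewrite ler_wpM2l// eucl_lipschitz_circ.
  rewrite mulrA; apply: (@le_trans _ _ (b / 2 * circ_dist t s)).
    by rewrite ler_wpM2r// circ_dist_ge0.
  by have := fb t s; rewrite mulrAC mulrC; lra.
have key1 t s : eucl ((p - f) t - (p - f) s) <= 2^-1 * eucl (f t - f s).
  apply: le_trans (key t s); rewrite -[leLHS]mul1r ler_wpM2r ?eucl_ge0//.
  by rewrite ler1n.
have key2 t s : `|(p - f) t - (p - f) s| <= 2^-1 * `|f t - f s|.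
  have d0 : 0 < d.+1%:R :> R by rewrite ltr0n.
  rewrite -(ler_pM2l d0); apply: (@le_trans _ _ (d.+1%:R * eucl ((p - f) t - (p - f) s))).
    by rewrite ler_wpM2l// normr_le_eucl.
  apply: le_trans (key t s) _; rewrite mulrCA ler_wpM2l//.
  apply: le_trans (eucl_le_normr _) _.
  by rewrite ler_wpM2r// ler_nat.
have h2 : 0 <= 2^-1 :> R by rewrite invr_ge0.
have [W [Wf WL]] := @lipschitz_extension_rV R f (p - f) 2^-1 h2 key2.
have pE : p = (fun t => f t + W (f t)).
  by apply/funext => t; rewrite Wf -[X in f t + X]/(p t - f t) addrC subrK.
case: Kk Kf => f0 _ -> [_ iso]; split; last by rewrite pE; exact: ambient_isotopic_perturb.
split => //.
- have cvf : continuous f by case: ef.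
  rewrite pE => t; apply: (@cvgD _ _ _ _ _ f (W \o f)); first exact: cvf.
  by apply: continuous_comp; [exact: cvf|exact: normr_lipschitz_continuous WL _].
(* If p takes the same value twice, the increments of p - f and f have equal length, which the
   factor 1/2 allows only when they vanish. *)
- move=> t s t01 s01 pts; case: ef => _ _ finj; apply: finj => //.
  have := key1 t s.
  have -> : (p - f) t - (p - f) s = - (f t - f s).
    rewrite -[(p - f) t]/(p t - f t) -[(p - f) s]/(p s - f s) pts.
    by apply/rowP => i; rewrite !mxE; ring.
  rewrite euclN => h; apply/eqP; rewrite -subr_eq0; apply/eqP/eucl_eq0.
  by have := eucl_ge0 (f t - f s); lra.
Qed.

End Isotopy.

(** * Equal chords on curves of class C1 *)

Section C1.
Context {R : realType} {d : nat}.
Implicit Types (f g p : R -> 'rV[R]_d).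
Local Notation mu := (@lebesgue_measure R).

Lemma continuous_eucl_near g t (e : R) : {for t, continuous g} -> 0 < e ->
  exists2 r, 0 < r & forall s, `|s - t| < r -> eucl (g s - g t) <= e.
Proof.
move=> gt e0; have e1 : 0 < e / (d%:R + 1) by rewrite divr_gt0// ltr_wpDl.
move/cvgrPdist_le : gt => /(_ _ e1)/nbhs_ballP[r /= r0 hr]; exists r => // s st.
have := hr s; rewrite /ball/= distrC => /(_ st) h.
apply: le_trans (eucl_le_normr _) _; rewrite distrC.
apply: (@le_trans _ _ (d%:R * (e / (d%:R + 1)))); first by rewrite ler_wpM2l.
by rewrite mulrCA ler_piMr ?(ltW e0)// ler_pdivrMr ?ltr_wpDl// mul1r lerDl.
Qed.

Lemma periodic_unif_continuous g (e : R) : closed_curve g -> continuous g -> 0 < e ->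
  exists2 r, 0 < r & forall s t, `|s - t| <= r -> eucl (g s - g t) <= e.
Proof.
move=> pg cg e0.
have /compact_near_coveringP cov := @segment_compact R 0 1.
pose P (r x : R) := forall s, `|s - x| <= r -> eucl (g s - g x) <= e.
have : \forall r \near 0^'+, `[0, 1]%classic `<=` P r.
  apply: cov => x _; have [r r0 hr] := continuous_eucl_near (cg x) (divr_gt0 e0 (ltr0Sn _ 1)).
  have r2 : 0 < r / 2 by rewrite divr_gt0.
  exists ([set y | `|y - x| < r / 2], [set k | k < r / 2]) => /=.
    split; last exact: nbhs_right_lt.
    apply/nbhs_ballP; exists (r / 2) => // y; rewrite /ball/= distrC//.
  move=> [y k] /= [yx kr] s sy.
  have := eucl_dist_triangle (g x) (g s) (g y).
  have := hr y; have /[swap] /[apply] : `|y - x| < r by lra.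
  have := hr s; have /[swap] /[apply] : `|s - x| < r.
    by have := ler_distD y s x; lra.
  rewrite (euclB (g x)); lra.
move=> [r /= r0 hr]; exists (r / 2); first by rewrite divr_gt0.
have {}hr : `[0, 1]%classic `<=` P (r / 2).
  by apply: hr; rewrite /ball/= ?sub0r ?normrN ?ger0_norm; lra.
move=> s t st; have [m tm] := frac_01 t.
rewrite -(closed_curveDz t m)// -(closed_curveDz s m)//; apply: hr.
  by move: tm; rewrite /= !in_itv/= => /andP[-> /ltW].
by rewrite (_ : _ - _ = s - t)//; ring.
Qed.

(** By continuity a deviation of the speed from 1 would persist on an interval, which has positive
    measure. *)
Lemma C1_derivative_unit f : arclength_curves f -> C1_curves f ->
  forall t, eucl (derive1 f t) = 1.
Proof.
have absurd (a b : R) : 0 < a / 2 -> b <= a / 2 -> a <= b -> False by lra.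
move=> [_ _ [N [mN N0 hN]]] [_ _ cf'] t; apply: contrapT => ft.
have e0 : 0 < `|eucl (derive1 f t) - 1| / 2.
  by rewrite divr_gt0// normr_gt0 subr_eq0; exact/eqP.
have [r r0 hr] := continuous_eucl_near (cf' t) e0.
have rN : `]t - r, t + r[%classic `<=` N.
  move=> s /=; rewrite in_itv/= => /andP[s1 s2]; apply: hN => /= -[_ s3].
  have sr : `|s - t| < r by rewrite ltr_norml; move: s1 s2; clear; lra.
  have := eucl_lerB_dist (derive1 f s) (derive1 f t); rewrite s3 (distrC 1).
  exact: absurd e0 (hr s sr).
have : (mu `](t - r)%R, (t + r)%R[%classic <= mu N)%E.
  by apply: le_measure; rewrite ?inE.
rewrite N0 lebesgue_measure_itv/= lte_fin (_ : t - r < t + r); last by lra.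
by rewrite -EFinB lee_fin; lra.
Qed.

(** A mean value inequality for f(y) - y f'(x), whose derivative is small near x by uniform
    continuity of f'. Both endpoints may move while the derivative stays frozen at x, the form in
    which consecutive chords are compared. *)
Lemma C1_unif_derivable f (e : R) : arclength_curves f -> C1_curves f -> 0 < e ->
  exists2 r, 0 < r & forall x s t, `|s - x| <= r -> `|t - x| <= r ->
    eucl (f t - f s - (t - s) *: derive1 f x) <= e * `|t - s|.
Proof.
move=> fA [pf df cf'] e0.
have pf' : closed_curve (derive1 f).
  move=> t; rewrite /derive1; set u := (fun h => _); set w := (fun h => _).
  by suff -> : u = w by []; apply/funext => h; rewrite /u /w addrA !pf.
have e2 : 0 < e / 2 by rewrite divr_gt0.
have [r r0 hr] := periodic_unif_continuous pf' cf' e2.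
exists r => // x s t.
wlog st : s t / s <= t.
  move=> h sx tx; have [st|/ltW ts] := leP s t; first exact: h.
  rewrite (_ : _ - _ - _ = - (f s - f t - (s - t) *: derive1 f x)); last first.
    by apply/rowP => i; rewrite !mxE; ring.
  by rewrite euclN distrC; exact: h.
move=> sx tx; rewrite (ger0_norm (_ : 0 <= t - s)) ?subr_ge0//.
pose g y := f y - y *: derive1 f x.
have gE y z : g y - g z = f y - f z - (y - z) *: derive1 f x.
  by rewrite /g; apply/rowP => i; rewrite !mxE; ring.
rewrite -gE mulrBr.
have fl := arclength_lipschitz fA.
apply: (@right_local_bound _ _ g (1 + eucl (derive1 f x)) (fun y => e * y)) => //.
- move=> y z; rewrite gE; apply: le_trans (eucl_triangle _ _) _.
  by rewrite euclN euclZ mulrDl (mulrC (eucl _)) lerD// fl.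
- by move=> y z yz; rewrite ler_wpM2l// ltW.
move=> y /andP[sy yt]; have [k k0 hk] := derivable_eucl (df y) e2.
exists k => // z /andP[yz zk].
rewrite gE -mulrBr (_ : _ - _ - _ = (f z - f y - (z - y) *: derive1 f y) +
   (z - y) *: (derive1 f y - derive1 f x)); last first.
  move: (f z) (f y) (derive1 f x) (derive1 f y) => a b v w.
  by apply/rowP => i; rewrite !mxE; ring.
apply: le_trans (eucl_triangle _ _) _; rewrite euclZ.
have := hk z; rewrite ger0_norm ?subr_ge0// ltrBlDl => /(_ zk).
have : eucl (derive1 f y - derive1 f x) <= e / 2.
  by apply: hr; move: sx tx; rewrite !ler_norml; lra.
have : 0 <= z - y by rewrite subr_ge0.
by nra.
Qed.

(** Let B = f s - f x. The increment f t - f s and the chord B both nearly point along v = f'(x), so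
    by Cauchy-Schwarz the chord from x grows at rate at least 1 - 2e. One e is lost in the
    increment, the other in the bound of v against B, where |B| <= s - x. *)
Lemma chord_rate f (r e x s t : R) : eucl_lipschitz 1 f -> eucl (derive1 f x) = 1 ->
  0 < e <= 1 / 4 ->
  (forall s t, `|s - x| <= r -> `|t - x| <= r ->
    eucl (f t - f s - (t - s) *: derive1 f x) <= e * `|t - s|) ->
  x <= s -> s <= t -> t <= x + r ->
  (1 - 2 * e) * (t - s) <= eucl (f t - f x) - eucl (f s - f x).
Proof.
move=> fl v1 /andP[e0 e1] H xs st tr.
set v := derive1 f x in v1 H.
have h0 y z : x <= y -> y <= z -> z <= x + r ->
    eucl (f z - f y - (z - y) *: v) <= e * (z - y).
  move=> xy yz zr; rewrite -[z - y in leRHS]ger0_norm ?subr_ge0//.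
  by apply: H; rewrite ger0_norm; lra.
have dot_low y z w : x <= y -> y <= z -> z <= x + r ->
    (z - y) * dotp v w - e * (z - y) * eucl w <= dotp (f z - f y) w.
  move=> xy yz zr; set u := f z - f y - (z - y) *: v.
  have -> : f z - f y = u + (z - y) *: v by rewrite /u subrK.
  have : - dotp u w <= e * (z - y) * eucl w.
    rewrite -dotpNl; apply: le_trans (dotp_le_eucl _ _) _; rewrite euclN.
    by rewrite ler_wpM2r ?eucl_ge0// h0.
  by rewrite dotpDl dotpZl; lra.
(* Separated because the main case divides by the length of B. *)
have [xs0|sx] := eqVneq s x.
  have xt := le_trans xs st; have h := h0 x t (lexx _) xt tr.
  rewrite xs0 subrr eucl0 subr0.
  have := eucl_triangle ((t - x) *: v - (f t - f x)) (f t - f x).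
  rewrite subrK euclZ v1 mulr1 ger0_norm ?subr_ge0// (euclB (_ *: _)).
  have : 0 <= e * (t - x) by rewrite mulr_ge0 ?subr_ge0// ltW.
  lra.
have {}sx : x < s by rewrite lt_neqAle eq_sym sx.
have sr : s <= x + r by lra.
set B := f s - f x; set A := f t - f x.
have Bs : eucl B <= s - x by have := fl s x; rewrite mul1r ger0_norm// subr_ge0 ltW.
have vB : (1 - e) * (s - x) <= dotp v B.
  have := dot_low x s v (lexx _) (ltW sx) sr.
  by rewrite -sqr_eucl v1 expr1n !mulr1 -/B dotpC; lra.
have B0 : 0 < eucl B.
  have : dotp v B <= eucl v * eucl B by exact: dotp_le_eucl.
  rewrite v1 mul1r; apply: lt_le_trans; apply: lt_le_trans vB.
  by rewrite mulr_gt0 ?subr_gt0//; lra.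
have AB : dotp A B = eucl B ^+ 2 + dotp (f t - f s) B.
  rewrite sqr_eucl -dotpDl; congr dotp; rewrite /A /B.
  by apply/rowP => i; rewrite !mxE; ring.
have := dotp_le_eucl A B; rewrite AB => hAB.
have hB := dot_low s t B (ltW sx) st tr.
rewrite -(ler_pM2l B0).
have : (t - s) * ((1 - e) * eucl B) <= (t - s) * dotp v B.
  rewrite ler_wpM2l ?subr_ge0//; apply: le_trans vB.
  by rewrite ler_wpM2l//; lra.
lra.
Qed.

(** * Partitions with equal chords, by shooting *)

Section Step.
Variables (f : R -> 'rV[R]_d) (r e : R).
Hypotheses (fl : eucl_lipschitz 1 f) (v1 : forall x, eucl (derive1 f x) = 1)
  (e01 : 0 < e <= 1 / 4) (r0 : 0 < r)
  (H : forall x s t, `|s - x| <= r -> `|t - x| <= r ->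
    eucl (f t - f s - (t - s) *: derive1 f x) <= e * `|t - s|).

Let rate x s t : x <= s -> s <= t -> t <= x + r ->
  (1 - 2 * e) * (t - s) <= eucl (f t - f x) - eucl (f s - f x).
Proof. by apply: chord_rate => //; exact: H. Qed.

(** With e <= 1/4 the chord over a parameter step r is at least r/2, so the intermediate value
    theorem reaches every h up to r/2. *)
Lemma chord_step_exists h x : 0 <= h <= r / 2 ->
  exists y, x <= y <= x + r /\ eucl (f y - f x) = h.
Proof.
move=> /andP[h0 hr].
have xr : x <= x + r by rewrite lerDl ltW.
have := rate (lexx x) xr (lexx _); rewrite subrr eucl0 subr0 => hx.
have [] := @IVT R (fun y => eucl (f y - f x)) x (x + r) h xr.
- apply: continuous_subspaceT => y; apply/cvgrPdist_le => /= k k0.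
  near=> z; apply: le_trans (eucl_lerB_dist _ _) _.
  rewrite opprB addrA subrK; apply: le_trans (fl _ _) _; rewrite mul1r.
  by near: z; exact: cvgr_dist_le.
- rewrite subrr eucl0 min_l ?eucl_ge0// max_r ?eucl_ge0// h0/=.
  apply: le_trans hx; rewrite (_ : x + r - x = r); last by ring.
  have /andP[e0 e1] := e01.
  have : e * r <= 1 / 4 * r by rewrite ler_wpM2r// ltW.
  lra.
- by move=> y /[!in_itv]/= yx yh; exists y.
Unshelve. all: by end_near. Qed.

Lemma chord_step_bounds h x y : x <= y <= x + r -> eucl (f y - f x) = h ->
  h <= y - x /\ (1 - 2 * e) * (y - x) <= h.
Proof.
move=> /andP[xy yr] yh; split.
  by rewrite -yh; have := fl y x; rewrite mul1r ger0_norm ?subr_ge0.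
by have := rate (lexx x) xy yr; rewrite subrr eucl0 subr0 yh.
Qed.

(** Chord length grows at rate at least 1/2, so parameters differ by at most twice the difference of
    chord lengths; moving the starting point adds to this, and 3 covers all cases. The estimate also
    shows that the endpoint is unique. *)
Lemma chord_step_lipschitz h x y h' x' y' :
  x <= y <= x + r -> eucl (f y - f x) = h ->
  x' <= y' <= x' + r -> eucl (f y' - f x') = h' ->
  `|y - y'| <= 3 * (`|h - h'| + `|x - x'|).
Proof.
wlog xx : h x y h' x' y' / x' <= x.
  move=> W a1 a2 a3 a4; have [/W|/ltW xx] := leP x' x; first exact.
  by rewrite distrC (distrC h) (distrC x); apply: W.
move=> yx yh yx' yh'.
have [b1 b2] := chord_step_bounds yx yh.
have [b1' b2'] := chord_step_bounds yx' yh'.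
case/andP: yx => y1 y2; case/andP: yx' => y1' y2'.
have /andP[e0 e1] := e01.
have half : (y - x) <= 2 * h.
  have : (1 - 2 * e) * (y - x) >= 1 / 2 * (y - x) by rewrite ler_wpM2r ?subr_ge0//; lra.
  by lra.
have hh : h - h' <= `|h - h'| by exact: ler_norm.
rewrite [`|x - x'|]ger0_norm ?subr_ge0//.
have [y'x|xy'] := ltP y' x.
  by rewrite ger0_norm; lra.
have dh : `|eucl (f y' - f x) - h'| <= x - x'.
  rewrite -yh'; apply: le_trans (eucl_lerB_dist _ _) _.
  rewrite (_ : _ - _ = f x' - f x); last by apply/rowP => i; rewrite !mxE; ring.
  by have := fl x' x; rewrite mul1r distrC ger0_norm// subr_ge0.
move: dh; rewrite ler_norml => /andP[d1 d2].
have rt s t : x <= s -> s <= t -> t <= x + r ->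
    1 / 2 * (t - s) <= eucl (f t - f x) - eucl (f s - f x).
  move=> ? st ?; apply: le_trans (rate _ _ _) => //.
  by rewrite ler_wpM2r ?subr_ge0//; lra.
have hn : - `|h - h'| <= h - h' by rewrite lerNnormlW.
have [yy|/ltW yy] := leP y y'.
  have := rt y y' y1 yy; rewrite yh distrC ger0_norm ?subr_ge0//; lra.
have := rt y' y xy' yy; rewrite yh ger0_norm ?subr_ge0//; lra.
Qed.

(** Start at 0 and make n steps of chord length h. The endpoint depends continuously on h, is 0 for
    h = 0 and at least n r/2 >= 1 for h = r/2, so some h makes it exactly 1. *)
Lemma chord_partition n : (2 / r <= n%:R) ->
  exists h (x : nat -> R), [/\ 0 < h, x 0%N = 0, x n = 1 &
   forall k, [/\ h <= x k.+1 - x k, (1 - 2 * e) * (x k.+1 - x k) <= h &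
     eucl (f (x k.+1) - f (x k)) = h]].
Proof.
move=> nr; pose H2 := r / 2; have H20 : 0 < H2 by rewrite divr_gt0.
(* Clamping h to the range where a step exists makes the step map total, so that it can be
   iterated. *)
have clamp h : 0 <= Num.min (Num.max h 0) H2 <= r / 2.
  by rewrite le_min le_max lexx orbT (ltW H20) ge_min lexx orbT.
have ex h x : exists y, x <= y <= x + r /\ eucl (f y - f x) = Num.min (Num.max h 0) H2.
  exact/chord_step_exists/clamp.
pose T h x := sval (cid (ex h x)).
have TP h x : x <= T h x <= x + r /\ eucl (f (T h x) - f x) = Num.min (Num.max h 0) H2.
  exact: (svalP (cid (ex h x))).
have clampE h : 0 <= h <= H2 -> Num.min (Num.max h 0) H2 = h.
  by move=> /andP[h0 hH]; rewrite max_l// min_l.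
pose X h k := iter k (T h) 0.
have Xlip k : exists2 C, 0 <= C & forall h h', 0 <= h <= H2 -> 0 <= h' <= H2 ->
    `|X h k - X h' k| <= C * `|h - h'|.
  elim: k => [|k [C C0 ih]]; first by exists 0 => // h h' _ _; rewrite subrr normr0 mul0r.
  exists (3 * (1 + C)); first by rewrite mulr_ge0// addr_ge0.
  move=> h h' hH hH'; have [a1 a2] := TP h (X h k); have [b1 b2] := TP h' (X h' k).
  have := chord_step_lipschitz a1 a2 b1 b2; rewrite !clampE//.
  move=> /le_trans; apply; rewrite -mulrA ler_wpM2l//.
  by rewrite mulrDl mul1r lerD2l; exact: ih.
have XS h k : 0 <= h <= H2 -> [/\ h <= X h k.+1 - X h k,
    (1 - 2 * e) * (X h k.+1 - X h k) <= h & eucl (f (X h k.+1) - f (X h k)) = h].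
  move=> hH; have [a1 a2] := TP h (X h k); rewrite clampE// in a2.
  by have [b1 b2] := chord_step_bounds a1 a2; split.
have Xn0 : X 0 n = 0.
  elim: n {nr} => // k ih; have := XS 0 k; rewrite lexx (ltW H20) => /(_ isT)[a b _].
  apply/eqP; rewrite eq_le; have /andP[e0 e1] := e01; move: a b; rewrite ih subr0 => a b.
  by rewrite a andbT -(pmulr_rle0 _ (_ : 0 < 1 - 2 * e)); lra.
have Xn1 : 1 <= X H2 n.
  have : n%:R * H2 <= X H2 n.
    elim: n {nr Xn0} => [|k ih]; first by rewrite mul0r.
    have := XS H2 k; rewrite lexx (ltW H20) => /(_ isT)[a _ _].
    by rewrite -natr1 mulrDl mul1r; lra.
  apply: le_trans; move: nr; rewrite ler_pdivrMr//; rewrite /H2; lra.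
have [] := @IVT R (fun h => X h n) 0 H2 1 (ltW H20).
- have [C C0 Cl] := Xlip n.
  apply/subspace_continuousP => h; rewrite /= in_itv/= => hH.
  apply/cvgrPdist_le => /= k k0.
  have kC : 0 < k / (C + 1) by rewrite divr_gt0// ltr_wpDl.
  have : \forall h' \near within `[0, H2] (nbhs h), `|h - h'| <= k / (C + 1).
    by apply: cvg_within; exact: (@cvgr_dist_le _ _ _ (nbhs h) _ id h (@cvg_id _ _) _ kC).
  rewrite !near_withinE; apply: filterS => h' hh' hH'.
  apply: le_trans (Cl _ _ hH _) _; first by move: hH'; rewrite /= in_itv.
  apply: (@le_trans _ _ (C * (k / (C + 1)))); first by rewrite ler_wpM2l// hh'.
  by rewrite mulrCA ler_piMr ?(ltW k0)// ler_pdivrMr ?ltr_wpDl// mul1r lerDl.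
- by rewrite Xn0 min_l ?(le_trans ler01)// max_r ?(le_trans ler01)// ler01.
move=> h /[!in_itv]/= hH X1; exists h, (X h); split => //.
- case/andP: hH => h0 _; rewrite lt_neqAle h0 andbT; apply/eqP => h00.
  by move: X1; rewrite -h00 Xn0 => /esym/eqP; rewrite oner_eq0.
- by move=> k; exact: XS.
Qed.

End Step.

End C1.

(** * Riemann sums of the kernel *)

Section Riemann.
Context {R : realType} {d : nat}.
Implicit Types (f : R -> 'rV[R]_d).
Local Notation K := mobius_kernel.
Local Notation Q := (@unit_square R).
Local Notation KI := kernel_integral.

(* The deficit [l^2 - c^2] between arc length [l] and chord [c] is monotone under inclusion of arcs. *)
Lemma deficit_widen (l c l' c' : R) : 0 < l -> 2^-1 * l <= c -> c <= l ->
  0 < c' -> c' <= l' -> l <= l' -> l' <= 5 * l -> c' <= c + (l' - l) ->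
  (c ^+ 2)^-1 - (l ^+ 2)^-1 <= 4 * 5 ^+ 4 * ((c' ^+ 2)^-1 - (l' ^+ 2)^-1).
Proof.
move=> l0 cl c1 c'0 c'1 l'l ll' c'c.
have c0 : 0 < c by apply: lt_le_trans cl; rewrite mulr_gt0// invr_gt0.
have l'0 : 0 < l' by exact: lt_le_trans l'l.
have D1 : 0 <= l ^+ 2 - c ^+ 2 by rewrite subr_ge0 lerXn2r ?nnegrE// ltW.
(* With D = l' - l, (l + D)^2 - (c + D)^2 exceeds l^2 - c^2 by 2 D (l - c) >= 0, and c' <= c + D. *)
have D2 : l ^+ 2 - c ^+ 2 <= l' ^+ 2 - c' ^+ 2.
  have A : c' ^+ 2 <= (c + (l' - l)) ^+ 2.
    have s0 : 0 <= c + (l' - l) by apply: addr_ge0; [exact: ltW|rewrite subr_ge0].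
    rewrite lerXn2r ?nnegrE//. exact: ltW.
  have B : 0 <= (l' - l) * (l - c) by rewrite mulr_ge0 ?subr_ge0.
  have -> : l' ^+ 2 - c' ^+ 2 = l ^+ 2 - c ^+ 2 + 2 * ((l' - l) * (l - c)) +
    ((c + (l' - l)) ^+ 2 - c' ^+ 2) by ring.
  by rewrite -addrA lerDl addr_ge0 ?subr_ge0// mulr_ge0.
have E1 : (c ^+ 2)^-1 - (l ^+ 2)^-1 = (l ^+ 2 - c ^+ 2) * (c ^+ 2 * l ^+ 2)^-1.
  by field; rewrite !gt_eqF.
have E2 : (c' ^+ 2)^-1 - (l' ^+ 2)^-1 = (l' ^+ 2 - c' ^+ 2) * (c' ^+ 2 * l' ^+ 2)^-1.
  by field; rewrite !gt_eqF.
rewrite E1 E2.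
(* The factor 4 comes from c >= l/2, and 5^4 below from l' <= 5 l. *)
have F1 : (c ^+ 2 * l ^+ 2)^-1 <= 4 * (l ^+ 4)^-1.
  have -> : 4 * (l ^+ 4)^-1 = ((2^-1 * l) ^+ 2 * l ^+ 2)^-1 by field; rewrite gt_eqF.
  rewrite lef_pV2 ?posrE ?mulr_gt0 ?exprn_gt0 ?mulr_gt0 ?invr_gt0//.
  by rewrite ler_wpM2r ?sqr_ge0// lerXn2r ?nnegrE ?(ltW c0) ?mulr_ge0 ?invr_ge0 ?(ltW l0).
have F2 : (l' ^+ 4)^-1 <= (c' ^+ 2 * l' ^+ 2)^-1.
  rewrite lef_pV2 ?posrE ?mulr_gt0 ?exprn_gt0//.
  by rewrite (exprD _ 2 2) ler_wpM2r ?sqr_ge0// lerXn2r ?nnegrE ?(ltW c'0) ?(ltW l'0).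
have F3 : (l ^+ 4)^-1 <= 5 ^+ 4 * (l' ^+ 4)^-1.
  rewrite -[5 ^+ 4]invrK -invfM lef_pV2 ?posrE ?exprn_gt0 ?mulr_gt0 ?invr_gt0 ?exprn_gt0//.
  rewrite ler_pdivrMl ?exprn_gt0// -exprMn.
  by rewrite lerXn2r ?nnegrE ?(ltW l'0) ?mulr_ge0 ?(ltW l0).
apply: (@le_trans _ _ ((l ^+ 2 - c ^+ 2) * (4 * 5 ^+ 4 * (l' ^+ 4)^-1))).
  rewrite ler_wpM2l//; apply: le_trans F1 _; rewrite -mulrA ler_wpM2l//.
rewrite mulrCA ler_wpM2l ?mulr_ge0 ?exprn_ge0//; apply: ler_pM => //.
by rewrite invr_ge0 exprn_ge0// ltW.
Qed.

Lemma mobius_kernel_widen f (T X Y S : R) : embedded f -> arclength_curves f ->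
  T <= X -> X < Y -> Y <= S -> S - T <= 2^-1 -> S - T <= 5 * (Y - X) ->
  2^-1 * (Y - X) <= eucl (f Y - f X) -> K f X Y <= 4 * 5 ^+ 4 * K f T S.
Proof.
move=> ef fA TX XY YS ST5 STl cl.
have TS : T < S by lra.
rewrite -[K f X Y]mobius_kernelC -[K f T S]mobius_kernelC /K.
rewrite !circ_dist_small ?ger0_norm; [|lra..].
have fl := arclength_lipschitz fA.
have c1 : eucl (f Y - f X) <= Y - X by have := fl Y X; rewrite mul1r ger0_norm; lra.
have c'1 : eucl (f S - f T) <= S - T by have := fl S T; rewrite mul1r ger0_norm; lra.
have c'0 : 0 < eucl (f S - f T).
  apply: embedded_eucl_gt0 => //.
  by rewrite circ_dist_small ger0_norm ?subr_ge0 ?(ltW TS)// gt_eqF ?subr_gt0.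
apply: deficit_widen => //; [lra..|].
have := eucl_dist_triangle (f Y) (f S) (f T).
have := eucl_dist_triangle (f X) (f Y) (f T).
have := fl S Y; rewrite mul1r ger0_norm; last lra.
have := fl X T; rewrite mul1r ger0_norm; last lra.
by lra.
Qed.

Lemma cell_length_ge (x : nat -> R) h : (forall k, h <= x k.+1 - x k) ->
  forall i k, h * k%:R <= x (i + k)%N - x i.
Proof.
move=> xh i; elim=> [|k ih]; first by rewrite mulr0 addn0 subrr.
by rewrite addnS -natr1 mulrDr mulr1; have := xh (i + k)%N; lra.
Qed.

(** Each of the two arcs between x_j and x_i consists of a number of steps of length at least h, and
    the corresponding arc of the uniform grid of the same number of steps of length 1/n. Minimising
    over the two arcs gives the comparison with factor n h. *)
Lemma vertices_circ_dist (x : nat -> R) h n (i j : nat) :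
  (forall k, h <= x k.+1 - x k) -> 0 < h ->
  x 0%N = 0 -> x n = 1 -> (i < n)%N -> (j < n)%N ->
  (n%:R * h) * circ_dist (i%:R / n%:R) (j%:R / n%:R) <= circ_dist (x i) (x j).
Proof.
move=> xh h0 x0 xn.
wlog ji : i j / (j <= i)%N.
  move=> W iN jN; have [/W|/ltnW/W] := leqP j i; first exact.
  by rewrite circ_distC (circ_distC (x i)); apply.
move=> iN jN.
have nR : 0 < n%:R :> R by rewrite ltr0n (leq_ltn_trans _ iN).
have len := cell_length_ge xh.
have l1 := len j (i - j)%N; rewrite subnKC// in l1.
have l2 := len i (n - i)%N; rewrite subnKC ?xn in l2; last exact: ltnW.
have l3 := len 0%N j; rewrite add0n x0 subr0 in l3.
have ni : h <= h * (n - i)%:R by rewrite ler_pMr// ler1n subn_gt0.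
have hj : 0 <= h * j%:R by rewrite mulr_ge0// ltW.
have hij : 0 <= h * (i - j)%:R by rewrite mulr_ge0// ltW.
have aE : i%:R / n%:R - j%:R / n%:R = (i - j)%:R / n%:R :> R.
  by rewrite natrB// mulrBl.
have a1 : (i - j)%:R < n%:R :> R by rewrite ltr_nat (leq_ltn_trans (leq_subr _ _)).
rewrite !circ_distE; last 2 first.
- by apply/andP; split; lra.
- by rewrite aE divr_ge0//= ltr_pdivrMr// mul1r.
rewrite aE le_min; apply/andP; split.
  apply: (@le_trans _ _ (n%:R * h * ((i - j)%:R / n%:R))).
    by rewrite ler_wpM2l ?ge_min ?lexx// mulr_ge0// ltW.
  by rewrite (_ : _ * _ = h * (i - j)%:R)//; field; rewrite gt_eqF.
apply: (@le_trans _ _ (n%:R * h * (1 - (i - j)%:R / n%:R))).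
  by rewrite ler_wpM2l ?ge_min ?lexx ?orbT// mulr_ge0// ltW.
rewrite (_ : _ * _ = h * (n - i)%:R + h * j%:R); first by lra.
by rewrite !natrB ?(ltnW iN)//; field; rewrite gt_eqF.
Qed.

Section fixed_curve.
Variable f : R -> 'rV[R]_d.
Hypotheses (ef : embedded f) (fA : arclength_curves f).

(** Take T in the cell that ends at x_i and S in the cell that starts at x_j: the arc from T to S
    contains the arc between the vertices and is longer by at most 4h. As the latter has length at
    least h, the ratio is at most 5. The integer m lifts x_j so that it follows x_i along the short
    arc. *)
Lemma near_cell_le (x : nat -> R) (h e r : R) n (i j : 'I_n) (m : int) :
  0 < h -> x 0%N = 0 -> x n = 1 ->
  (forall k, h <= x k.+1 - x k <= 2 * h) ->
  (forall t s, `|t - s| <= r -> 2^-1 * `|t - s| <= eucl (f t - f s)) ->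
  e <= r -> e <= 2^-1 -> h <= x j + m%:~R - x i -> x j + m%:~R - x i + 4 * h < e ->
  ((h ^+ 2 * K f (x i) (x j))%:E <=
   (4 * 5 ^+ 4)%:E * KI f ((cell x (ord_pred i) `*` cell x j) `&` ~` far e))%E.
Proof.
move=> h0 x0 xn xh fr er e2 hYX YXe.
have K0 := mobius_kernel_ge0 _ _ ef fA.
have cf : closed_curve f by case: ef.
(* The cell before x_0 is the last one, shifted by -1. *)
have [l lP] : exists l : int, forall t, cell x (ord_pred i) t ->
    x i - 2 * h <= t + l%:~R <= x i.
  have n0 : (0 < n)%N by apply: leq_ltn_trans (ltn_ord i).
  have [i0|i0] := posnP i.
    exists (-1) => t; rewrite /cell/= i0 add0n modn_small ?prednK//.
    rewrite in_itv/= xn x0 => /andP[t1 t2].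
    have /andP[_ ] := xh n.-1; rewrite prednK// xn => h2.
    by rewrite rmorphN/=; apply/andP; split; lra.
  exists 0 => t; rewrite /cell/=.
  have -> : ((i + n).-1 %% n = i.-1)%N.
    rewrite -(prednK i0) addSn/= modnDr modn_small//.
    by rewrite (leq_ltn_trans (leq_pred _)).
  rewrite prednK// in_itv/= => /andP[t1 t2].
  have /andP[_ ] := xh i.-1; rewrite prednK// => h2.
  by apply/andP; split; lra.
set X := x i; set Y := x j + m%:~R.
have KXY : K f X Y = K f (x i) (x j).
  by rewrite /X /Y -{1}[x i]addr0 (mobius_kernelDz _ _ 0).
have xS k : x k <= x k.+1 by have /andP[] := xh k; rewrite -subr_ge0; lra.
have sub z : (cell x (ord_pred i) `*` cell x j) z ->
    circ_dist z.1 z.2 < e /\ K f X Y <= 4 * 5 ^+ 4 * K f z.1 z.2.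
  move=> [/= /lP/andP[t1 t2]]; rewrite /cell/= in_itv/= => /andP[s1 s2].
  have /andP[_ xj] := xh j.
  have ST : z.2 + m%:~R - (z.1 + l%:~R) <= Y - X + 4 * h by rewrite /X /Y; lra.
  split.
    rewrite -(circ_distDz z.1 z.2 l) circ_distC -(circ_distDz z.2 _ m).
    apply: le_lt_trans (circ_dist_le_norm _ _) _.
    by rewrite ger0_norm; rewrite /X /Y in ST; lra.
  rewrite -(mobius_kernelDz z.1 z.2 l m)//.
  apply: mobius_kernel_widen => //; rewrite /X /Y in ST *; [lra..|].
  have := fr Y X; rewrite ger0_norm; last by rewrite /X /Y; lra.
  by apply; rewrite /X /Y; lra.
have -> : (cell x (ord_pred i) `*` cell x j) `&` ~` far e = cell x (ord_pred i) `*` cell x j.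
  apply/setIidl => z /sub[ze _]; rewrite /far/= => /le_lt_trans/(_ ze).
  by rewrite ltxx.
have C0 : 0 < 4 * 5 ^+ 4 :> R by rewrite mulr_gt0// exprn_gt0.
have c0 : 0 <= (4 * 5 ^+ 4)^-1 * K f X Y by rewrite mulr_ge0 ?K0// invr_ge0 ltW.
have Kc z : (cell x (ord_pred i) `*` cell x j) z -> (4 * 5 ^+ 4)^-1 * K f X Y <= K f z.1 z.2.
  by move=> /sub[_]; rewrite -ler_pdivrMl// => hz; rewrite ler_pdivrMl.
have := kernel_integral_ge_cst ef (measurable_cell2 x (ord_pred i) j) c0 Kc.
rewrite measure_cell2// -EFinM => h1.
apply: (@le_trans _ _ ((4 * 5 ^+ 4)%:E * ((4 * 5 ^+ 4)^-1 * K f X Y *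
   ((x (ord_pred i).+1 - x (ord_pred i)) * (x j.+1 - x j)))%:E)%E); last first.
  by rewrite lee_pmul2l// lte_fin.
rewrite -EFinM lee_fin KXY !mulrA divff ?gt_eqF// mul1r -mulrA mulrC ler_wpM2l ?K0//.
rewrite expr2; have /andP[a1 _] := xh (ord_pred i); have /andP[a2 _] := xh j.
by apply: ler_pM => //; exact: ltW.
Qed.

Lemma far_cell_le (x : nat -> R) (e r h : R) (i j : nat) : 0 <= r -> 0 < e ->
  x i <= x i.+1 -> x j <= x j.+1 ->
  (forall t s t' s', e <= circ_dist t s -> `|t - t'| <= h -> `|s - s'| <= h ->
     K f t s <= K f t' s' + r) ->
  x i.+1 - x i <= h -> x j.+1 - x j <= h ->
  e <= circ_dist (x i) (x j) ->
  (((x i.+1 - x i) * (x j.+1 - x j) * K f (x i) (x j))%:E <=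
   KI f (cell x i `*` cell x j) + ((x i.+1 - x i) * (x j.+1 - x j) * r)%:E)%E.
Proof.
move=> r0 e0 xi xj H hi hj eij.
set a := (_ - _) * _; have a0 : 0 <= a by rewrite mulr_ge0// subr_ge0.
(* Truncated at 0, because integrating a constant lower bound asks for a nonnegative constant. *)
have Kc z : (cell x i `*` cell x j) z -> Num.max (K f (x i) (x j) - r) 0 <= K f z.1 z.2.
  move=> [/= zi zj]; rewrite ge_max mobius_kernel_ge0// andbT lerBlDr.
  move: zi zj; rewrite /cell/= !in_itv/= => /andP[? ?] /andP[? ?].
  by apply: H => //; rewrite ler0_norm; lra.
have c0 : 0 <= Num.max (K f (x i) (x j) - r) 0 by rewrite le_max lexx orbT.
have := kernel_integral_ge_cst ef (measurable_cell2 x i j) c0 Kc.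
rewrite measure_cell2// -/a -EFinM => h1.
apply: le_trans (leeD2r _ h1); rewrite -EFinD lee_fin.
have : K f (x i) (x j) - r <= Num.max (K f (x i) (x j) - r) 0 by rewrite le_max lexx.
by nra.
Qed.

End fixed_curve.
End Riemann.

Section RiemannSum.
Context {R : realType} {d : nat}.
Implicit Types (f : R -> 'rV[R]_d).
Local Notation K := mobius_kernel.
Local Notation Q := (@unit_square R).
Local Notation KI := kernel_integral.

Lemma grid_circ_dist_ge n (i j : 'I_n) : i != j ->
  n%:R^-1 <= circ_dist (i%:R / n%:R) (j%:R / n%:R) :> R.
Proof.
move=> ij; have n0 : (0 < n)%N by apply: leq_ltn_trans (ltn_ord i).
have nR : 0 < n%:R :> R by rewrite ltr0n.
have [m ->] := circ_distP (i%:R / n%:R : R) (j%:R / n%:R).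
have -> : i%:R / n%:R - j%:R / n%:R - m%:~R = (i%:Z - j%:Z - m * n%:Z)%:~R / n%:R :> R.
  by rewrite !rmorphB rmorphM/= -!pmulrn; field; rewrite gt_eqF.
rewrite normrM [X in _ * X]ger0_norm ?invr_ge0 ?ler0n// -[leLHS]mul1r ler_wpM2r ?invr_ge0//.
rewrite -intr_norm ler1z -gtz0_ge1 normr_gt0; apply: contra ij => /eqP h.
have /eqP : (i%:Z == j%:Z %[mod n%:Z])%Z.
  rewrite eqz_mod_dvd (_ : i%:Z - j%:Z = m * n%:Z) ?dvdz_mull//.
  by apply/eqP; rewrite -subr_eq0 h.
by rewrite !modz_small ?ltz_nat ?ltn_ord// => -[/val_inj ->].
Qed.

(** Far pairs are compared with their own cell, near pairs with C times the integral over the outer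
    cell. The far errors add up to eps/2, and the near cells, counted once for each orientation of
    the pair, to at most eps/4 twice. *)
Lemma riemann_sum_le f (eps r : R) : embedded f -> arclength_curves f ->
  (mobius_energy f < +oo)%E -> 0 < eps -> 0 < r ->
  (forall t s, `|t - s| <= r -> 2^-1 * `|t - s| <= eucl (f t - f s)) ->
  exists2 h0, 0 < h0 & forall n h (x : nat -> R), 0 < h <= h0 ->
    x 0%N = 0 -> x n = 1 -> (forall k, h <= x k.+1 - x k <= 2 * h) ->
    ((\sum_(i < n) \sum_(j < n) h ^+ 2 * K f (x i) (x j))%:E
      <= mobius_energy f + eps%:E)%E.
Proof.
move=> ef fA Efin eps0 r0 fr.
pose C : R := 4 * 5 ^+ 4; have C0 : 0 < C by rewrite mulr_gt0// exprn_gt0.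
have e10 : 0 < eps / 4 / C by rewrite !divr_gt0.
have [D0 D00 hD0] := mobius_energy_near ef fA Efin e10.
(* Below r the local chord bound applies, and below 1/2 arc length is circle distance. *)
pose D := Num.min D0 (Num.min r 2^-1).
have D_gt0 : 0 < D by rewrite !lt_min D00 r0 /= invr_gt0 ltr0n.
have D_le0 : D <= D0 by rewrite ge_min lexx.
have D_ler : D <= r by rewrite !ge_min lexx orbT.
have D_le2 : D <= 2^-1 by rewrite !ge_min lexx !orbT.
have mQ := @measurable_unit_square R.
have mfar e := @measurable_far R e.
have hD : (KI f (Q `&` ~` far D) <= (eps / 4 / C)%:E)%E.
  apply: le_trans hD0; apply: subset_kernel_integral => //.
  - by apply: measurableI => //; exact: measurableC.
  - exact: measurableD.
  - by move=> z [Qz zD]; split => // /(le_trans D_le0).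
have e20 : 0 < eps / 2 by rewrite divr_gt0.
have D20 : 0 < D / 2 by rewrite divr_gt0.
have [hh hh0 hpert] := mobius_kernel_perturb ef fA D20 e20.
have {}hpert t s t' s' : D / 2 <= circ_dist t s -> `|t - t'| <= hh -> `|s - s'| <= hh ->
     K f t s <= K f t' s' + eps / 2.
  move=> a1 a2 a3; have := hpert f t s t' s' a1 a2 a3.
  rewrite !subrr eucl0 (ltW hh0) => /(_ isT isT); rewrite ler_norml; lra.
(* Cells have length up to 2h, which must not exceed hh; and a near pair, at distance below D/2,
   must stay below D after widening by 4h. *)
pose h0 := Num.min (hh / 2) (D / 16).
exists h0; first by rewrite lt_min !divr_gt0.
move=> n h x /andP[h_gt0 hh0'] x0 xn xh.
have h1 : 2 * h <= hh.
  by have := le_trans hh0' (_ : h0 <= hh / 2); rewrite ge_min lexx => /(_ isT); lra.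
have h2 : 16 * h <= D.
  by have := le_trans hh0' (_ : h0 <= D / 16); rewrite ge_min lexx orbT => /(_ isT); lra.
have K0 t s := mobius_kernel_ge0 t s ef fA.
have KI0 A := kernel_integral_ge0 ef fA A.
have xS k : x k <= x k.+1 by have /andP[] := xh k; rewrite -subr_ge0; lra.
pose I i j := KI f (cell x i `*` cell x j).
pose N i j := KI f ((cell x i `*` cell x j) `&` ~` far D).
pose w i j := (x i.+1 - x i) * (x j.+1 - x j) * (eps / 2).
have w0 i j : 0 <= w i j.
  by rewrite !mulr_ge0 ?subr_ge0 ?(ltW e20)// ltW.
(* All possible bounds are added on the right, which is legitimate since they are nonnegative and
   avoids splitting the double sum by cases. *)
have main (ij : 'I_n * 'I_n) : ((h ^+ 2 * K f (x ij.1) (x ij.2))%:E <=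
    I ij.1 ij.2 + (w ij.1 ij.2)%:E +
    (C%:E * N (ord_pred ij.1) ij.2 + C%:E * N (ord_pred ij.2) ij.1))%E.
  case: ij => i j /=.
  have nn1 : (0 <= I i j + (w i j)%:E)%E by rewrite adde_ge0// ?KI0// lee_fin.
  have nn2 a b : (0 <= C%:E * N a b)%E by rewrite mule_ge0 ?KI0// lee_fin ltW.
  have [far_ij|near_ij] := leP (D / 2) (circ_dist (x i) (x j)).
    apply: le_trans (leeDl _ _); last by rewrite adde_ge0.
    have hi : x i.+1 - x i <= hh by have /andP[_] := xh i; lra.
    have hj : x j.+1 - x j <= hh by have /andP[_] := xh j; lra.
    have := far_cell_le ef fA (ltW e20) D20 (xS i) (xS j) hpert hi hj far_ij.
    apply: le_trans; rewrite lee_fin ler_wpM2r// expr2.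
    have /andP[? _] := xh i; have /andP[? _] := xh j.
    by apply: ler_pM => //; exact: ltW.
  have [ij|ij] := eqVneq i j.
    rewrite (_ : K f (x i) (x j) = 0) ?mulr0.
      by apply: adde_ge0 => //; exact: adde_ge0.
    by rewrite ij -{1}[x j]addr0 (mobius_kernel_diag _ 0)//; case: ef.
  have n0 : (0 < n)%N by apply: leq_ltn_trans (ltn_ord i).
  have nR : 0 < n%:R :> R by rewrite ltr0n.
  have hd : h <= circ_dist (x i) (x j).
    have xh' k : h <= x k.+1 - x k by have /andP[] := xh k.
    apply: le_trans (vertices_circ_dist xh' h_gt0 x0 xn (ltn_ord i) (ltn_ord j)).
    rewrite {1}(_ : h = n%:R * h * n%:R^-1); last by field; rewrite gt_eqF.
    by rewrite ler_wpM2l ?grid_circ_dist_ge// mulr_ge0// ltW.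
  have [m hm] := circ_distP (x j) (x i); rewrite circ_distC in hm.
  (* The sign tells which of the two vertices comes first along the short arc; the other case
     follows by symmetry of the kernel. *)
  have [w_ge0|w_lt0] := leP 0 (x j - x i - m%:~R).
    rewrite ger0_norm// in hm.
    apply: le_trans (leeDr _ nn1); apply: le_trans (leeDl _ (nn2 _ _)).
    apply: (@near_cell_le _ _ f ef fA x h D r n i j (- m)) => //.
      by rewrite rmorphN/=; lra.
    by rewrite rmorphN/=; lra.
  rewrite ltr0_norm// in hm.
  apply: le_trans (leeDr _ nn1); apply: le_trans (leeDr _ (nn2 _ _)).
  rewrite mobius_kernelC.
  by apply: (@near_cell_le _ _ f ef fA x h D r n j i m) => //; lra.
rewrite pair_bigA/= -sumEFin; apply: le_trans (lee_sum _ (fun ij _ => main ij)) _.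
have sumI : (\sum_(ij : 'I_n * 'I_n) I ij.1 ij.2 = mobius_energy f)%E.
  rewrite mobius_energyE// -/(KI f Q) -[Q in RHS]setIT.
  rewrite (kernel_integral_cells ef fA measurableT xS x0 xn).
  by apply: eq_bigr => ij _; rewrite setIT.
have sumN : (\sum_(ij : 'I_n * 'I_n) N ij.1 ij.2 <= (eps / 4 / C)%:E)%E.
  apply: le_trans hD; rewrite (kernel_integral_cells ef fA _ xS x0 xn)//.
  exact: measurableC.
(* The index maps to outer cells are injective, so the shifted sum is a reindexing of the sum over
   all near cells. *)
have sumC (s : 'I_n * 'I_n -> 'I_n * 'I_n) : injective s ->
    (\sum_(ij : 'I_n * 'I_n) C%:E * N (s ij).1 (s ij).2 <= (eps / 4)%:E)%E.
  move=> sinj; rewrite -ge0_sume_distrr => [|ij _]; last exact: KI0.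
  rewrite [X in (_ * X)%E](_ : _ = \sum_(ij : 'I_n * 'I_n) N ij.1 ij.2)%E; last first.
    by rewrite [RHS](reindex_inj sinj).
  apply: le_trans (lee_wpmul2l _ sumN) _; first by rewrite lee_fin ltW.
  by rewrite -EFinM lee_fin mulrCA divff ?mulr1// gt_eqF.
have inj1 : injective (fun ij : 'I_n * 'I_n => (ord_pred ij.1, ij.2)).
  move=> ij ij' e; have /ord_pred_inj := congr1 fst e; have := congr1 snd e.
  by case: ij ij' {e} => [i j] [i' j'] /= -> ->.
have inj2 : injective (fun ij : 'I_n * 'I_n => (ord_pred ij.2, ij.1)).
  move=> ij ij' e; have /ord_pred_inj := congr1 fst e; have := congr1 snd e.
  by case: ij ij' {e} => [i j] [i' j'] /= -> ->.
have sumw : \sum_(ij : 'I_n * 'I_n) w ij.1 ij.2 = eps / 2.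
  have tel : \sum_(i < n) (x i.+1 - x i) = 1.
    by rewrite -(big_mkord xpredT (fun i => x i.+1 - x i)) telescope_sumr// xn x0 subr0.
  rewrite -(pair_bigA _ (fun i j : 'I_n => w i j))/=.
  transitivity (\sum_(i < n) (x i.+1 - x i) * (eps / 2)).
    apply: eq_bigr => i _; rewrite /w -mulr_suml -mulr_sumr tel mulr1//.
  by rewrite -mulr_suml tel mul1r.
have split : (\sum_(ij : 'I_n * 'I_n) (I ij.1 ij.2 + (w ij.1 ij.2)%:E +
    (C%:E * N (ord_pred ij.1) ij.2 + C%:E * N (ord_pred ij.2) ij.1)) =
  \sum_(ij : 'I_n * 'I_n) I ij.1 ij.2 + \sum_(ij : 'I_n * 'I_n) (w ij.1 ij.2)%:E +
  (\sum_(ij : 'I_n * 'I_n) C%:E * N (ord_pred ij.1) ij.2 +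
   \sum_(ij : 'I_n * 'I_n) C%:E * N (ord_pred ij.2) ij.1))%E.
  by rewrite !big_split.
rewrite split sumI sumEFin sumw -addeA; apply: leeD2l.
apply: (@le_trans _ _ ((eps / 2)%:E + ((eps / 4)%:E + (eps / 4)%:E))%E).
  by apply: leeD2l; apply: leeD; [exact: (sumC _ inj1)|exact: (sumC _ inj2)].
by rewrite -!EFinD lee_fin; lra.
Qed.

End RiemannSum.

(** * Inscribed polygons *)

Section Grid.
Context {R : realType} {d : nat}.
Implicit Types (f g p : R -> 'rV[R]_d) (i : int).
Local Notation mu := (@lebesgue_measure R).

(** Indexed by all integers, so that the periodic lift has no special case at the seam. *)
Definition grid_affine (n : nat) p (w : int -> 'rV[R]_d) := forall i s,
  i%:~R / n%:R <= s <= (i + 1)%:~R / n%:R -> p s = p (i%:~R / n%:R) + (s - i%:~R / n%:R) *: w i.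

Lemma grid_floor (n : nat) (s : R) : (0 < n)%N ->
  (Num.floor (n%:R * s))%:~R / n%:R <= s < (Num.floor (n%:R * s) + 1)%:~R / n%:R.
Proof.
move=> n0; have nR : 0 < n%:R :> R by rewrite ltr0n.
by rewrite ler_pdivrMr// ltr_pdivlMr// mulrC; exact: floor_itv.
Qed.

Lemma grid_lipschitz (n : nat) g (c : R) : (0 < n)%N ->
  (forall i s t, i%:~R / n%:R <= s -> s <= t -> t <= (i + 1)%:~R / n%:R ->
     eucl (g t - g s) <= c * (t - s)) -> eucl_lipschitz c g.
Proof.
move=> n0 gc; have nR : 0 < n%:R :> R by rewrite ltr0n.
have main (m : nat) i s t : s <= t -> i%:~R / n%:R <= s <= (i + 1)%:~R / n%:R ->
    (i + m%:Z)%:~R / n%:R <= t <= (i + m%:Z + 1)%:~R / n%:R -> eucl (g t - g s) <= c * (t - s).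
  elim: m t => [|m ih] t st /andP[s1 s2] /andP[t1 t2].
    by rewrite addr0 in t2; exact: (gc i).
  have e1 : (i + m.+1%:Z)%:~R = (i + m%:Z + 1)%:~R :> R by rewrite -addn1 PoszD addrA.
  rewrite e1 in t1.
  have mid : (i + m%:Z)%:~R / n%:R <= (i + m%:Z + 1)%:~R / n%:R :> R.
    by rewrite ler_pM2r ?invr_gt0// ler_int lerDl.
  set z : R := (i + m%:Z + 1)%:~R / n%:R in t1 mid *.
  have sz : s <= z.
    apply: le_trans s2 _; rewrite /z ler_pM2r ?invr_gt0// ler_int lerD2r lerDl.
    by [].
  have := ih z sz; rewrite s1 s2 mid lexx => /(_ isT isT) h1.
  have h2 : eucl (g t - g z) <= c * (t - z).
    by apply: (gc (i + m%:Z + 1)) => //; move: t2; rewrite -addn1 PoszD addrA.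
  by have := eucl_dist_triangle (g z) (g t) (g s); lra.
have {}main s t : s <= t -> eucl (g t - g s) <= c * (t - s).
  move=> st; have /andP[s1 s2] := grid_floor s n0; have /andP[t1 t2] := grid_floor t n0.
  have fst : Num.floor (n%:R * s) <= Num.floor (n%:R * t).
    by apply: Num.Theory.le_floor; rewrite ler_pM2l.
  set i := Num.floor (n%:R * s) in s1 s2 fst *; set j := Num.floor (n%:R * t) in t1 t2 fst *.
  have jE : j = i + `|j - i|%N%:Z by rewrite gez0_abs ?subr_ge0// subrKC.
  apply: (main `|j - i|%N i) => //; first by rewrite s1 ltW.
  by rewrite -jE t1 ltW.
move=> t s; have [st|/ltW ts] := leP s t; first by rewrite ger0_norm ?subr_ge0// main.
by rewrite euclB distrC ger0_norm ?subr_ge0// main.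
Qed.

Lemma grid_affine_lipschitz n p w : (0 < n)%N -> grid_affine n p w ->
  (forall i, eucl (w i) = 1) -> eucl_lipschitz 1 p.
Proof.
move=> n0 pw w1; apply: (grid_lipschitz n0) => i s t s1 st t1.
rewrite (pw i t) ?t1 ?(le_trans s1)// (pw i s) ?s1 ?(le_trans st)//.
rewrite (_ : _ - _ = (t - s) *: w i); last by apply/rowP => k; rewrite !mxE; ring.
by rewrite euclZ w1 mulr1 mul1r ger0_norm ?subr_ge0.
Qed.

Lemma derivable_near_affine p (v : 'rV[R]_d) (t : R) :
  (\forall s \near t, p s = p t + (s - t) *: v) ->
  derivable p t 1 /\ derive1 p t = v.
Proof.
move=> /nbhs_ballP[r /= r0 hr].
have cv : (fun h => h^-1 *: (p (h + t) - p t)) @ (0:R)^' --> v.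
  apply: cvg_near_cst; exists r => //= h. rewrite /ball_/= sub0r normrN => hr' h0.
  rewrite (hr (h + t)); last first.
    by rewrite /ball/= (_ : t - (h + t) = - h) ?normrN//; ring.
  rewrite (_ : h + t - t = h); last by ring.
  by rewrite addrC addKr scalerA mulVf// scale1r.
split; last exact/cvg_lim.
rewrite /derivable; apply/cvg_ex; exists v; move: cv.
set g1 := (fun h => _); set g2 := (fun h => _).
suff -> : g1 = g2 by []; apply/funext => h; rewrite /g1 /g2 /= [h *: 1]mulr1//.
Qed.

Lemma grid_affine_arclength n p w : (0 < n)%N -> closed_curve p ->
  grid_affine n p w -> (forall i, eucl (w i) = 1) -> arclength_curves p.
Proof.
move=> n0 cp pw w1; have nR : 0 < n%:R :> R by rewrite ltr0n.
split => //; first exact: eucl_lipschitzW (grid_affine_lipschitz n0 pw w1).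
pose N : set R := range (fun i : int => i%:~R / n%:R).
have cN : countable N by apply: card_le_trans (card_image_le _ _) _; exact: countableP.
exists N; split.
- exact: countable_measurable.
- exact: countable_lebesgue_measure0.
move=> t /= ht; apply: contrapT => nt; apply: ht.
have /andP[t1 t2] := grid_floor t n0; set i := Num.floor (n%:R * t) in t1 t2.
have {}t1 : i%:~R / n%:R < t.
  by rewrite lt_neqAle t1 andbT; apply/eqP => ti; apply: nt; exists i.
have [|dp ->] := @derivable_near_affine p (w i) t; last by [].
near=> s; rewrite (pw i s); last first.
  apply/andP; split; apply/ltW; near: s; [exact: lt_nbhsr|exact: lt_nbhsl].
rewrite (pw i t); last by rewrite !ltW.
by apply/rowP => k; rewrite !mxE; ring.
Unshelve. all: by end_near. Qed.

(** With n > 1 the step 1/n is at most 1/2, hence equal to the circle distance of consecutive grid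
    points. *)
Lemma grid_affine_equilateral n p w : (1 < n)%N -> closed_curve p ->
  grid_affine n p w -> (forall i, eucl (w i) = 1) ->
  equilateral_vertices n p (fun i : nat => i%:R / n%:R).
Proof.
move=> n1 cp pw w1; have n0 : (0 < n)%N by apply: ltnW.
have nR : 0 < n%:R :> R by rewrite ltr0n.
have step (i : nat) : i.+1%:R / n%:R - i%:R / n%:R = n%:R^-1 :> R.
  by rewrite -natr1 mulrDl mul1r addrC addKr.
split.
- exact: grid_affine_arclength pw w1.
- split; last by rewrite divff ?gt_eqF// mul0r add0r.
  by move=> i _; rewrite -subr_gt0 step invr_gt0.
- have n2 : n%:R^-1 <= 2^-1 :> R by rewrite lef_pV2 ?posrE// ler_nat.
  have nV : 0 <= n%:R^-1 :> R by rewrite invr_ge0 ltW.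
  by move=> i _; rewrite circ_dist_small step ger0_norm.
move=> i _ c /andP[c0 c1].
have iR : i%:R = (i%:Z)%:~R :> R by rewrite -pmulrn.
have iR1 : i.+1%:R = (i%:Z + 1)%:~R :> R by rewrite rmorphD/= -pmulrn natr1.
have h s := pw i%:Z s; rewrite -iR -iR1 in h.
have st := step i.
have c3 : c * n%:R^-1 <= n%:R^-1 by rewrite ler_piMl// invr_ge0 ltW.
have c4 : 0 <= c * n%:R^-1 by rewrite mulr_ge0// invr_ge0 ltW.
have E : (1 - c) * (i%:R / n%:R) + c * (i.+1%:R / n%:R) = i%:R / n%:R + c * n%:R^-1.
  by rewrite -st; ring.
rewrite E (h (i%:R / n%:R + c * n%:R^-1)); last by apply/andP; split; lra.
rewrite (h (i.+1%:R / n%:R)); last by rewrite -subr_ge0 st invr_ge0 ltW//=.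
rewrite st; apply/rowP => k; rewrite !mxE; ring.
Qed.

End Grid.

Section Inscribed.
Context {R : realType} {d : nat}.
Variables (f : R -> 'rV[R]_d) (n : nat) (h : R) (x : nat -> R).
Hypotheses (cf : closed_curve f) (n1 : (1 < n)%N) (h0 : 0 < h)
  (x0 : x 0%N = 0) (xn : x n = 1)
  (xh : forall k, eucl (f (x k.+1) - f (x k)) = h).

Definition inscribed_vertex (i : int) : 'rV[R]_d := f (x `|(i %% n%:Z)%Z|%N).

Definition inscribed_slope (i : int) : 'rV[R]_d :=
  h^-1 *: (inscribed_vertex (i + 1) - inscribed_vertex i).

(* The polygon through the points [f (x k)], rescaled about [f 0] by the factor [(n h)^-1] so as to have length [1]. *)
Definition inscribed_polygon (s : R) : 'rV[R]_d :=
  let i := Num.floor (n%:R * s) in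
  f 0 + (n%:R * h)^-1 *: (inscribed_vertex i - f 0)
    + (s - i%:~R / n%:R) *: inscribed_slope i.

Let n0 : (0 < n)%N. Proof. exact: ltnW. Qed.
Let nR : 0 < n%:R :> R. Proof. by rewrite ltr0n. Qed.

Lemma inscribed_vertexDn i m : inscribed_vertex (i + m * n%:Z) = inscribed_vertex i.
Proof. by rewrite /inscribed_vertex addrC modzMDl. Qed.

Lemma inscribed_vertex_nat (k : nat) : (k <= n)%N -> inscribed_vertex k = f (x k).
Proof.
rewrite leq_eqVlt => /predU1P[->|kn]; last first.
  by rewrite /inscribed_vertex modz_small.
rewrite /inscribed_vertex modzz absz0 x0 xn.
by rewrite -[X in _ = f X]add0r cf.
Qed.

(** At the seam the index on the right is n, and x_n = 1 and x_0 = 0 give the same point of the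
    closed curve. *)
Lemma inscribed_vertexS (i : int) :
  inscribed_vertex (i + 1) = f (x `|(i %% n%:Z)%Z|%N.+1).
Proof.
have i0 : (0 <= i %% n%:Z)%Z by rewrite modz_ge0// eqz_nat -lt0n.
have iN : (`|(i %% n%:Z)%Z| < n)%N.
  by rewrite -ltz_nat gez0_abs// ltz_pmod.
rewrite -inscribed_vertex_nat//.
have -> : `|(i %% n%:Z)%Z|%N.+1%:Z = (i %% n%:Z)%Z + 1 by rewrite intS addrC gez0_abs.
by rewrite /inscribed_vertex modzDml.
Qed.

Lemma inscribed_slope_unit i : eucl (inscribed_slope i) = 1.
Proof.
rewrite /inscribed_slope inscribed_vertexS /inscribed_vertex euclZ xh.
by rewrite ger0_norm ?mulVf ?gt_eqF// invr_ge0 ltW.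
Qed.

Lemma inscribed_polygonE i s : i%:~R / n%:R <= s <= (i + 1)%:~R / n%:R ->
  inscribed_polygon s = f 0 + (n%:R * h)^-1 *: (inscribed_vertex i - f 0)
    + (s - i%:~R / n%:R) *: inscribed_slope i.
Proof.
move=> /andP[si]; rewrite le_eqVlt => /predU1P[->|s1].
  (* At the right endpoint [Num.floor] selects the next piece; the two agree because a step 1/n at
     slope h^-1 moves by (n h)^-1 times the chord vector. *)
  rewrite /inscribed_polygon mulrCA divff ?gt_eqF// mulr1 intrKfloor subrr scale0r addr0.
  rewrite -addrA; congr (_ + _).
  have -> : (i + 1)%:~R / n%:R - i%:~R / n%:R = n%:R^-1 :> R.
    by rewrite rmorphD/= mulrDl mul1r addrC addKr.
  rewrite /inscribed_slope scalerA -invfM -scalerDr; congr (_ *: _).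
  by apply/rowP => k; rewrite !mxE; ring.
rewrite /inscribed_polygon; suff -> : Num.floor (n%:R * s) = i by [].
by apply: floor_def; rewrite -ler_pdivrMl// mulrC si/= mulrC -ltr_pdivlMr.
Qed.

Lemma inscribed_polygon_grid i :
  inscribed_polygon (i%:~R / n%:R) = f 0 + (n%:R * h)^-1 *: (inscribed_vertex i - f 0).
Proof.
rewrite (@inscribed_polygonE i) ?subrr ?scale0r ?addr0// lexx/=.
by rewrite ler_pM2r ?invr_gt0// ler_int lerDl.
Qed.

Lemma inscribed_polygon_affine : grid_affine n inscribed_polygon inscribed_slope.
Proof. by move=> i s si; rewrite (inscribed_polygonE si) inscribed_polygon_grid. Qed.

Lemma inscribed_polygon_closed : closed_curve inscribed_polygon.
Proof.
move=> s; have /andP[s1 s2] := grid_floor s n0; set i := Num.floor _ in s1 s2.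
have e : (i + n%:Z)%:~R / n%:R = i%:~R / n%:R + 1 :> R.
  by rewrite rmorphD/= -pmulrn mulrDl divff ?gt_eqF.
have e1 : (i + n%:Z + 1)%:~R / n%:R = (i + 1)%:~R / n%:R + 1 :> R.
  by rewrite addrAC rmorphD/= -pmulrn mulrDl divff ?gt_eqF.
rewrite (@inscribed_polygonE (i + n%:Z)) ?e ?e1 ?lerD2r ?s1 ?ltW//.
rewrite (@inscribed_polygonE i) ?s1 ?ltW// /inscribed_slope.
have vn k : inscribed_vertex (k + n%:Z) = inscribed_vertex k.
  by have := inscribed_vertexDn k 1; rewrite mul1r.
have -> : i + n%:Z + 1 = (i + 1) + n%:Z by rewrite addrAC.
rewrite !vn.
by congr (_ + _ *: _); ring.
Qed.

Lemma inscribed_polygon_equilateral :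
  equilateral_vertices n inscribed_polygon (fun i : nat => i%:R / n%:R).
Proof.
apply: grid_affine_equilateral inscribed_polygon_affine inscribed_slope_unit => //.
exact: inscribed_polygon_closed.
Qed.

Lemma inscribed_polygon0 : inscribed_polygon 0 = f 0.
Proof.
have := inscribed_polygon_grid 0; rewrite mul0r => ->.
by rewrite (inscribed_vertex_nat (leq0n _)) x0 subrr scaler0 addr0.
Qed.

Lemma inscribed_polygon_vertex (k : nat) : (k <= n)%N ->
  inscribed_polygon (k%:R / n%:R) = f 0 + (n%:R * h)^-1 *: (f (x k) - f 0).
Proof.
by move=> kn; have := inscribed_polygon_grid k; rewrite -pmulrn inscribed_vertex_nat.
Qed.

(** On each grid cell the polygon has a constant slope u, to be compared with the increments of f
    through v = f'(x_k). The scale r covers the mismatch between the parameters k/n and x_k, where f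
    is compared with v; the finer scale r2 covers one chord, where u is. *)
Lemma inscribed_polygon_close (e e2 r r2 : R) :
  0 <= e -> 0 < e2 <= 1 / 4 ->
  (forall y, eucl (derive1 f y) = 1) ->
  (forall y s t, `|s - y| <= r -> `|t - y| <= r ->
    eucl (f t - f s - (t - s) *: derive1 f y) <= e * `|t - s|) ->
  (forall y s t, `|s - y| <= r2 -> `|t - y| <= r2 ->
    eucl (f t - f s - (t - s) *: derive1 f y) <= e2 * `|t - s|) ->
  (forall k, h <= x k.+1 - x k /\ (1 - 2 * e2) * (x k.+1 - x k) <= h) ->
  2 * h <= r2 ->
  (forall k, (k <= n)%N -> `|x k - k%:R / n%:R| + n%:R^-1 <= r) ->
  eucl_lipschitz (e + 6 * e2) (inscribed_polygon - f).
Proof.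
move=> e0 /andP[e20 e21] v1 H1 H2 xs hr2 xr.
apply: (grid_lipschitz n0) => i s t si st ti.
set k := `|(i %% n%:Z)%Z|%N; set M := (i %/ n%:Z)%Z.
have i0 : (0 <= i %% n%:Z)%Z by rewrite modz_ge0// eqz_nat -lt0n.
have kN : (k < n)%N by rewrite -ltz_nat gez0_abs// ltz_pmod.
have iE : i = M * n%:Z + k%:Z by rewrite /k gez0_abs// -divz_eq.
have iR : i%:~R / n%:R = M%:~R + k%:R / n%:R :> R.
  by rewrite iE rmorphD rmorphM/= -!pmulrn mulrDl mulfK ?gt_eqF.
have i1R : (i + 1)%:~R / n%:R = M%:~R + k%:R / n%:R + n%:R^-1 :> R.
  by rewrite rmorphD/= mulrDl iR mul1r.
have := xr k (ltnW kN); have [xk1 xk2] := xs k.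
set y := x k; set v := derive1 f y => yr.
set u := inscribed_slope i.
have uE : u = h^-1 *: (f (x k.+1) - f y) by rewrite /u /inscribed_slope inscribed_vertexS.
have D2 : x k.+1 - y <= 2 * h.
  have : 1 / 2 * (x k.+1 - y) <= (1 - 2 * e2) * (x k.+1 - y).
    by rewrite ler_wpM2r//; [exact: le_trans (ltW h0) xk1|lra].
  rewrite /y; lra.
have D0 : 0 <= x k.+1 - y by exact: le_trans (ltW h0) xk1.
(* A chord step has parameter length at most 2h. Multiplied by h, the error is 2 e2 h from
   differentiability plus at most 4 e2 h from the excess of that length over h. *)
have uv : eucl (u - v) <= 6 * e2.
  rewrite -(ler_pM2l h0) -{1}(ger0_norm (ltW h0)) -euclZ.
  rewrite (_ : h *: (u - v) = (f (x k.+1) - f y - (x k.+1 - y) *: v) + (x k.+1 - y - h) *: v); last first.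
    rewrite scalerBr uE scalerA divff ?gt_eqF// scale1r.
    by apply/rowP => j; rewrite !mxE; ring.
  apply: le_trans (eucl_triangle _ _) _; rewrite euclZ v1 mulr1.
  have := H2 y y (x k.+1); rewrite subrr normr0 (ger0_norm D0).
  have h3 : x k.+1 - y <= r2 by exact: le_trans hr2.
  have h4 : 0 <= r2 by exact: le_trans h3.
  move=> /(_ h4 h3) h5; rewrite ger0_norm; last by rewrite subr_ge0.
  have : e2 * (x k.+1 - y) <= e2 * (2 * h) by rewrite ler_wpM2l// ltW.
  by move: xk2; rewrite -/y; lra.
have pts : inscribed_polygon t - inscribed_polygon s = (t - s) *: u.
  rewrite (@inscribed_polygonE i t) ?ti ?(le_trans si)//.
  rewrite (@inscribed_polygonE i s) ?si ?(le_trans st)//.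
  by rewrite -/u; apply/rowP => j; rewrite !mxE; ring.
have fM z : f z = f (z - M%:~R) by rewrite -rmorphN/= closed_curveDz.
(* After subtracting M, z lies within 1/n of k/n, hence within r of x_k. *)
have win z : s <= z -> z <= t -> `|z - M%:~R - y| <= r.
  move=> sz zt; move: yr si ti; rewrite iR i1R => yr si ti.
  move: yr si ti; rewrite (distrC y); move: (M%:~R : R) (n%:R^-1 : R) (k%:R / n%:R : R) => m w q yr si ti.
  have : `|z - m - q| <= w by rewrite ger0_norm; lra.
  have := ler_distD q (z - m) y; lra.
rewrite -[(inscribed_polygon - f) t]/(inscribed_polygon t - f t).
rewrite -[(inscribed_polygon - f) s]/(inscribed_polygon s - f s).
rewrite (_ : _ - _ = (t - s) *: (u - v) - (f t - f s - (t - s) *: v)); last first.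
  have -> : inscribed_polygon t = inscribed_polygon s + (t - s) *: u by rewrite -pts subrKC.
  by apply/rowP => j; rewrite !mxE; ring.
apply: le_trans (eucl_triangle _ _) _; rewrite euclN euclZ ger0_norm ?subr_ge0//.
have := H1 y (s - M%:~R) (t - M%:~R) (win _ (lexx _) st) (win _ st (lexx _)).
rewrite -!fM -/v (_ : t - M%:~R - (s - M%:~R) = t - s); last by ring.
rewrite ger0_norm ?subr_ge0//.
have : (t - s) * eucl (u - v) <= (t - s) * (6 * e2) by rewrite ler_wpM2l ?subr_ge0.
lra.
Qed.

(** The chords of the polygon are those of f divided by n h, so the weight 1/n^2 turns the inverse
    square of a chord into h^2 / a^2 exactly. The subtracted term becomes h^2 / (n h b)^2 with b the
    grid distance, and n h b is at most the distance of the vertices along f. *)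
Lemma inscribed_energy_le : embedded f -> arclength_curves f ->
  (forall k, h <= x k.+1 - x k) -> n%:R * h <= 1 -> embedded inscribed_polygon ->
  (discrete_energy_sum n inscribed_polygon (fun i : nat => (i%:R / n%:R)%R) <=
   (\sum_(i < n) \sum_(j < n) h ^+ 2 * mobius_kernel f (x i) (x j))%:E)%E.
Proof.
move=> ef fA xs nh ep.
rewrite (discrete_energy_sumE ep inscribed_polygon_equilateral).
rewrite lee_fin; apply: ler_sum => i _; apply: ler_sum => j _.
rewrite (mobius_kernelC f) mulrC.
have [->|ij] := eqVneq j i.
  rewrite -{1}[i%:R / n%:R]addr0 (mobius_kernel_diag _ 0)//; last by case: ep.
  rewrite mulr0 mulr_ge0 ?sqr_ge0 ?mobius_kernel_ge0//.
have nh0 : 0 < n%:R * h by rewrite mulr_gt0.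
have cd := vertices_circ_dist xs h0 x0 xn (ltn_ord j) (ltn_ord i).
have cd0 : 0 < circ_dist (j%:R / n%:R) (i%:R / n%:R) :> R.
  by apply: lt_le_trans (@grid_circ_dist_ge R n j i ij); rewrite invr_gt0.
rewrite /mobius_kernel !inscribed_polygon_vertex ?(ltnW (ltn_ord _))//.
rewrite (_ : _ - _ = (n%:R * h)^-1 *: (f (x j) - f (x i))); last first.
  by apply/rowP => k; rewrite !mxE; ring.
rewrite euclZ ger0_norm ?invr_ge0 ?(ltW nh0)//.
set a := eucl _; set b := circ_dist _ _ in cd0 cd *; set c := circ_dist _ _ in cd *.
have c0 : 0 < c by apply: lt_le_trans cd; rewrite mulr_gt0.
have -> : n%:R^-1 ^+ 2 * ((((n%:R * h)^-1 * a) ^+ 2)^-1 - (b ^+ 2)^-1) =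
  h ^+ 2 * ((a ^+ 2)^-1 - ((n%:R * h * b) ^+ 2)^-1).
  have [->|a0] := eqVneq a 0.
    rewrite !mulr0 expr0n/= invr0 !sub0r; field.
    by rewrite ?gt_eqF.
  by field; rewrite a0 !gt_eqF.
rewrite ler_wpM2l ?sqr_ge0// lerD2l lerN2.
by rewrite lef_pV2 ?posrE ?exprn_gt0 ?mulr_gt0// lerXn2r ?nnegrE// ?mulr_ge0 ?ltW// mulr_gt0.
Qed.

End Inscribed.

(** * Corners have infinite energy *)

Section Corner.
Context {R : realType} {d : nat}.
Implicit Types (f : R -> 'rV[R]_d) (u v : 'rV[R]_d).
Local Notation mu := (@lebesgue_measure R).
Local Notation K := mobius_kernel.
Local Notation KI := kernel_integral.

Lemma affine_on_slope f (x y : R) : x < y -> affine_on f x y ->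
  forall s, x <= s <= y ->
    f s = f x + (s - x) *: ((y - x)^-1 *: (f y - f x)).
Proof.
move=> xy fxy s /andP[xs sy]; have yx : 0 < y - x by rewrite subr_gt0.
pose c := (s - x) / (y - x).
have c01 : 0 <= c <= 1 by rewrite divr_ge0 ?subr_ge0 ?(ltW xy)//= ler_pdivrMr// mul1r; lra.
have cyx : c * (y - x) = s - x by rewrite /c divfK// gt_eqF.
have := fxy c c01; rewrite (_ : (1 - c) * x + c * y = s); last first.
  have -> : (1 - c) * x + c * y = x + c * (y - x) by ring.
  by rewrite cyx; ring.
by move=> ->; rewrite scalerA -/c; apply/rowP => k; rewrite !mxE; ring.
Qed.

Lemma arclength_affine_unit f u (x y : R) : arclength_curves f -> x < y ->
  (forall s, x <= s <= y -> f s = f x + (s - x) *: u) -> eucl u = 1.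
Proof.
move=> [_ _ [N [mN N0 hN]]] xy fs; apply: contrapT => u1.
have xyN : `]x, y[%classic `<=` N.
  move=> t /=; rewrite in_itv/= => /andP[xt ty]; apply: hN => /= -[_].
  have [|_ ->//] := @derivable_near_affine _ _ f u t.
  near=> s; rewrite (fs s); last first.
    by apply/andP; split; apply/ltW; near: s; [exact: lt_nbhsr|exact: lt_nbhsl].
  by rewrite (fs t) ?(ltW xt) ?(ltW ty)//; apply/rowP => k; rewrite !mxE; ring.
have : (mu `]x, y[%classic <= mu N)%E by apply: le_measure; rewrite ?inE.
by rewrite N0 lebesgue_measure_itv/= lte_fin xy -EFinB lee_fin; lra.
Unshelve. all: by end_near. Qed.

(** If all slopes agreed, closing up after n segments would force the common slope to be 0, against
    unit speed. *)
Lemma equilateral_corner n f a : equilateral_vertices n f a ->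
  exists i u v, [/\ (i.+1 < n)%N, u != v &
   (forall s, a i <= s <= a i.+1 -> f s = f (a i) + (s - a i) *: u) /\
   (forall s, a i.+1 <= s <= a i.+2 -> f s = f (a i.+1) + (s - a i.+1) *: v)].
Proof.
move=> eqv; have aE := equilateral_verticesE eqv.
have n0 := equilateral_vertices_gt0 eqv.
have nR : 0 < n%:R :> R by rewrite ltr0n.
case: eqv => fA [ainc an] _ aff; have cf : closed_curve f by case: fA.
pose u i := (a i.+1 - a i)^-1 *: (f (a i.+1) - f (a i)).
have fs i : (i < n)%N -> forall s, a i <= s <= a i.+1 -> f s = f (a i) + (s - a i) *: u i.
  by move=> iN; apply: affine_on_slope; [exact: ainc|exact: aff].
apply: contrapT => nex.
have uS i : (i.+1 < n)%N -> u i.+1 = u i.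
  move=> iN; apply: contrapT => /eqP; rewrite eq_sym => neq; apply: nex.
  by exists i, (u i), (u i.+1); split => //; split; apply: fs => //; exact: ltnW.
have u0 i : (i < n)%N -> u i = u 0%N.
  by elim: i => // i ih iN; rewrite uS// ih// ltnW.
have fa i : (i <= n)%N -> f (a i) = f (a 0%N) + (i%:R / n%:R) *: u 0%N.
  elim: i => [_|i ih iN]; first by rewrite mul0r scale0r addr0.
  rewrite (fs i iN (a i.+1)) ?lexx ?ltW ?ainc// (ih (ltnW iN)) u0//.
  rewrite (aE i.+1 iN) (aE i (ltnW iN)) -natr1; apply/rowP => k; rewrite !mxE; ring.
have := fa n (leqnn _); rewrite an cf divff ?gt_eqF// scale1r => /eqP.
rewrite -subr_eq0 opprD addrA subrr sub0r oppr_eq0 => /eqP u00.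
have := arclength_affine_unit fA (ainc 0%N n0) (fs 0%N n0).
by rewrite u00 eucl0 => /esym/eqP; rewrite oner_eq0.
Qed.

(** By the law of cosines the squared chord is (t + s)^2 - 2 t s (1 - u.v). With s and t between r/2
    and r the kernel is at least 2 (r/2)^2 (1 - u.v) / (2r)^4, whence 32. The bound l <= 1/4 makes t
    + s the circle distance. *)
Lemma mobius_kernel_corner f u v (A l s t r : R) : embedded f ->
  eucl u = 1 -> eucl v = 1 -> l <= 4^-1 ->
  (forall z, A - l <= z <= A -> f z = f A + (z - A) *: u) ->
  (forall z, A <= z <= A + l -> f z = f A + (z - A) *: v) ->
  0 < r -> r <= l -> r / 2 <= s <= r -> r / 2 <= t <= r ->
  (1 - dotp u v) / 32 / r ^+ 2 <= K f (A - s) (A + t).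
Proof.
move=> ef u1 v1 l4 fu fv r0 rl /andP[s1 s2] /andP[t1 t2].
have s0 : 0 < s by lra. have t0 : 0 < t by lra.
have uv1 : dotp u v <= 1 by have := dotp_le_eucl u v; rewrite u1 v1 mulr1.
rewrite mobius_kernelC.
have ts : `|A + t - (A - s)| = t + s by rewrite ger0_norm; lra.
have cts : circ_dist (A + t) (A - s) = t + s by rewrite circ_dist_small ts//; lra.
have q0 : 0 < eucl (f (A + t) - f (A - s)).
  by apply: embedded_eucl_gt0 => //; rewrite cts gt_eqF//; lra.
rewrite /K cts.
have q2 : eucl (f (A + t) - f (A - s)) ^+ 2 = (t + s) ^+ 2 - 2 * t * s * (1 - dotp u v).
  rewrite (fu (A - s)); last by apply/andP; split; lra.
  rewrite (fv (A + t)); last by apply/andP; split; lra.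
  rewrite (_ : _ - _ = t *: v + s *: u); last by apply/rowP => k; rewrite !mxE; ring.
  rewrite sqr_eucl !(dotpDl, dotpDr, dotpZl, dotpZr) -!sqr_eucl u1 v1 (dotpC v u); ring.
have q20 : 0 < eucl (f (A + t) - f (A - s)) ^+ 2 by rewrite exprn_gt0.
move: q2 q20; move: (_ ^+ 2) => q q2 q20.
set c := 1 - dotp u v in q2 *; have c0 : 0 <= c by rewrite subr_ge0.
have Q0 : 0 < (t + s) ^+ 2 by rewrite exprn_gt0// addr_gt0.
have qQ : q <= (t + s) ^+ 2 by rewrite q2 gerBl !mulr_ge0// ltW.
have -> : q^-1 - ((t + s) ^+ 2)^-1 = (2 * t * s * c) * (q * (t + s) ^+ 2)^-1.
  have -> : 2 * t * s * c = (t + s) ^+ 2 - q by rewrite q2; ring.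
  have ts0 : t + s != 0 by rewrite gt_eqF// addr_gt0.
  have qN0 : q != 0 by rewrite gt_eqF.
  by field; rewrite ?ts0 ?qN0.
have h1 : ((t + s) ^+ 2 * (t + s) ^+ 2)^-1 <= (q * (t + s) ^+ 2)^-1.
  rewrite lef_pV2 ?posrE; [|exact: mulr_gt0..].
  by apply: ler_wpM2r => //; exact: ltW.
have h2 : ((2 * r) ^+ 2 * (2 * r) ^+ 2)^-1 <= ((t + s) ^+ 2 * (t + s) ^+ 2)^-1.
  have r20 : 0 < (2 * r) ^+ 2 by rewrite exprn_gt0// mulr_gt0.
  have tr : (t + s) ^+ 2 <= (2 * r) ^+ 2.
    have A1 : 0 <= t + s by lra. have A2 : 0 <= 2 * r by lra. have A3 : t + s <= 2 * r by lra.
    by rewrite lerXn2r ?nnegrE.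
  rewrite lef_pV2 ?posrE; [|exact: mulr_gt0..].
  by apply: ler_pM => //; exact: ltW.
have h3 : (r / 2) * (r / 2) <= t * s by rewrite ler_pM// divr_ge0// ltW.
have -> : c / 32 / r ^+ 2 = (2 * ((r / 2) * (r / 2)) * c) * ((2 * r) ^+ 2 * (2 * r) ^+ 2)^-1.
  by field; rewrite gt_eqF.
apply: ler_pM.
- have h4 : 0 <= r / 2 by lra.
  by apply: mulr_ge0 => //; apply: mulr_ge0 => //; exact: mulr_ge0.
- by rewrite invr_ge0 mulr_ge0 ?sqr_ge0.
- by rewrite ler_wpM2r// -[2 * t * s]mulrA ler_wpM2l.
- exact: le_trans h1.
Qed.

(** Were the energy finite, its part near the diagonal could be made smaller than any prescribed
    positive number; a single square at a small enough scale already contradicts this. *)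
Lemma equilateral_polygon_energy n f a : embedded f -> equilateral_vertices n f a ->
  mobius_energy f = +oo%E.
Proof.
move=> ef eqv; have aE := equilateral_verticesE eqv.
have n0 := equilateral_vertices_gt0 eqv.
have nR : 0 < n%:R :> R by rewrite ltr0n.
have fA : arclength_curves f by case: eqv.
have cf : closed_curve f by case: ef.
have [i [u [v [iN uv [fu fv]]]]] := equilateral_corner eqv.
have ai : a i.+1 - a i = n%:R^-1.
  by rewrite (aE i.+1 (ltnW iN)) (aE i (ltnW (ltnW iN))) -natr1; ring.
have ai1 : a i.+2 - a i.+1 = n%:R^-1.
  by rewrite (aE i.+2 iN) (aE i.+1 (ltnW iN)) -[i.+2%:R]natr1; ring.
have nV : 0 < n%:R^-1 :> R by rewrite invr_gt0.
have u1 : eucl u = 1 by apply: (arclength_affine_unit fA _ fu); lra.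
have v1 : eucl v = 1 by apply: (arclength_affine_unit fA _ fv); lra.
set A := a i.+1 in fu fv ai ai1.
have [l [l0 ln l4]] : exists l : R, [/\ 0 < l, l <= n%:R^-1 & l <= 4^-1].
  exists (Num.min n%:R^-1 4^-1); split; last by rewrite ge_min lexx orbT.
    by rewrite lt_min nV invr_gt0 ltr0n.
  by rewrite ge_min lexx.
have fu' z : A - l <= z <= A -> f z = f A + (z - A) *: u.
  move=> /andP[z1 z2]; rewrite (fu z); last by apply/andP; split; lra.
  rewrite (fu A); last by apply/andP; split; lra.
  by apply/rowP => k; rewrite !mxE; ring.
have fv' z : A <= z <= A + l -> f z = f A + (z - A) *: v.
  by move=> /andP[z1 z2]; apply: fv; apply/andP; split; lra.
pose c := 1 - dotp u v.
have c0 : 0 < c.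
  have : 0 < eucl (u - v) ^+ 2.
    rewrite exprn_gt0// lt_neqAle eucl_ge0 andbT eq_sym; apply: contra uv => /eqP/eucl_eq0 h.
    by rewrite -subr_eq0 h.
  rewrite sqr_eucl !(dotpDl, dotpDr, dotpNl, dotpNr) -!sqr_eucl u1 v1 (dotpC v u) /c; lra.
apply: contrapT => /eqP Ey.
have Efin : (mobius_energy f < +oo)%E by rewrite ltey.
(* The square has area (r/2)^2 and the kernel is at least c / 32 / r^2 on it, which gives c / 128 at
   every scale r. *)
pose c' := c / 128; have c'0 : 0 < c' / 2 by rewrite !divr_gt0.
have [D D0 hD] := mobius_energy_near ef fA Efin c'0.
(* Two lifts of the corner, one in [[0, 1[] for the side after it and one in []0, 1]] for the side
   before it, keep both intervals in the fundamental domain even when the corner sits at the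
   seam. *)
have [m2 A2] := frac_01 A; move: A2; rewrite in_itv/= => /andP[A20 A21].
have [m1 [A10 A11]] : exists m, 0 < A + m%:~R /\ A + m%:~R <= 1.
  have [m +] := frac_01 (- A); rewrite in_itv/= => /andP[b0 b1].
  by exists (1 - m); rewrite rmorphB/=; split; lra.
have [r [r0 rl rD rA1 rA2]] : exists r : R, [/\ 0 < r, r <= l, r <= D / 4,
    r <= (A + m1%:~R) / 2 & r <= (1 - (A + m2%:~R)) / 2].
  exists (Num.min (Num.min l (D / 4)) (Num.min ((A + m1%:~R) / 2) ((1 - (A + m2%:~R)) / 2))).
  rewrite !ge_min !lexx !orbT; split => //.
  rewrite lt_min; apply/andP; split; rewrite lt_min; apply/andP; split => //.
  - exact: divr_gt0.
  - exact: divr_gt0.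
  - by apply: divr_gt0; rewrite ?subr_gt0.
(* Cells 0 and 2 of this sequence are the parameter intervals before and after the corner. *)
pose y (k : nat) : R := if k == 0%N then A + m1%:~R - r else
  if k == 1%N then A + m1%:~R - r / 2 else
  if k == 2%N then A + m2%:~R + r / 2 else A + m2%:~R + r.
pose B := cell y 0 `*` cell y 2.
have zB z : B z -> [/\ unit_square z, circ_dist z.1 z.2 < D & c / 32 / r ^+ 2 <= K f z.1 z.2].
  case: z => t s [/=]; rewrite /cell /y/= !in_itv/= => /andP[t1 t2] /andP[s1 s2].
  pose s' := A - (t - m1%:~R); pose t' := (s - m2%:~R) - A.
  have tE : t = (A - s') + m1%:~R by rewrite /s'; ring.
  have sE : s = (A + t') + m2%:~R by rewrite /t'; ring.
  split.
  - move: t1 t2 s1 s2 r0 rA1 rA2 A20 A11; clear => t1 t2 s1 s2 r0 rA1 rA2 A20 A11.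
    by rewrite /unit_square; split; rewrite /= in_itv/=; apply/andP; split; lra.
  - rewrite tE sE circ_distDz circ_distC circ_distDz.
    apply: le_lt_trans (circ_dist_le_norm _ _) _.
    rewrite /t' /s'; move: t1 t2 s1 s2 r0 rD; clear => t1 t2 s1 s2 r0 rD.
    by rewrite ger0_norm; lra.
  rewrite tE sE mobius_kernelDz//.
  apply: (mobius_kernel_corner (l := l) ef u1 v1 l4 fu' fv' r0 rl).
    by rewrite /s'; move: t1 t2; clear => ? ?; apply/andP; split; lra.
  by rewrite /t'; move: s1 s2; clear => ? ?; apply/andP; split; lra.
have K0 : 0 <= c / 32 / r ^+ 2 by rewrite !divr_ge0 ?sqr_ge0// ltW.
have := kernel_integral_ge_cst ef (measurable_cell2 y 0 2) K0 (fun z Bz => let: And3 _ _ h := zB z Bz in h).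
rewrite measure_cell2; [|by rewrite /y/=; move: r0; clear; lra..].
rewrite -EFinM (_ : c / 32 / r ^+ 2 * _ = c'); last first.
  by rewrite /c' /y/=; field; rewrite gt_eqF.
move=> low.
have : (KI f B <= KI f (unit_square `\` far D))%E.
  apply: subset_kernel_integral => //.
  - exact: measurable_cell2.
  - by apply: measurableD; [exact: measurable_unit_square|exact: measurable_far].
  - by move=> z /zB[Qz zD _]; split => //; rewrite /far/= => /le_lt_trans/(_ zD); rewrite ltxx.
move=> /(le_trans low)/le_trans/(_ hD); rewrite lee_fin; move: c'0; clear; lra.
Qed.

End Corner.

(** * Recovery sequences *)

Section Recovery.
Context {R : realType} {d : nat}.
Implicit Types (f p : R -> 'rV[R]_d).

Lemma C1_local_bilipschitz f : arclength_curves f -> C1_curves f ->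
  exists2 r, 0 < r & forall t s, `|t - s| <= r -> 2^-1 * `|t - s| <= eucl (f t - f s).
Proof.
move=> fA fC; have v1 := C1_derivative_unit fA fC.
have e0 : 0 < 2^-1 :> R by rewrite invr_gt0.
have [r r0 hr] := C1_unif_derivable fA fC e0.
exists r => // t s ts; have := hr s s t; rewrite subrr normr0 (ltW r0) => /(_ isT ts) h.
have := eucl_triangle ((t - s) *: derive1 f s - (f t - f s)) (f t - f s).
rewrite subrK euclZ v1 mulr1 (euclB (_ *: _)); lra.
Qed.

(** Near pairs use the local bound with constant 1/2; for far pairs the compactness gap m suffices,
    because circle distances are at most 1/2. *)
Lemma C1_bilipschitz f : embedded f -> arclength_curves f -> C1_curves f ->
  exists2 b, 0 < b & forall t s, b * circ_dist t s <= eucl (f t - f s).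
Proof.
move=> ef fA fC; have cf : closed_curve f by case: ef.
have [r r0 hr] := C1_local_bilipschitz fA fC.
have [m m0 hm] := embedded_far_gap ef fA r0.
exists (Num.min 2^-1 m); first by rewrite lt_min invr_gt0 ltr0n.
move=> t s; have [far_ts|near_ts] := leP r (circ_dist t s).
  apply: le_trans (hm _ _ far_ts); apply: (@le_trans _ _ (m * circ_dist t s)).
    by rewrite ler_wpM2r ?circ_dist_ge0// ge_min lexx orbT.
  rewrite ler_piMr ?(ltW m0)//; apply: le_trans (circ_dist_le_half _ _) _.
  by rewrite invf_le1// ler1n.
apply: (@le_trans _ _ (2^-1 * circ_dist t s)).
  by rewrite ler_wpM2r ?circ_dist_ge0// ge_min lexx.
have [k hk] := circ_distP t s.
have -> : f s = f (s + k%:~R) by rewrite closed_curveDz.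
have E : t - s - k%:~R = t - (s + k%:~R) by ring.
rewrite hk E; apply: hr; rewrite -E -hk; exact: ltW.
Qed.

(** The n steps add up to 1, so n h >= 1 - 2e. Counting k steps from the left end and n - k steps
    from the right end bounds x_k on both sides. *)
Lemma partition_near_grid (x : nat -> R) (h e : R) n k :
  x 0%N = 0 -> x n = 1 -> 0 < h -> (forall k, h <= x k.+1 - x k) ->
  (forall k, (1 - 2 * e) * (x k.+1 - x k) <= h) -> 0 <= e -> (k <= n)%N ->
  `|x k - k%:R / n%:R| <= 2 * e.
Proof.
move=> x0 xn h0 xs xs2 e0 kn.
have n0 : (0 < n)%N by rewrite lt0n; apply/eqP => n0; move: xn; rewrite n0 x0 => /esym/eqP; rewrite oner_eq0.
have nR : 0 < n%:R :> R by rewrite ltr0n.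
have nh : 1 - 2 * e <= n%:R * h.
  have : (1 - 2 * e) * (x n - x 0%N) <= n%:R * h.
    elim: (n) => [|m ih]; first by rewrite subrr mulr0 mul0r.
    by rewrite -natr1 mulrDl mul1r; have := xs2 m; lra.
  by rewrite xn x0 subr0 mulr1.
have len := cell_length_ge xs.
have l1 := len 0%N k; rewrite add0n x0 subr0 in l1.
have l2 := len k (n - k)%N; rewrite subnKC// xn in l2.
have m1 : (1 - 2 * e) * (k%:R / n%:R) <= h * k%:R.
  rewrite mulrA ler_pdivrMr// mulrAC; apply: ler_wpM2r => //.
  by rewrite [h * _]mulrC.
have m2 : (1 - 2 * e) * (1 - k%:R / n%:R) <= h * (n - k)%:R.
  have -> : 1 - k%:R / n%:R = (n - k)%:R / n%:R :> R.
    by rewrite natrB// mulrBl divff// gt_eqF.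
  rewrite mulrA ler_pdivrMr// mulrAC; apply: ler_wpM2r => //.
  by rewrite [h * _]mulrC.
have k01 : 0 <= (k%:R / n%:R : R) <= 1.
  by rewrite divr_ge0//= ler_pdivrMr// mul1r ler_nat.
move: k01 m1 m2; move: (k%:R / n%:R) => q /andP[q0 q1] m1 m2.
have a1 : 0 <= e * q by rewrite mulr_ge0.
have a2 : e * q <= e by rewrite ler_piMr.
by rewrite ler_norml; apply/andP; split; lra.
Qed.

Lemma recovery f (K : set (R -> 'rV[R]_d)) (eps : R) : knot_class K -> K f ->
  arclength_curves f -> C1_curves f -> (mobius_energy f < +oo)%E -> 0 < eps ->
  exists N, forall n, (N <= n)%N -> exists p,
   [/\ K p, equilateral_polygons n p, eucl_lipschitz eps (p - f),
      (forall t, eucl ((p - f) t) <= eps) &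
      (discrete_mobius_energy n p <= mobius_energy f + eps%:E)%E].
Proof.
move=> Kk Kf fA fC Efin eps0.
have ef := knot_class_embedded Kk Kf; have cf : closed_curve f by case: ef.
have v1 := C1_derivative_unit fA fC.
have [r0 r00 hr0] := C1_local_bilipschitz fA fC.
have [b b0 hb] := C1_bilipschitz ef fA fC.
(* The polygon differs from f by Lipschitz constant eta + 6 e2 <= 7 eta; this must be below eps and
   small enough to stay in the knot class. *)
pose eta : R := Num.min (eps / 7) (b / 2 / d.+1%:R / 7).
have eta0 : 0 < eta by rewrite lt_min !divr_gt0.
have eta_eps : 7 * eta <= eps by rewrite mulrC -ler_pdivlMr// ge_min lexx.
have eta_b : d.+1%:R * (7 * eta) <= b / 2.
  rewrite mulrC -ler_pdivlMr// mulrC -ler_pdivlMr//.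
  by rewrite ge_min lexx orbT.
have [r r_gt0 hr] := C1_unif_derivable fA fC eta0.
(* The bound r/8 limits the drift of x_k from k/n to r/4, and 1/4 is what the chord steps need. *)
pose e2 : R := Num.min (Num.min eta 4^-1) (r / 8).
have e20 : 0 < e2.
  rewrite lt_min; apply/andP; split; last exact: divr_gt0.
  by rewrite lt_min eta0 invr_gt0 ltr0n.
have e2_eta : e2 <= eta by rewrite 2!ge_min lexx.
have e2_4 : e2 <= 1 / 4 by rewrite 2!ge_min div1r lexx !orbT.
have e2_r : e2 <= r / 8 by rewrite ge_min lexx orbT.
have e2_01 : 0 < e2 <= 1 / 4 by rewrite e20.
have [r2 r20 hr2] := C1_unif_derivable fA fC e20.
have [h00 h000 riemann] := riemann_sum_le ef fA Efin eps0 r00 hr0.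
(* Bounds on 1/n: r2/2 for the partition and for 2h <= r2, r/2 for the window around x_k, h00 for
   the Riemann sum, 1/2 for n > 1. The bound n h <= 1 passes them on to h. *)
pose z : R := Num.min (Num.min (r2 / 2) (r / 2)) (Num.min h00 2^-1).
have z0 : 0 < z.
  rewrite lt_min; apply/andP; split; rewrite lt_min; apply/andP; split => //.
  - exact: divr_gt0.
  - exact: divr_gt0.
have z1 : z <= r2 / 2 by rewrite !ge_min lexx.
have z2 : z <= r / 2 by rewrite !ge_min lexx ?orbT.
have z3 : z <= h00 by rewrite !ge_min lexx ?orbT.
have z4 : z <= 2^-1 by rewrite !ge_min lexx ?orbT.
have [N [N0 hN]] := near_inv_nat z0.
exists N => n Nn; have nz := hN n Nn.
have n0 : (0 < n)%N by exact: leq_trans N0 Nn.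
have nR : 0 < n%:R :> R by rewrite ltr0n.
have n1 : (1 < n)%N.
  by have := le_trans nz z4; rewrite lef_pV2 ?posrE// ler_nat.
have nr2 : 2 / r2 <= n%:R.
  have : n%:R^-1 <= r2 / 2 by exact: le_trans z1.
  by rewrite invf_ple ?posrE ?divr_gt0// invf_div.
have [h [x [h0 x0 xn xP]]] :=
  chord_partition (arclength_lipschitz fA) v1 e2_01 r20 hr2 nr2.
have xs k : h <= x k.+1 - x k by case: (xP k).
have xs2 k : (1 - 2 * e2) * (x k.+1 - x k) <= h by case: (xP k).
have xh k : eucl (f (x k.+1) - f (x k)) = h by case: (xP k).
have xs3 k : h <= x k.+1 - x k <= 2 * h.
  rewrite xs/=; have : 1 / 2 * (x k.+1 - x k) <= (1 - 2 * e2) * (x k.+1 - x k).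
    rewrite ler_wpM2r//; first exact: le_trans (ltW h0) (xs k).
    by move: e2_4; clear; lra.
  by move: (xs2 k); clear; lra.
have len := cell_length_ge xs.
have nh : n%:R * h <= 1.
  by have := len 0%N n; rewrite add0n xn x0 subr0 mulrC.
have hn : h <= n%:R^-1 by rewrite -[_^-1]mul1r ler_pdivlMr// mulrC.
have xclose k : (k <= n)%N -> `|x k - k%:R / n%:R| + n%:R^-1 <= r.
  move=> kn; have near_k := partition_near_grid x0 xn h0 xs xs2 (ltW e20) kn.
  have kn1 : n%:R^-1 <= r / 2 by exact: le_trans z2.
  move: near_k e2_r kn1 r_gt0; clear; lra.
pose p := inscribed_polygon f n h x.
have cp : closed_curve p := @inscribed_polygon_closed R d f n h x n1.
have pf : eucl_lipschitz (eta + 6 * e2) (p - f).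
  apply: (inscribed_polygon_close cf n1 h0 x0 xn (ltW eta0) e2_01 v1 hr hr2) => //.
  have nr2' : n%:R^-1 <= r2 / 2 := le_trans nz z1.
  by move: nr2' hn; clear; lra.
have pf7 : eucl_lipschitz (7 * eta) (p - f).
  move=> t s; apply: le_trans (pf t s) _; rewrite ler_wpM2r//.
  by move: e2_eta; clear; lra.
have Kp : K p.
  apply: (knot_class_perturb Kk Kf cp b0 _ hb pf7 eta_b).
  by rewrite mulr_ge0// ltW.
have eqv : equilateral_vertices n p (fun i : nat => i%:R / n%:R).
  by apply: inscribed_polygon_equilateral.
exists p; split => //.
- by exists (fun i : nat => i%:R / n%:R).
- by move=> t s; apply: le_trans (pf7 t s) _; rewrite ler_wpM2r.
- move=> t; have cpf : closed_curve (p - f) by exact: closed_curveB.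
  (* The polygon meets f at parameter 0, so the Lipschitz bound for the difference also bounds its
     size. *)
  have := eucl_lipschitz_circ t 0 cpf pf7.
  have -> : (p - f) 0 = 0.
    by rewrite -[LHS]/(p 0 - f 0) /p inscribed_polygon0// subrr.
  rewrite subr0 => /le_trans; apply; apply: le_trans eta_eps.
  rewrite ler_piMr ?mulr_ge0 ?(ltW eta0)//.
  by apply: le_trans (circ_dist_le_half _ _) _; rewrite invf_le1// ler1n.
have ep := knot_class_embedded Kk Kp.
apply: (@le_trans _ _ (discrete_energy_sum n p (fun i : nat => (i%:R / n%:R)%R))).
  by apply: ereal_inf_lbound; exists (fun i : nat => i%:R / n%:R).
apply: le_trans (inscribed_energy_le cf n1 h0 x0 xn xh ef fA xs nh ep) _.
by apply: riemann => //; rewrite h0 (le_trans hn)// (le_trans nz).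
Qed.

End Recovery.

(** * Diagonal choice and conclusion *)

(** At index n the best accuracy 1/(k+1) attainable with k <= n is chosen; the cap k <= n guarantees
    that a best one exists. When none is attainable, [x0] fills the place. *)
Lemma diagonal_sequence (R : realType) (T : Type) (x0 : T) (P : nat -> R -> T -> Prop) :
  (forall n e e' x, e <= e' -> P n e x -> P n e' x) ->
  (forall e, 0 < e -> exists N, forall n, (N <= n)%N -> exists x, P n e x) ->
  exists u : nat -> T, (forall n, u n = x0 \/ exists e, 0 < e /\ P n e (u n)) /\
    forall e, 0 < e -> exists N, forall n, (N <= n)%N -> P n e (u n).
Proof.
move=> Pmon Pex.
pose good n k := (k <= n)%N /\ exists x, P n k.+1%:R^-1 x.
have /choice[u hu] : forall n, exists x, (x = x0 /\ forall k, ~ good n k) \/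
    exists k, P n k.+1%:R^-1 x /\ forall j, good n j -> (j <= k)%N.
  move=> n; have [[k gk]|none] := pselect (exists k, good n k); last first.
    by exists x0; left; split => // k gk; apply: none; exists k.
  have ex : exists k, `[< good n k >] by exists k; apply/asboolP.
  have bd k' : `[< good n k' >] -> (k' <= n)%N by move=> /asboolP[].
  case: (ex_maxnP ex bd) => m /asboolP[_ [x Px]] mmax.
  exists x; right; exists m; split => // j gj; apply: mmax; exact/asboolP.
exists u; split.
  move=> n; have [[-> _]|[k [Pk _]]] := hu n; first by left.
  by right; exists k.+1%:R^-1; split; rewrite ?invr_gt0.
move=> e e0; have [k [k0 hk]] := near_inv_nat e0.
have kV : 0 < k.+1%:R^-1 :> R by rewrite invr_gt0.
have [N hN] := Pex _ kV.
exists (maxn N k) => n; rewrite geq_max => /andP[Nn kn].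
have gk : good n k by split => //; exact: hN.
have [[_ /(_ k)]//|[m [Pm /(_ _ gk) km]]] := hu n.
apply: Pmon Pm; apply: hk; exact: leqW.
Qed.

Theorem theorem1 (R : realType) (d : nat) (q : \bar R) (hq : (1 <= q)%E)
    (nrm : (R -> 'rV[R]_d) -> \bar R)
    (hnrm : nrm = Lq_norm q \/ nrm = W1q_norm q)
    (K : set (R -> 'rV[R]_d)) (hK : knot_class K) (tameK : tame K) :
  Gamma_converges (C1p K) nrm (@discrete_mobius_energy R d) (@mobius_energy R d).
Proof.
split.
  move=> g_ g g_C [[gA _] gK] cv.
  have eg := knot_class_embedded hK gK.
  have hg_ n : embedded (g_ n) /\ arclength_curves (g_ n).
    by have [[? _] Kn] := g_C n; split => //; exact: knot_class_embedded hK Kn.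
  exact: (mobius_liminf hq hnrm hg_ eg gA cv).
move=> g [[gA gC] gK]; have eg := knot_class_embedded hK gK.
have nrm_0 : nrm (g - g) = 0%E.
  have c0 : 0 <= (0 : R) by [].
  have ggE t : (g - g) t = 0 by rewrite -[LHS]/(g t - g t) subrr.
  apply/eqP; rewrite eq_le; apply/andP; split; last first.
    by apply: le_trans (curve_norm_ge _ hnrm); exact: Lq_norm_ge0.
  have := @curve_norm_le _ _ nrm q (g - g) 0 hnrm hq c0; rewrite mulr0; apply.
    by move=> t; rewrite ggE eucl0.
  by move=> t s; rewrite !ggE subrr eucl0 mul0r.
(* With infinite energy the limsup inequality is void and the constant sequence serves, whatever its
   discrete energies are. *)
have [Einf|Efin] := eqVneq (mobius_energy g) +oo%E.
  exists (fun=> g); split; [by []| |by rewrite Einf leey].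
  by rewrite nrm_0; exact: cvg_cst.
have {}Efin : (mobius_energy g < +oo)%E by rewrite ltey.
(* Finite energy excludes the polygonal alternative in [C1p]. *)
have {}gC : C1_curves g.
  case: gC => // -[n _ [a eqv]]; move: Efin.
  by rewrite (equilateral_polygon_energy eg eqv) ltxx.
pose P n (e : R) (p : R -> 'rV[R]_d) :=
  [/\ K p, equilateral_polygons n p, eucl_lipschitz e (p - g),
      (forall t, eucl ((p - g) t) <= e) &
      (discrete_mobius_energy n p <= mobius_energy g + e%:E)%E].
have Pmon n e e' p : e <= e' -> P n e p -> P n e' p.
  move=> ee [Kp pn pl pc pE]; split => //.
  - by move=> t s; apply: le_trans (pl t s) _; rewrite ler_wpM2r.
  - by move=> t; exact: le_trans ee.
  - by apply: le_trans pE _; apply: leeD2l; rewrite lee_fin.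
have Pex e : 0 < e -> exists N, forall n, (N <= n)%N -> exists p, P n e p.
  exact: recovery.
have [u [uP uE]] := diagonal_sequence g Pmon Pex.
exists u; split.
- move=> n; have [->|[e [e0 [Kp pn _ _ _]]]] := uP n.
    by split; [split; [exact: gA|left]|exact: gK].
  have pA : arclength_curves (u n) by case: pn => a [].
  by split; [split; [exact: pA|right; exists n]|exact: Kp].
- have nrm_small e : 0 < e -> exists N, forall n, (N <= n)%N -> (nrm (u n - g)%R <= e%:E)%E.
    move=> e0; have e2 : 0 < e / 2 by rewrite divr_gt0.
    have [N hN] := uE _ e2; exists N => n /hN[_ _ pl pc _].
    apply: le_trans (curve_norm_le hnrm hq (ltW e2) pc pl) _.
    by rewrite lee_fin mulrC divfK.
  have nrm_ge0 n : (0 <= nrm (u n - g)%R)%E.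
    by apply: le_trans (curve_norm_ge _ hnrm); exact: Lq_norm_ge0.
  (* Neighbourhoods of [0%E] are tested on reals, since the norms are nonnegative and eventually at
     most r/2. *)
  move=> A nA; have /nbhs_ballP[r /= r0 hr] : nbhs (0 : R) (fun y => A y%:E) by exact: nA.
  have r2 : 0 < r / 2 by rewrite divr_gt0.
  have [N hN] := nrm_small _ r2; exists N => // n /= /hN.
  have := nrm_ge0 n; case: (nrm _) => [y| |]//; rewrite !lee_fin => y0 yr.
  by apply: hr; rewrite /ball/= sub0r normrN ger0_norm//; lra.
- apply: limn_esup_le => e e0; have [N hN] := uE _ e0.
  by exists N => n /hN[].
Qed.
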